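(* Let $g(z)=\sum_{n=0}^\infty \eta_n z^n$ be analytic in the unit disc $\mathbb D$, and let $\mathcal R_\eta$ be the associated Rhaly operator. Let $1<p<\infty$ and $a,b>-1$ be such that $p-2<a<\min\{p-1+b,\,2p-2\}$ and $a-b+1>0$, and put $s=\frac{a-b+1}{p}$. Then: (i) $\mathcal R_{\eta}\in\mathcal B(D^p_a,D^p_b)$ if and only if $g\in\Lambda^p_s$. (ii) $\mathcal R_{\eta}\in\mathcal K(D^p_a,D^p_b)$ if and only if $g\in\lambda^p_s$.
   Context: $\mathbb D=\{z\in\mathbb C:|z|<1\}$, $\mathrm{Hol}(\mathbb D)$ is the space of analytic functions in $\mathbb D$, and $dA$ is area Lebesgue measure on $\mathbb D$. For $0<r<1$, $M_p(r,f)=\left(\frac1{2\pi}\int_0^{2\pi}|f(re^{it})|^p\,dt\right)^{1/p}$. Weighted Dirichlet spaces: for $\alpha>-1$, $D^p_\alpha$ consists of those $f\in\mathrm{Hol}(\mathbb D)$ such that $f'$ belongs to the weighted Bergman space $A^p_\alpha$, i.e. $\int_{\mathbb D}|f'(z)|^p(1-|z|^2)^\alpha\,dA(z)<\infty$, with norm $\|f\|_{D^p_\alpha}^p=|f(0)|^p+\int_{\mathbb D}|f'(z)|^p(1-|z|^2)^\alpha\,dA(z)$. Rhaly operator: for $f(z)=\sum_{k=0}^\infty a_kz^k\in\mathrm{Hol}(\mathbb D)$, $\mathcal R_{\eta}(f)(z)=\sum_{n=0}^\infty\eta_n\left(\sum_{k=0}^n a_k\right)z^n$, $z\in\mathbb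 D$. (When $g(z)=\sum\eta_nz^n$ is analytic in $\mathbb D$, this defines an analytic function in $\mathbb D$.) Mean Lipschitz spaces: for $1\le p<\infty$ and $0<\alpha\le1$, $\Lambda^p_\alpha$ is the space of $f\in\mathrm{Hol}(\mathbb D)$ with $M_p(r,f')=O\left((1-r)^{\alpha-1}\right)$ as $r\to1^-$; $\lambda^p_\alpha$ is the corresponding space with $O$ replaced by $o$. For Banach spaces $X,Y$ of analytic functions in $\mathbb D$, $\mathcal B(X,Y)$ denotes the continuous linear operators from $X$ into $Y$, and $\mathcal K(X,Y)$ the compact linear operators from $X$ into $Y$; $\mathcal R_\eta\in\mathcal B(X,Y)$ (resp. $\mathcal K(X,Y)$) means that $\mathcal R_\eta$ maps $X$ into $Y$ and is bounded (resp. compact). *)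

(* Defs.v *)
From HB Require Import structures.
From mathcomp Require Import all_boot all_order all_algebra.
From mathcomp Require Import all_classical all_reals all_analysis.
From mathcomp Require Export complex.

Set Implicit Arguments.
Unset Strict Implicit.
Unset Printing Implicit Defensive.

Import Order.TTheory GRing.Theory Num.Theory.
Import numFieldNormedType.Exports.
Import ComplexField.Normc.

Local Open Scope classical_set_scope.
Local Open Scope ring_scope.
Local Open Scope complex_scope.

(* R[i] carries the topology, norm and module structure of a field over
   itself, so that [derive1] below is the complex derivative. *)
HB.instance Definition _ (R : realType) := NormedModule.copy R[i] R[i]^o.

Section DiscSpaces.
Variable R : realType.
Implicit Types (f h : R[i] -> R[i]) (c : nat -> R[i]) (p alpha s r : R).

Definition disc : set R[i] := [set z | `|z| < 1].

(* f(z) = \sum_k c_k z^k for every z in the disc; in particular the series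
   converges there.  Values of f outside the disc are irrelevant. *)
Definition expansion_on_disc c f : Prop :=
  forall z, disc z -> series (fun k => c k * z ^+ k) @ \oo --> f z.

(* Analytic functions in the disc, as sums of power series about 0. *)
Definition Hol : set (R[i] -> R[i]) := [set f | exists c, expansion_on_disc c f].

Definition taylor_coef f (k : nat) : R[i] := derive1n k f 0 / k`!%:R.

(* Area measure is the product Lebesgue measure in the coordinates x +i* y. *)
Definition bergman_integral p alpha f : \bar R :=
  (\int[(@lebesgue_measure R \x @lebesgue_measure R)]_(w in [set w | disc (w.1 +i* w.2)])
     (normc (f (w.1 +i* w.2)) `^ p
        * (1 - normc (w.1 +i* w.2) ^+ 2) `^ alpha)%:E)%E.

Definition integral_mean p r f : R :=
  ((2 * pi)^-1 *
     \int[@lebesgue_measure R]_(t in `[0, 2 * pi])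
        normc (f ((r * cos t) +i* (r * sin t))) `^ p) `^ p^-1.

(* A space of analytic functions: the set of its elements and its norm. The
   norm is extended-valued and only meaningful on the carrier. *)
Record fspace := Fspace {
  carrier : set (R[i] -> R[i]);
  fnorm : (R[i] -> R[i]) -> \bar R }.

Definition dirichlet p alpha : fspace :=
  Fspace
    [set f | Hol f /\ (bergman_integral p alpha (derive1 f) < +oo)%E]
    (fun f => (((normc (f 0)) `^ p)%:E + bergman_integral p alpha (derive1 f))%E
                `^ p^-1)%E.

Definition mean_lipschitz p s : set (R[i] -> R[i]) :=
  [set f | Hol f /\
     (fun r => integral_mean p r (derive1 f)) =O_ (1^'-) (fun r => (1 - r) `^ (s - 1))].

Definition little_mean_lipschitz p s : set (R[i] -> R[i]) :=
  [set f | Hol f /\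
     (fun r => integral_mean p r (derive1 f)) =o_ (1^'-) (fun r => (1 - r) `^ (s - 1))].

(* [limn] is the sum of the series wherever it converges; for f in Hol, and eta
   the coefficients of a function of Hol, that is on the whole disc. *)
Definition rhaly (eta : nat -> R[i]) f : R[i] -> R[i] :=
  fun z => limn (series (fun n =>
    eta n * (\sum_(0 <= k < n.+1) taylor_coef f k) * z ^+ n)).

(* Linearity is tested on the disc, where elements of a space are determined. *)
Definition linear_into (X Y : fspace) (T : (R[i] -> R[i]) -> R[i] -> R[i]) :=
  (forall f, carrier X f -> carrier Y (T f)) /\
  (forall (k : R[i]) f h, carrier X f -> carrier X h ->
     forall z, disc z -> T (k \*: f \+ h) z = k * T f z + T h z).

Definition bounded_operator (X Y : fspace) T : Prop :=
  linear_into X Y T /\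
  exists C : R, forall f, carrier X f -> (fnorm Y (T f) <= C%:E * fnorm X f)%E.

(* Every norm-bounded sequence of X has a subsequence whose image converges in
   the norm of Y to an element of Y. *)
Definition compact_operator (X Y : fspace) T : Prop :=
  linear_into X Y T /\
  forall u : nat -> R[i] -> R[i],
    (forall n, carrier X (u n)) ->
    (exists M : R, forall n, (fnorm X (u n) <= M%:E)%E) ->
    exists (phi : nat -> nat) (h : R[i] -> R[i]),
      [/\ {homo phi : m n / (m < n)%N}, carrier Y h
        & fnorm Y (T (u (phi n)) \- h) @[n --> \oo] --> 0%E].

End DiscSpaces.

(* Main.v *)
Require Import Defs.
From HB Require Import structures.
From mathcomp Require Import all_boot all_order all_algebra.
From mathcomp Require Import all_classical all_reals all_analysis.
From mathcomp Require Import measurable_realfun ring lra.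

(** Write [M_p(r, f)] for the integral mean and [r_j = 1 - 2^-j].

    Everything is read on the dyadic circles.  Area is invariant under rotations
    and integral means grow with the radius, so the Bergman integral of [f'] is
    comparable with the sum over [j] of [2^(-j(a+1)) M_p(r_j, f')^p]
    ([dsum_le_bergman], [bergman_le_dsum]).  For the same reason [g] belongs to
    the mean Lipschitz space if and only if [M_p(r_j, g')] is [O(2^(j(1-s)))], and
    to the little space if and only if it is [o(2^(j(1-s)))] ([mean_lipschitzP],
    [little_mean_lipschitzP]).  The means have the usual properties: Young's
    inequality for Hadamard products ([conv_young]), growth with the radius
    ([Mp_le]), and bounds for the Cauchy kernel ([cauchy_norm_mean]).  They are
    derived from trigonometric polynomials, whose convolutions are finite sums
    over equally spaced nodes ([trig_conv]).

    Sufficiency.  The partial sums of the coefficients of [f] are the coefficients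
    of [F(z) = f(z) / (1 - z)], so the image of [f] is the Hadamard product of [g]
    and [F], and by Young's inequality its derivative has means at most of the
    order of [M_p(r, g') M_1(r, F)] ([Mp_rhaly]).  It remains to bound the sum of
    [2^(-j(a+2-p)) M_1(r_j, F)^p] by the norm of [f]; this is
    [partial_sums_estimate].  There Hoelder's inequality with a large exponent
    [p1] gives [M_1(r_j, F) <= C 2^(j/p1) M_p1(r_j, f)], the mean of [f] is
    telescoped over the circles of radii [r_i], [i < j], each increment is
    interpolated between its mean of order [p] and its supremum, and the resulting
    double sum is a discrete Hardy inequality.  The hypothesis [p - 2 < a] leaves
    room for the loss [2^(j/p1)].

    Necessity.  The function [w(z) = - (1 - rho) z / (1 - rho z)] is mapped to
    [g(rho z) - g(z)], and because [a < 2p - 2] the [p]-th power of its norm is at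
    most of the order of [(1 - rho)^(a+2-p)] ([probe_dsum]).  With [rho = r_k] this
    yields [M_p(r_(k+1), g') <= M_p(r_k, g') + C 2^(k(1-s))] ([symbol_increment]);
    as [s < 1], which is the hypothesis [a < p - 1 + b], the increments sum up to
    the bound that is wanted.

    Compactness.  If [g] is in the little space, a bounded sequence has a
    subsequence that converges coefficientwise to a member of the space.  The
    images of the differences are small on any finite number of dyadic circles by
    this convergence, and on the remaining ones because the symbol is
    ([rhaly_dsum_small]).  Conversely, the images of the normalized functions [w]
    tend to zero coefficientwise as [rho] tends to one, hence in norm when the
    operator is compact; so the increments above are [o(2^(k(1-s)))]
    ([little_of_compact]). *)

Set Implicit Arguments.
Unset Strict Implicit.
Unset Printing Implicit Defensive.

Import Order.TTheory GRing.Theory Num.Theory.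
Import numFieldNormedType.Exports.
Import ComplexField.Normc.

Local Open Scope classical_set_scope.
Local Open Scope ring_scope.
Local Open Scope complex_scope.

Local Notation Re := complex.Re.
Local Notation Im := complex.Im.

(** * Complex numbers and their sequences *)

Section ComplexBasics.
Context {R : realType}.
Implicit Types (z w : R[i]) (r x : R).

Lemma normC_normc z : `|z| = (normc z)%:C.
Proof. by []. Qed.

Lemma normc_ge0 z : 0 <= normc z.
Proof. by case: z => a b; rewrite /normc sqrtr_ge0. Qed.

Lemma normc_real x : normc x%:C = `|x|.
Proof. by rewrite /normc /= expr0n addr0 sqrtr_sqr. Qed.

Lemma normcX z n : normc (z ^+ n) = normc z ^+ n.
Proof.
elim: n => [|n IH]; first by rewrite !expr0 normc1.
by rewrite !exprS normcM IH.
Qed.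

Lemma normcBC z w : normc (z - w) = normc (w - z).
Proof. by rewrite -normcN opprB. Qed.

Lemma le_normc_sum (I : Type) (s : seq I) (P : pred I) (F : I -> R[i]) :
  normc (\sum_(i <- s | P i) F i) <= \sum_(i <- s | P i) normc (F i).
Proof.
elim/big_rec2: _ => [|i y1 y2 _ h]; first by rewrite normc0.
by rewrite (le_trans (le_normcD _ _))// lerD2l.
Qed.

Lemma discE z : disc z <-> normc z < 1.
Proof. by rewrite /disc /= normC_normc -ltcR. Qed.

Lemma le_Re_normc z : `|Re z| <= normc z.
Proof.
case: z => a b /=; rewrite -sqrtr_sqr ler_wsqrtr// lerDl sqr_ge0//.
Qed.

Lemma le_Im_normc z : `|Im z| <= normc z.
Proof.
case: z => a b /=; rewrite -sqrtr_sqr ler_wsqrtr// lerDr sqr_ge0//.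
Qed.

Lemma le_normc_ReIm z : normc z <= `|Re z| + `|Im z|.
Proof.
rewrite {1}[z]complexE (le_trans (le_normcD _ _))//.
by rewrite normcM !normc_real /normc /= expr0n expr1n add0r sqrtr1 mul1r.
Qed.

Lemma ler_normcB z w : normc z - normc w <= normc (z - w).
Proof. by rewrite lerBlDr -{1}(subrK w z) le_normcD. Qed.

Lemma cvgc_normP (T : Type) (F : set_system T) {FF : Filter F} (f : T -> R[i]) (l : R[i]) :
  f @ F --> l <-> forall e : R, 0 < e -> \forall x \near F, normc (f x - l) < e.
Proof.
split=> [/cvgrPdist_lt fl e e0|fl].
  have e0' : 0 < e%:C by rewrite -[0]/(0%:C) ltcR.
  apply: filterS (fl _ e0') => x; rewrite normC_normc ltcR.
  by rewrite normcBC.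
apply/cvgrPdist_lt => e e0.
have : e \is Num.real by rewrite ger0_real// ltW.
move=> /complex_realP[k ke]; rewrite ke in e0 *.
rewrite -[0]/(0%:C) ltcR in e0.
by apply: filterS (fl _ e0) => x; rewrite normC_normc ltcR normcBC.
Qed.

Lemma cvgc_seqP (f : nat -> R[i]) (l : R[i]) :
  f @ \oo --> l <->
  forall e : R, 0 < e -> exists N, forall n, (N <= n)%N -> normc (f n - l) < e.
Proof.
split=> [/cvgc_normP fl e /fl[N _ NP]|fl]; first by exists N => n; exact: NP.
by apply/cvgc_normP => e /fl[N NP]; exists N.
Qed.

Lemma cvgc_unique (f : nat -> R[i]) (l : R[i]) : f @ \oo --> l -> limn f = l.
Proof. by move=> /cvg_lim; apply; exact: norm_hausdorff. Qed.

Lemma cvgc_ReIm (f : nat -> R[i]) (x y : R) :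
  (fun n => Re (f n)) @ \oo --> x -> (fun n => Im (f n)) @ \oo --> y ->
  f @ \oo --> x +i* y.
Proof.
move=> /cvgrPdist_lt fx /cvgrPdist_lt fy; apply/cvgc_normP => e e0.
have e2 : 0 < e / 2 by rewrite divr_gt0.
near=> n.
have Hx : `|x - Re (f n)| < e / 2 by near: n; exact: fx.
have Hy : `|y - Im (f n)| < e / 2 by near: n; exact: fy.
apply: le_lt_trans (le_normc_ReIm _) _.
rewrite [e]splitr; move: Hx Hy; case: (f n) => a b /=.
by rewrite (distrC x) (distrC y); exact: ltrD.
Unshelve. all: end_near. Qed.

End ComplexBasics.

(** * Geometric bounds and power series *)

Section Geometric.
Context {R : realType}.
Implicit Types (x u v K : R).

Lemma sum_geo_le x n : 0 <= x < 1 -> \sum_(k < n) x ^+ k <= (1 - x)^-1.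
Proof.
move=> /andP[x0 x1]; have x1' : 0 < 1 - x by rewrite subr_gt0.
rewrite -[leRHS]mul1r ler_pdivlMr//.
have -> : (\sum_(i < n) x ^+ i) * (1 - x) = 1 - x ^+ n.
  by rewrite mulrC -(opprB x) mulNr -subrX1 opprB.
by rewrite gerBl exprn_ge0.
Qed.

Lemma nat_geo_le x n : 0 <= x < 1 -> n.+1%:R * x ^+ n <= (1 - x)^-1.
Proof.
move=> x01; apply: (@le_trans _ _ (\sum_(k < n.+1) x ^+ k)); last exact: sum_geo_le.
move: x01 => /andP[x0 x1].
have -> : n.+1%:R * x ^+ n = \sum_(k < n.+1) x ^+ n.
  by rewrite sumr_const card_ord mulr_natl.
apply: ler_sum => k _; apply: ler_wiXn2l => //; first exact: ltW.
by rewrite -ltnS.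
Qed.

(** Estimates for polynomials pass to power series through this lemma, the
    truncation error being geometric. *)
Lemma le_geo K x u v : 0 <= x < 1 -> (forall n, u <= v + K * x ^+ n) -> u <= v.
Proof.
move=> /andP[x0 x1] H.
have xl : (fun n => v + K * x ^+ n) @ \oo --> v.
  rewrite -[X in _ --> X]addr0; apply: cvgD; first exact: cvg_cst.
  rewrite -[X in _ --> X](mulr0 K); apply: cvgMr.
  by apply: cvg_expr; rewrite ger0_norm.
by apply: (ler_cvg_to (cvg_cst u) xl); exact: nearW.
Qed.

End Geometric.

HB.lock Definition psum (R : realType) (c : nat -> R[i]) (z : R[i]) : R[i] :=
  limn (series (fun k => c k * z ^+ k)).
Arguments psum {R} c z.

Lemma psumE (R : realType) (c : nat -> R[i]) z :
  psum c z = limn (series (fun k => c k * z ^+ k)).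
Proof. by rewrite unlock. Qed.

Section PowerSeries.
Context {R : realType}.
Implicit Types (c d : nat -> R[i]) (z w : R[i]) (r : R).

(** Coefficient sequences whose power series has radius of convergence at
    least one; this form of the condition is the one that passes to products,
    derivatives and partial sums. *)
Definition tame c := forall r, 0 <= r < 1 -> exists B, forall n, normc (c n) * r ^+ n <= B.

Definition shift_deriv c : nat -> R[i] := fun n => n.+1%:R * c n.+1.
Definition partial_sums c : nat -> R[i] := fun n => \sum_(k < n.+1) c k.

Lemma middle r : 0 <= r < 1 -> exists2 rho, 0 < rho < 1 & r < rho.
Proof.
move=> /andP[r0 r1]; exists ((1 + r) / 2); lra.
Qed.

Lemma tame_geo c r : tame c -> 0 <= r < 1 ->
  exists B x, [/\ 0 <= B, 0 <= x < 1 & forall n, normc (c n) * r ^+ n <= B * x ^+ n].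
Proof.
move=> tc r01; have [rho /andP[rho0 rho1] rrho] := middle r01.
have [|B HB] := tc rho; first by rewrite (ltW rho0).
move: r01 => /andP[r0 r1].
exists B, (r / rho); split.
- by apply: le_trans (HB 0%N); rewrite expr0 mulr1 normc_ge0.
- by rewrite divr_ge0// ?(ltW rho0)//= ltr_pdivrMr// mul1r.
- move=> n; have -> : normc (c n) * r ^+ n = normc (c n) * rho ^+ n * (r / rho) ^+ n.
    rewrite expr_div_n mulrA mulrAC mulfK// expf_neq0//; exact: lt0r_neq0.
  by apply: ler_wpM2r => //; rewrite exprn_ge0// divr_ge0// ltW.
Qed.

Lemma tame_sum c r : tame c -> 0 <= r < 1 ->
  exists2 K, 0 <= K & forall n, \sum_(k < n) normc (c k) * r ^+ k <= K.
Proof.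
move=> tc /(tame_geo tc)[B [x [B0 x01 H]]]; exists (B * (1 - x)^-1).
  by rewrite mulr_ge0// invr_ge0 subr_ge0; case/andP: x01 => _ /ltW.
move=> n; apply: (@le_trans _ _ (\sum_(k < n) B * x ^+ k)).
  by apply: ler_sum => k _.
by rewrite -mulr_sumr ler_wpM2l// sum_geo_le.
Qed.

Lemma tameD c d : tame c -> tame d -> tame (c \+ d).
Proof.
move=> tc td r r01; have [B HB] := tc r r01; have [D HD] := td r r01.
exists (B + D) => n; apply: le_trans (lerD (HB n) (HD n)).
rewrite -mulrDl ler_wpM2r ?exprn_ge0 ?le_normcD//.
by case/andP: r01.
Qed.

(** The radius is shared between the factors by a square root. *)
Lemma tameM c d : tame c -> tame d -> tame (fun n => c n * d n).
Proof.
move=> tc td r /andP[r0 r1].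
have s01 : 0 <= Num.sqrt r < 1.
  by rewrite sqrtr_ge0/= -[ltRHS]sqrtr1 ltr_sqrt.
have [B HB] := tc _ s01; have [D HD] := td _ s01.
exists (B * D) => n; rewrite -[in leLHS](sqr_sqrtr r0) -exprM mulnC exprM expr2.
rewrite normcM mulrACA; apply: ler_pM => //;
  by rewrite mulr_ge0 ?normc_ge0// exprn_ge0// sqrtr_ge0.
Qed.

Lemma tameZ k c : tame c -> tame (fun n => k * c n).
Proof.
move=> tc; apply: tameM => // r /andP[r0 r1].
exists (normc k) => n; rewrite -[leRHS]mulr1 ler_wpM2l ?normc_ge0//.
by rewrite exprn_ile1// ltW.
Qed.

Lemma tameB c d : tame c -> tame d -> tame (fun n => c n - d n).
Proof.
move=> tc td; have -> : (fun n => c n - d n) = c \+ (fun n => -1 * d n).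
  by apply/funext => n /=; rewrite mulN1r.
by apply: tameD => //; exact: tameZ.
Qed.

Lemma tame_nat : tame (fun n => n.+1%:R).
Proof.
move=> r r01; exists (1 - r)^-1 => n.
have -> : normc (n.+1%:R : R[i]) = n.+1%:R.
  by rewrite -[n.+1%:R](rmorph_nat (real_complex R)) normc_real ger0_norm.
exact: nat_geo_le.
Qed.

Lemma tame_behead c : tame c -> tame (fun n => c n.+1).
Proof.
move=> tc r r01; have [rho /andP[rho0 rho1] rrho] := middle r01.
have [|B HB] := tc rho; first by rewrite (ltW rho0).
exists (B / rho) => n; rewrite ler_pdivlMr//.
apply: le_trans (HB n.+1); rewrite -mulrA ler_wpM2l ?normc_ge0//.
rewrite exprSr; apply: ler_wpM2r; first exact: ltW.
case/andP: r01 => r0 _.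
by apply: lerXn2r; rewrite ?nnegrE// ?(ltW rho0)// ltW.
Qed.

Lemma tame_cons c k : tame c -> tame (fun n => if n is m.+1 then c m else k).
Proof.
move=> tc r r01; have [B HB] := tc r r01; exists (Num.max (normc k) B) => -[|n].
  by rewrite expr0 mulr1 le_max lexx.
rewrite le_max; apply/orP; right; apply: le_trans (HB n).
case/andP: r01 => r0 r1.
rewrite exprS mulrCA -[leRHS]mul1r ler_wpM2r ?(ltW r1)//.
by rewrite mulr_ge0 ?normc_ge0// exprn_ge0.
Qed.

Lemma tame_deriv c : tame c -> tame (shift_deriv c).
Proof. by move=> tc; apply: tameM; [exact: tame_nat|exact: tame_behead]. Qed.

Lemma tame_partial_sums c : tame c -> tame (partial_sums c).
Proof.
move=> tc r r01; have [rho /andP[rho0 rho1] rrho] := middle r01.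
have [|B HB] := tc rho; first by rewrite (ltW rho0).
have B0 : 0 <= B by apply: le_trans (HB 0%N); rewrite expr0 mulr1 normc_ge0.
case/andP: (r01) => r0 r1.
have x01 : 0 <= r / rho < 1.
  by rewrite divr_ge0// ?(ltW rho0)//= ltr_pdivrMr// mul1r.
exists (B * (1 - r / rho)^-1) => n.
apply: (@le_trans _ _ (B * (n.+1%:R * (r / rho) ^+ n))); last first.
  by rewrite ler_wpM2l// nat_geo_le.
have -> : B * (n.+1%:R * (r / rho) ^+ n) = \sum_(k < n.+1) B / rho ^+ n * r ^+ n.
  rewrite sumr_const card_ord -[RHS]mulr_natl expr_div_n.
  by rewrite mulrCA [in RHS]mulrAC -[in RHS]mulrA.
rewrite -mulr_suml; apply: ler_wpM2r; first exact: exprn_ge0.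
apply: le_trans (le_normc_sum _ _ _) _.
apply: ler_sum => k _; rewrite ler_pdivlMr ?exprn_gt0//.
apply: le_trans (HB k); rewrite ler_wpM2l ?normc_ge0//.
by apply: ler_wiXn2l; rewrite ?(ltW rho0) ?(ltW rho1)// -ltnS.
Qed.

Lemma abs_cvg_re (u : nat -> R) (B x : R) : 0 <= x < 1 -> (forall n, `|u n| <= B * x ^+ n) ->
  cvgn (series u).
Proof.
move=> /andP[x0 x1] H; apply: normed_cvg.
apply: (@series_le_cvg _ _ (geometric B x)) => //.
- by move=> n /=.
- by move=> n; apply: (le_trans (normr_ge0 (u n)) (H n)).
- by apply: is_cvg_geometric_series; rewrite ger0_norm.
Qed.

Lemma psum_cvg c z : tame c -> normc z < 1 ->
  series (fun k => c k * z ^+ k) @ \oo --> psum c z.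
Proof.
move=> tc z1.
have [|B [x [B0 x01 H]]] := @tame_geo c (normc z) tc; first by rewrite normc_ge0.
set u := fun k => c k * z ^+ k.
have Hu n : normc (u n) <= B * x ^+ n by rewrite /u normcM normcX.
have cre : cvgn (series (fun n => Re (u n))).
  by apply: (@abs_cvg_re _ B x) => // n; apply: le_trans (Hu n); exact: le_Re_normc.
have cim : cvgn (series (fun n => Im (u n))).
  by apply: (@abs_cvg_re _ B x) => // n; apply: le_trans (Hu n); exact: le_Im_normc.
have reE n : Re (series u n) = series (fun n => Re (u n)) n.
  rewrite /series /= (big_morph _ (id1 := 0) (op1 := +%R))//.
  by case=> ? ? [].
have imE n : Im (series u n) = series (fun n => Im (u n)) n.
  rewrite /series /= (big_morph _ (id1 := 0) (op1 := +%R))//.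
  by case=> ? ? [].
have : series u @ \oo --> (limn (series (fun n => Re (u n)))) +i* (limn (series (fun n => Im (u n)))).
  apply: cvgc_ReIm.
    by under eq_fun do rewrite reE.
  by under eq_fun do rewrite imE.
by move=> h; rewrite psumE (cvgc_unique h).
Qed.

Lemma normc_lim_le (u : nat -> R[i]) l x (B : R) : u @ \oo --> l ->
  (\forall n \near \oo, normc (u n - x) <= B) -> normc (l - x) <= B.
Proof.
move=> /cvgc_normP ul H; apply/ler_addgt0Pl => e e0.
have [n [Hn1 Hn2]] : exists n, normc (u n - l) < e /\ normc (u n - x) <= B.
  by apply: (@filter_ex _ \oo); apply: filterI => //; exact: ul.
rewrite -(subrKA (u n)) (le_trans (le_normcD _ _))// lerD//.
by rewrite normcBC ltW.
Qed.

(** The bound depends on the coefficients only through [B] and [x]. This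
    uniformity is what makes coefficientwise convergence of a dominated family
    locally uniform. *)
Lemma psum_tail_geo c r (B x : R) : tame c -> r < 1 -> 0 <= B -> 0 <= x < 1 ->
  (forall n, normc (c n) * r ^+ n <= B * x ^+ n) -> forall z, normc z <= r -> forall n,
  normc (psum c z - \sum_(k < n) c k * z ^+ k) <= B * (1 - x)^-1 * x ^+ n.
Proof.
move=> tc r1 B0 x01 H z zr n.
have r0 : 0 <= r by exact: le_trans (normc_ge0 z) zr.
have z1 : normc z < 1 by exact: le_lt_trans r1.
apply: normc_lim_le (psum_cvg tc z1) _.
near=> m.
have nm : (n <= m)%N by near: m; exists n.
rewrite /series /= -[X in _ - X](big_mkord xpredT (fun k => c k * z ^+ k)).
rewrite (big_cat_nat (leq0n n) nm)//= addrAC subrr add0r.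
apply: le_trans (le_normc_sum _ _ _) _.
rewrite -{1}(add0n n) big_addn.
apply: (@le_trans _ _ (\sum_(0 <= i < m - n) B * x ^+ n * x ^+ i)).
  apply: ler_sum => i _; rewrite normcM normcX.
  rewrite -mulrA -exprD addnC; apply: le_trans (H _).
  by rewrite ler_wpM2l ?normc_ge0//; apply: lerXn2r; rewrite ?nnegrE ?normc_ge0.
rewrite -mulr_sumr big_mkord mulrAC.
apply: ler_wpM2r; first by apply: exprn_ge0; case/andP: x01.
by apply: ler_wpM2l => //; exact: sum_geo_le.
Unshelve. all: end_near. Qed.

Lemma psum_tail c r : tame c -> 0 <= r < 1 ->
  exists K x, [/\ 0 <= K, 0 <= x < 1 & forall z, normc z <= r -> forall n,
   normc (psum c z - \sum_(k < n) c k * z ^+ k) <= K * x ^+ n].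
Proof.
move=> tc r01; case/andP: (r01) => r0 r1.
have [B [x [B0 x01 H]]] := tame_geo tc r01.
exists (B * (1 - x)^-1), x; split=> //; last exact: psum_tail_geo.
by rewrite mulr_ge0// invr_ge0 subr_ge0; case/andP: x01 => _ /ltW.
Qed.

Lemma psum0 c : psum c 0 = c 0%N.
Proof.
rewrite psumE; apply: cvgc_unique; apply/cvgc_seqP => e e0; exists 1%N => -[//|n] _.
rewrite /series /= big_nat_recl//= expr0 mulr1 big1 ?addr0 ?subrr ?normc0//.
by move=> i _; rewrite expr0n mulr0.
Qed.

Lemma psumD c d z : tame c -> tame d -> normc z < 1 ->
  psum (c \+ d) z = psum c z + psum d z.
Proof.
move=> tc td z1; rewrite psumE; apply: cvgc_unique.
rewrite (_ : series _ = series (fun k => c k * z ^+ k) \+ series (fun k => d k * z ^+ k)).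
  exact: cvgD (psum_cvg tc z1) (psum_cvg td z1).
apply/funext => n /=.
by rewrite /series/= -big_split; apply: eq_bigr => k _ /=; rewrite mulrDl.
Qed.

Lemma psumZ k c z : tame c -> normc z < 1 ->
  psum (fun n => k * c n) z = k * psum c z.
Proof.
move=> tc z1; rewrite psumE; apply: cvgc_unique.
rewrite (_ : series _ = fun n => k * series (fun k => c k * z ^+ k) n).
  exact: cvgMr (psum_cvg tc z1).
apply/funext => n /=.
by rewrite /series/= mulr_sumr; apply: eq_bigr => i _; rewrite mulrA.
Qed.

Lemma psumB c d z : tame c -> tame d -> normc z < 1 ->
  psum (fun n => c n - d n) z = psum c z - psum d z.
Proof.
move=> tc td z1.
have -> : (fun n => c n - d n) = c \+ (fun n => -1 * d n).
  by apply/funext => n /=; rewrite mulN1r.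
by rewrite psumD// ?psumZ ?mulN1r//; exact: tameZ.
Qed.

Lemma psum_cons c z : tame c -> normc z < 1 ->
  psum (fun n => if n is m.+1 then c m else 0) z = z * psum c z.
Proof.
move=> tc z1; rewrite psumE; apply: cvgc_unique.
rewrite -(cvg_shiftS _ _).
rewrite (_ : [sequence _]_n = fun n => z * series (fun k => c k * z ^+ k) n).
  exact: cvgMr (psum_cvg tc z1).
apply/funext => n /=.
rewrite /series/= mulr_sumr [LHS]big_nat_recl//= mul0r add0r.
by apply: eq_bigr => i _; rewrite exprS mulrCA.
Qed.

Lemma psum_scale c (r : R[i]) z : psum (fun n => c n * r ^+ n) z = psum c (r * z).
Proof.
rewrite !psumE; congr (limn (series _)); apply/funext => n.
by rewrite exprMn mulrA.
Qed.

Lemma tame_scale c (r : R[i]) : tame c -> normc r <= 1 -> tame (fun n => c n * r ^+ n).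
Proof.
move=> tc r1; apply: tameM => // s /andP[s0 s1]; exists 1 => n.
rewrite normcX -exprMn exprn_ile1// ?mulr_ge0 ?normc_ge0//.
by rewrite mulr_ile1 ?normc_ge0// ltW.
Qed.

End PowerSeries.

(** * Analytic functions in the disc *)

Section Analytic.
Context {R : realType}.
Implicit Types (c d : nat -> R[i]) (z w : R[i]) (r : R) (f : R[i] -> R[i]).

Lemma psum_bounded c r : tame c -> 0 <= r < 1 ->
  exists2 K, 0 <= K & forall z, normc z <= r -> normc (psum c z) <= K.
Proof.
move=> tc r01; have [K [x [K0 x01 H]]] := psum_tail tc r01.
exists K => // z zr; have := H z zr 0%N.
by rewrite big_ord0 subr0 expr0 mulr1.
Qed.

Lemma normc_nat n : normc (n%:R : R[i]) = n%:R.
Proof. by rewrite -[n%:R](rmorph_nat (real_complex R)) normc_real ger0_norm. Qed.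

(** Induction on [k]: [w] times one remainder plus [k z^(k-1) (w - z)^2] is the
    next one. The factor [r ^+ 2] on the left replaces an exponent [k - 2], which
    would be truncated for small [k]. *)
Lemma pow_taylor2 r z w k : 0 <= r -> normc z <= r -> normc w <= r ->
  normc (w ^+ k - z ^+ k - (w - z) * (k%:R * z ^+ k.-1)) * r ^+ 2
    <= k%:R ^+ 2 * r ^+ k * normc (w - z) ^+ 2.
Proof.
move=> r0 zr wr; elim: k => [|k IH].
  by rewrite !expr0 subrr mul0r mulr0 subrr normc0 expr0n/= !mul0r.
have -> : w ^+ k.+1 - z ^+ k.+1 - (w - z) * (k.+1%:R * z ^+ k.+1.-1) =
  w * (w ^+ k - z ^+ k - (w - z) * (k%:R * z ^+ k.-1)) + k%:R * z ^+ k.-1 * (w - z) ^+ 2.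
  case: k {IH} => [|k]; first by rewrite /= !expr0 !expr1; ring.
  by rewrite /= !exprS -[in LHS]natr1 -[in RHS]natr1; ring.
set e := (w ^+ k - _ - _) in IH *; set D := normc (w - z) in IH *.
apply: (@le_trans _ _ ((r * normc e + k%:R * r ^+ k.-1 * D ^+ 2) * r ^+ 2)).
  apply: ler_wpM2r; first exact: exprn_ge0.
  apply: le_trans (le_normcD _ _) _; rewrite !normcM !normcX; apply: lerD.
    by apply: ler_wpM2r; rewrite ?normc_ge0.
  have -> : normc (k%:R : R[i]) = k%:R.
    by rewrite -[k%:R](rmorph_nat (real_complex R)) normc_real ger0_norm.
  apply: ler_wpM2r; first exact: sqr_ge0.
  apply: ler_wpM2l => //.
  by apply: lerXn2r; rewrite ?nnegrE ?normc_ge0.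
rewrite mulrDl -mulrA.
have H2 : k%:R * r ^+ k.-1 * D ^+ 2 * r ^+ 2 <= k%:R * r ^+ k.+1 * D ^+ 2.
  case: k {IH e} => [|k]; first by rewrite !mul0r.
  by rewrite /= [r ^+ k.+2]exprS [r ^+ k.+1]exprS le_eqVlt; apply/orP; left; apply/eqP; ring.
have H1 : r * (normc e * r ^+ 2) <= k%:R ^+ 2 * r ^+ k.+1 * D ^+ 2.
  rewrite [r ^+ k.+1]exprS (_ : _ * (r * r ^+ k) * _ = r * (k%:R ^+ 2 * r ^+ k * D ^+ 2)); last by ring.
  exact: ler_wpM2l.
apply: le_trans (lerD H1 H2) _.
rewrite -!mulrDl; apply: ler_wpM2r; first exact: sqr_ge0.
apply: ler_wpM2r; first exact: exprn_ge0.
by rewrite -natr1; have : (0 : R) <= k%:R by []; nra.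
Qed.

Lemma psum_taylor2 c r : tame c -> 0 <= r < 1 ->
  exists2 K, 0 <= K & forall z w, normc z <= r -> normc w <= r ->
    normc (psum c w - psum c z - (w - z) * psum (shift_deriv c) z)
      <= K * normc (w - z) ^+ 2.
Proof.
move=> tc r01.
wlog r2 : r r01 / 1 / 2 <= r => [H|].
  have [r2|r2] := leP (1 / 2) r; first exact: H.
  have [||K K0 HK] := H (1 / 2) => //; first lra.
  by exists K => // z w zr wr; apply: HK; [apply: le_trans zr _|apply: le_trans wr _]; exact: ltW.
case/andP: (r01) => r0 r1.
have rp : 0 < r by lra.
have t2 : tame (fun n => n.+1%:R * (n.+1%:R * c n)).
  by do 2 (apply: tameM; first exact: tame_nat).
have [K0 K00 HK0] := tame_sum t2 r01.
exists (K0 / r ^+ 2); first by rewrite divr_ge0// exprn_ge0.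
move=> z w zr wr.
have z1 : normc z < 1 by exact: le_lt_trans r1.
have w1 : normc w < 1 by exact: le_lt_trans r1.
set u := fun n => series (fun k => c k * w ^+ k) n.+1 - series (fun k => c k * z ^+ k) n.+1
   - (w - z) * series (fun k => shift_deriv c k * z ^+ k) n.
have ul : u @ \oo --> psum c w - psum c z - (w - z) * psum (shift_deriv c) z.
  apply: cvgB.
    apply: cvgB.
      by have := psum_cvg tc w1; rewrite -cvg_shiftS.
    by have := psum_cvg tc z1; rewrite -cvg_shiftS.
  apply: cvgMr.
  by apply: psum_cvg => //; exact: tame_deriv.
rewrite -[psum c w - _ - _]subr0.
apply: normc_lim_le ul _; apply: nearW => n.
rewrite subr0 /u /series /=.
rewrite -sumrB mulr_sumr big_nat_recl// !expr0 subrr add0r -sumrB big_mkord.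
apply: le_trans (le_normc_sum _ _ _) _.
set D := normc (w - z).
apply: (@le_trans _ _ (\sum_(i < n) normc (i.+2%:R * (i.+2%:R * c i.+1)) * r ^+ i.+1 / r ^+ 2 * D ^+ 2)).
  apply: ler_sum => i _.
  have -> : c i.+1 * w ^+ i.+1 - c i.+1 * z ^+ i.+1 - (w - z) * (shift_deriv c i * z ^+ i) =
    c i.+1 * (w ^+ i.+1 - z ^+ i.+1 - (w - z) * (i.+1%:R * z ^+ i.+1.-1)).
    by rewrite /shift_deriv /=; ring.
  rewrite !normcM !normc_nat mulrAC ler_pdivlMr ?exprn_gt0//.
  rewrite -[leLHS]mulrA.
  apply: (@le_trans _ _ (normc (c i.+1) * (i.+1%:R ^+ 2 * r ^+ i.+1 * D ^+ 2))).
    by apply: ler_wpM2l; [exact: normc_ge0|exact: pow_taylor2].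
  have -> : i.+2%:R * (i.+2%:R * normc (c i.+1)) * r ^+ i.+1 * D ^+ 2 =
    normc (c i.+1) * (i.+2%:R ^+ 2 * r ^+ i.+1 * D ^+ 2) by ring.
  apply: ler_wpM2l; first exact: normc_ge0.
  apply: ler_wpM2r; first exact: sqr_ge0.
  apply: ler_wpM2r; first exact: exprn_ge0.
  by apply: lerXn2r; rewrite ?nnegrE// ler_nat.
rewrite -mulr_suml; apply: ler_wpM2r; first exact: sqr_ge0.
rewrite -mulr_suml; apply: ler_wpM2r; first by rewrite invr_ge0 exprn_ge0.
apply: le_trans (HK0 n.+1); rewrite big_ord_recl/= lerDr.
by rewrite mulr_ge0 ?normc_ge0// exprn_ge0.
Qed.

Lemma psum_lip c r : tame c -> 0 <= r < 1 ->
  exists2 K, 0 <= K & forall z w, normc z <= r -> normc w <= r ->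
    normc (psum c w - psum c z) <= K * normc (w - z).
Proof.
move=> tc r01; have [K K0 HK] := psum_taylor2 tc r01.
have [B B0 HB] := psum_bounded (tame_deriv tc) r01.
exists (K * 2 + B); first by rewrite addr_ge0// mulr_ge0.
move=> z w zr wr.
rewrite -(subrK ((w - z) * psum (shift_deriv c) z) (psum c w - psum c z)).
apply: le_trans (le_normcD _ _) _; rewrite [leRHS]mulrDl; apply: lerD.
  apply: le_trans (HK _ _ zr wr) _; rewrite expr2 mulrA; apply: ler_wpM2r; first exact: normc_ge0.
  apply: ler_wpM2l => //; apply: le_trans (le_normcD _ _) _; rewrite normcN.
  by case/andP: r01 => _ r1; lra.
by rewrite normcM mulrC ler_wpM2r ?normc_ge0// HB.
Qed.

Lemma dnbhs0_normc_lt (e : R) : 0 < e -> \forall h \near (0 : R[i])^', h != 0 /\ normc h < e.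
Proof.
move=> e0.
have h1 : (fun x : R[i] => x) @ (0 : R[i]) --> (0 : R[i]) by exact: cvg_id.
move/cvgc_normP/(_ e e0) : h1 => /nbhs_dnbhs H.
near=> h; split; first by near: h; exact: nbhs_dnbhs_neq.
by rewrite -[h]subr0; near: h; exact: H.
Unshelve. all: end_near. Qed.

(** The second-order remainder, uniform on a slightly larger disc, bounds the
    difference quotient directly. *)
Lemma derive1_psum c f z : tame c -> (forall w, disc w -> f w = psum c w) ->
  disc z -> derive1 f z = psum (shift_deriv c) z.
Proof.
move=> tc fE /[dup] dz /discE z1.
have [r /andP[r0 r1] zr] : exists2 r, 0 <= r < 1 & normc z < r.
  have [|rho /andP[? ?] ?] := @middle R (normc z); first by rewrite normc_ge0.
  by exists rho => //; rewrite ltW.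
have [K K0 HK] : exists2 K, 0 <= K & forall z w, normc z <= r -> normc w <= r ->
    normc (psum c w - psum c z - (w - z) * psum (shift_deriv c) z) <= K * normc (w - z) ^+ 2.
  by apply: psum_taylor2; rewrite ?r0.
apply: cvg_lim; first exact: norm_hausdorff.
apply/cvgc_normP => e e0.
have d0 : 0 < Num.min (r - normc z) (e / (K + 1)).
  by rewrite lt_min subr_gt0 zr divr_gt0// ltr_wpDl.
near=> h.
have [h0 hd] : h != 0 /\ normc h < Num.min (r - normc z) (e / (K + 1)).
  by near: h; exact: dnbhs0_normc_lt.
move: hd; rewrite lt_min => /andP[hr he].
have zhr : normc (h + z) <= r.
  by apply: le_trans (le_normcD _ _) _; rewrite -lerBrDr ltW.
rewrite !fE//; last by apply/discE; exact: le_lt_trans r1.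
have := HK z (h + z) (ltW zr) zhr; rewrite addrK => H.
have h00 : 0 < normc h by rewrite lt_def normc_ge0 andbT; apply: contra_neq h0 => /eq0_normc.
rewrite -(ltr_pM2l h00) -normcM mulrBr /GRing.scale /= mulrA mulfV// mul1r.
apply: le_lt_trans H _; rewrite expr2 mulrCA ltr_pM2l//.
apply: (@le_lt_trans _ _ ((K + 1) * normc h)).
  by apply: ler_wpM2r; [exact: normc_ge0|lra].
by rewrite mulrC -ltr_pdivlMr// ltr_wpDl.
Unshelve. all: end_near. Qed.

Lemma derive1n_psum c f n z : tame c -> (forall w, disc w -> f w = psum c w) ->
  disc z -> derive1n n f z = psum (iter n shift_deriv c) z.
Proof.
move=> tc fE dz; suff [H _] : (forall z, disc z -> derive1n n f z = psum (iter n shift_deriv c) z) /\ tame (iter n shift_deriv c) by exact: H.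
elim: n {z dz} => [|n [IH tn]]; first by split.
split; last by rewrite iterS; exact: tame_deriv.
by move=> z dz; rewrite iterS -(derive1_psum tn IH).
Qed.

Lemma disc0 : disc (0 : R[i]).
Proof. by apply/discE; rewrite normc0. Qed.

Lemma taylor_coefE c f n : tame c -> (forall w, disc w -> f w = psum c w) ->
  taylor_coef f n = c n.
Proof.
move=> tc fE; rewrite /taylor_coef (derive1n_psum _ tc fE disc0) psum0.
have H k m : m`!%:R * iter k shift_deriv c m = (m + k)`!%:R * c (m + k)%N.
  elim: k m => [|k IH] m; first by rewrite addn0.
  by rewrite iterS /shift_deriv mulrA -natrM mulnC -factS IH addnS.
have := H n 0%N; rewrite fact0 mul1r add0n => ->.
by rewrite mulrAC mulfV ?mul1r// pnatr_eq0 -lt0n fact_gt0.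
Qed.

(** Convergence at the point [r] bounds the terms of the series there. *)
Lemma expansion_tame c f : expansion_on_disc c f ->
  tame c /\ forall z, disc z -> f z = psum c z.
Proof.
move=> H; split; last by move=> z /H /cvgc_unique <-; rewrite psumE.
move=> r /andP[r0 r1].
have /H : disc (r%:C) by apply/discE; rewrite normc_real ger0_norm.
move=> /(cvgP _)/cvg_series_cvg_0/cvgc_seqP/(_ 1 ltr01)[N NP].
exists (1 + \sum_(k < N) normc (c k) * r ^+ k) => n.
have nn k : 0 <= normc (c k) * r ^+ k by rewrite mulr_ge0 ?normc_ge0// exprn_ge0.
have [nN|Nn] := leqP N n.
  have := NP n nN; rewrite subr0 normcM normcX normc_real ger0_norm// => h.
  by apply: le_trans (ltW h) _; rewrite lerDl sumr_ge0.
rewrite (bigD1 (Ordinal Nn))//= addrCA lerDl addr_ge0// sumr_ge0//.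
Qed.

Lemma HolP f : Hol f <-> exists2 c, tame c & forall z, disc z -> f z = psum c z.
Proof.
split=> [[c /expansion_tame[tc fE]]|[c tc fE]]; first by exists c.
by exists c => z dz; rewrite fE//; apply: psum_cvg => //; apply/discE.
Qed.

Lemma Hol_taylor f : Hol f -> tame (taylor_coef f) /\ forall z, disc z -> f z = psum (taylor_coef f) z.
Proof.
move=> /HolP[c tc fE]; have -> : taylor_coef f = c; last by [].
by apply/funext => n; rewrite (taylor_coefE n tc fE).
Qed.

End Analytic.

(** * Means over the circle *)

Section Affine.
Context {R : realType}.
Notation mu := (@lebesgue_measure R).
Local Open Scope ereal_scope.

Definition affine (c k : R) : measurableTypeR R -> measurableTypeR R := fun x => (c * x + k)%R.

Lemma measurable_affine c k : measurable_fun setT (affine c k).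
Proof.
rewrite /affine; apply: continuous_measurable_fun => x.
by apply: cvgD; [apply: cvgMr; exact: cvg_id|exact: cvg_cst].
Qed.

Lemma lebesgue_affine (c k : R) : (0 < c)%R -> forall A : set (measurableTypeR R),
  measurable A -> mu A = c%:E * mu (affine c k @^-1` A).
Proof.
move=> c0 A mA.
have mf := measurable_affine c k.
have mE X : mscale (NngNum (ltW c0)) (pushforward mu (affine c k)) X =
  c%:E * mu (affine c k @^-1` X) by [].
rewrite -mE.
apply: lebesgue_measure_unique => //.
move=> _ [[a b] _ <-].
rewrite [RHS]mE /=.
have -> : affine c k @^-1` `]a, b] = [set` `]((a - k) / c)%R, ((b - k) / c)%R]].
  apply/seteqP; split => x /=; rewrite !in_itv /= /affine ltr_pdivrMr// ler_pdivlMr//;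
   by rewrite ltrBlDr lerBrDr mulrC.
rewrite !lebesgue_measure_itv /= !lte_fin ltr_pM2r ?invr_gt0// ltrBlDr subrK.
case: ifP => _; last by rewrite mule0.
rewrite -!EFinD -EFinM; congr EFin.
by field; rewrite gt_eqF.
Qed.

Lemma ge0_integral_shift (f : R -> \bar R) (k : R) (D : set R) :
  measurable D -> measurable_fun D f -> (forall x, 0 <= f x) ->
  \int[mu]_(x in D) f x = \int[mu]_(x in [set x | D (x + k)%R]) f (x + k)%R.
Proof.
move=> mD mf f0.
have mE := @measurable_affine 1 k.
have -> : \int[mu]_(x in D) f x = \int[pushforward mu (affine 1 k)]_(x in D) f x.
  apply: eq_measure_integral => // A mA _.
  exact: (etrans (lebesgue_affine k ltr01 mA) (mul1e _)).
rewrite (ge0_integral_pushforward mE)//.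
have -> : affine 1 k @^-1` D = [set x | D (x + k)%R].
  by apply/seteqP; split => x /=; rewrite /affine mul1r.
by apply: eq_integral => x _ /=; rewrite /affine mul1r.
Qed.

Lemma ge0_integral_shiftT (f : R -> \bar R) (k : R) :
  measurable_fun setT f -> (forall x, 0 <= f x) ->
  \int[mu]_x f x = \int[mu]_x f (x + k)%R.
Proof. by move=> mf f0; rewrite (@ge0_integral_shift f k setT). Qed.

End Affine.

HB.lock Definition circle_avg (R : realType) (v : R -> R) : R :=
  (2 * pi)^-1 * \int[@lebesgue_measure R]_(t in `[0, 2 * pi]) v t.

Arguments circle_avg {R} v.

Lemma circle_avgE (R : realType) (v : R -> R) :
  circle_avg v = (2 * pi)^-1 * \int[@lebesgue_measure R]_(t in `[0, 2 * pi]) v t.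
Proof. by rewrite unlock. Qed.

Section CircleMean.
Context {R : realType}.
Notation mu := (@lebesgue_measure R).
Implicit Types (v w : R -> R) (p q : R).

Definition periodic2pi v := forall t, v (t + 2 * pi) = v t.

Let pi2_gt0 : 0 < 2 * pi :> R.
Proof. by rewrite mulr_gt0// pi_gt0. Qed.

Lemma continuous_integrable v a b : continuous v -> mu.-integrable `[a, b] (EFin \o v).
Proof.
move=> cv; apply: continuous_compact_integrable; first exact: segment_compact.
exact: continuous_subspaceT.
Qed.

Lemma circle_avg_ge0 v : (forall t, 0 <= v t) -> 0 <= circle_avg v.
Proof.
by move=> v0; rewrite circle_avgE mulr_ge0 ?invr_ge0 ?(ltW pi2_gt0)//; apply: Rintegral_ge0.
Qed.

Lemma circle_avg_le v w : continuous v -> continuous w -> (forall t, v t <= w t) ->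
  circle_avg v <= circle_avg w.
Proof.
move=> cv cw vw; rewrite !circle_avgE ler_wpM2l ?invr_ge0 ?(ltW pi2_gt0)//.
by apply: le_Rintegral => //; exact: continuous_integrable.
Qed.

Lemma circle_avgD v w : continuous v -> continuous w ->
  circle_avg (fun t => v t + w t) = circle_avg v + circle_avg w.
Proof.
move=> cv cw; rewrite !circle_avgE RintegralD// ?mulrDr//; exact: continuous_integrable.
Qed.

Lemma circle_avgZ (k : R) v : continuous v -> circle_avg (fun t => k * v t) = k * circle_avg v.
Proof.
move=> cv; rewrite !circle_avgE RintegralZl//; last exact: continuous_integrable.
exact: mulrCA.
Qed.

Lemma circle_avg_cst (k : R) : circle_avg (fun=> k) = k.
Proof.
rewrite !circle_avgE Rintegral_cst//= lebesgue_measure_itv/= lte_fin pi2_gt0/=.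
by rewrite oppr0 addr0 mulrCA mulVf ?mulr1// gt_eqF.
Qed.

Lemma continuous_sum_ord n (F : 'I_n -> R -> R) : (forall i, continuous (F i)) ->
  continuous (fun t => \sum_(i < n) F i t).
Proof.
elim: n F => [|n IH] F cF.
  rewrite (_ : (fun _ => _) = cst 0); first by move=> ?; exact: cvg_cst.
  by apply/funext => t; rewrite big_ord0.
rewrite (_ : (fun _ => _) = fun t => F ord0 t + \sum_(i < n) F (lift ord0 i) t).
  by move=> t; apply: cvgD; [exact: cF|apply: IH].
by apply/funext => t; rewrite big_ord_recl.
Qed.

Lemma circle_avg_sum n (F : 'I_n -> R -> R) : (forall i, continuous (F i)) ->
  circle_avg (fun t => \sum_(i < n) F i t) = \sum_(i < n) circle_avg (F i).
Proof.
elim: n F => [|n IH] F cF.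
  rewrite big_ord0 -[RHS](circle_avg_cst 0); congr (@circle_avg R _).
  by apply/funext => t; rewrite big_ord0.
rewrite big_ord_recl -IH// -circle_avgD//.
  by congr (@circle_avg R _); apply/funext => t; rewrite big_ord_recl.
by apply: continuous_sum_ord.
Qed.

Lemma periodicMn v (n : nat) t : periodic2pi v -> v (t + n%:R * (2 * pi)) = v t.
Proof.
move=> pv; elim: n => [|n IH]; first by rewrite mul0r addr0.
by rewrite -natr1 mulrDl mul1r addrA pv.
Qed.

(** By periodicity the part of the shifted interval that sticks out past
    [2 * pi] is moved back to the beginning. *)
Lemma circle_avg_shift v s : continuous v -> periodic2pi v -> (forall t, 0 <= v t) ->
  circle_avg (fun t => v (t + s)) = circle_avg v.
Proof.
move=> cv pv v0.
wlog s0 : s / 0 <= s => [H|].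
  have [s0|s0] := leP 0 s; first exact: H.
  have [n Hn] : exists n : nat, 0 <= s + n%:R * (2 * pi).
    exists (Num.truncn (- s / (2 * pi))).+1.
    rewrite -lerBlDl sub0r -ler_pdivrMr//; apply: ltW; exact: truncnS_gt.
  rewrite -(H _ Hn); congr (@circle_avg R _); apply/funext => t.
  by rewrite addrA periodicMn.
wlog s1 : s s0 / s < 2 * pi => [H|].
  pose n := Num.truncn (s / (2 * pi)).
  have /andP[h1 h2] : n%:R <= s / (2 * pi) < n.+1%:R.
    by apply: truncn_itv; rewrite divr_ge0// ltW.
  rewrite ler_pdivlMr// in h1; rewrite ltr_pdivrMr// -natr1 mulrDl mul1r in h2.
  rewrite -(H (s - n%:R * (2 * pi))) ?subr_ge0 ?ltrBlDl//.
  congr (@circle_avg R _); apply/funext => t.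
  by rewrite -[in LHS](subrK (n%:R * (2 * pi)) s) addrA periodicMn.
rewrite !circle_avgE; congr (_ * _); rewrite /Rintegral; congr fine.
have mv : measurable_fun setT (EFin \o v).
  by apply/measurable_EFinP; exact: continuous_measurable_fun.
have e0 x : (0 <= (EFin \o v) x)%E by rewrite lee_fin.
have split_at a b c : a <= b -> b <= c ->
   (\int[mu]_(t in `[a, c]) (v t)%:E = \int[mu]_(t in `[a, b]) (v t)%:E + \int[mu]_(t in `]b, c]) (v t)%:E)%E.
  move=> ab bc; rewrite -ge0_integral_setU//.
  - by rewrite -(@itv_bndbnd_setU _ _ _ (BRight b))//= bnd_simp.
  - exact: measurable_funS mv.
  - by move=> x _; rewrite lee_fin.
  - apply/disj_setPS => x [] /=; rewrite !in_itv/= => /andP[_ h1] /andP[h2 _].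
    by move: (le_lt_trans h1 h2); rewrite ltxx.
have openl a b : (\int[mu]_(t in `[a, b]) (v t)%:E = \int[mu]_(t in `]a, b]) (v t)%:E)%E.
  by rewrite integral_itv_obnd_cbnd//; exact: measurable_funS mv.
transitivity (\int[mu]_(t in `[s, (2 * pi + s)%R]) (v t)%:E)%E.
  rewrite (@ge0_integral_shift _ (EFin \o v) s `[s, 2 * pi + s])//; last exact: measurable_funS mv.
  by congr (integral _ _); apply/seteqP; split => x /=; rewrite !in_itv/= lerDr lerD2r.
rewrite (@split_at s (2 * pi)) ?(ltW s1)// ?lerDl//.
rewrite (@split_at 0 s (2 * pi)) ?(ltW s1)// addeC (openl 0 s) (openl s).
congr (_ + _)%E.
rewrite (@ge0_integral_shift _ (EFin \o v) (2 * pi) `](2 * pi), (2 * pi + s)])//; last exact: measurable_funS mv.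
transitivity (\int[mu]_(x in `]0%R, s]) (v (x + 2 * pi)%R)%:E)%E.
  by congr (integral _ _); apply/seteqP; split => x /=; rewrite !in_itv/= ltrDr addrC lerD2l.
by apply: eq_integral => x _; rewrite pv.
Qed.

Lemma circle_avg_exists v a : continuous v -> (forall s, a <= v s) -> a <= circle_avg v.
Proof.
move=> cv H; rewrite -[a]circle_avg_cst; apply: circle_avg_le => //.
by move=> ?; exact: cvg_cst.
Qed.

End CircleMean.

(** * Power means, with the inequalities of Hoelder and Minkowski *)

HB.lock Definition power_mean (R : realType) (p : R) (v : R -> R) : R :=
  circle_avg (fun t => v t `^ p) `^ p^-1.

Arguments power_mean {R} p v.

Lemma power_meanE (R : realType) (p : R) (v : R -> R) :
  power_mean p v = circle_avg (fun t => v t `^ p) `^ p^-1.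
Proof. by rewrite unlock. Qed.

Section PowerMean.
Context {R : realType}.
Implicit Types (v w : R -> R) (p q x y : R).

Lemma continuous_norm_powR p : 0 < p -> continuous (fun x : R => `|x| `^ p).
Proof.
move=> p0 x; have [->|x0] := eqVneq x 0.
  apply/cvgrPdist_lt => e e0; near=> y.
  rewrite normr0 powR0 ?gt_eqF// sub0r normrN ger0_norm ?powR_ge0//.
  have -> : e = (e `^ p^-1) `^ p by rewrite -powRrM mulVf ?gt_eqF// powRr1// ltW.
  apply: gt0_ltr_powR => //; rewrite ?nnegrE ?powR_ge0//.
  rewrite -[`|y|]normrN -[- y]sub0r; near: y.
  by apply: cvgr_dist_lt; rewrite ?powR_gt0//; exact: cvg_id.
have nx : 0 < `|x| by rewrite normr_gt0.
have c1 : {for `|x|, continuous (@powR R ^~ p)}.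
  apply: differentiable_continuous; apply/derivable1_diffP.
  by apply: derivable_powR; rewrite in_itv/= nx.
have c2 : {for x, continuous (fun y : R => `|y|)} by exact: norm_continuous.
exact: (@continuous_comp _ _ _ (fun y : R => `|y|) (@powR R ^~ p) x c2 c1).
Unshelve. all: end_near. Qed.

Lemma continuous_powR v p : 0 < p -> (forall t, 0 <= v t) -> continuous v ->
  continuous (fun t => v t `^ p).
Proof.
move=> p0 v0 cv t.
rewrite (_ : (fun _ => _) = (fun x : R => `|x| `^ p) \o v); last first.
  by apply/funext => s /=; rewrite ger0_norm.
by apply: continuous_comp; [exact: cv|exact: continuous_norm_powR].
Qed.

Lemma powR1E p : (1 : R) `^ p = 1.
Proof. by rewrite powR1. Qed.

Lemma power_mean_ge0 p v : 0 <= power_mean p v.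
Proof. by rewrite power_meanE powR_ge0. Qed.

Lemma power_meanK p v : 0 < p -> power_mean p v `^ p = circle_avg (fun t => v t `^ p).
Proof.
move=> p0; rewrite power_meanE -powRrM mulVf ?gt_eqF// powRr1//.
by apply: circle_avg_ge0 => t; exact: powR_ge0.
Qed.

Lemma powR_le_inv p x y : 0 < p -> 0 <= x -> 0 <= y -> x `^ p <= y `^ p -> x <= y.
Proof.
move=> p0 x0 y0; apply: contraTT; rewrite -!ltNge => yx.
by apply: gt0_ltr_powR.
Qed.

Lemma powR_rootK p x : 0 < p -> 0 <= x -> (x `^ p^-1) `^ p = x.
Proof. by move=> p0 x0; rewrite -powRrM mulVf ?gt_eqF// powRr1. Qed.

Lemma power_mean_cst p (k : R) : 0 < p -> 0 <= k -> power_mean p (fun=> k) = k.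
Proof.
move=> p0 k0; rewrite !power_meanE circle_avg_cst -powRrM mulfV ?gt_eqF//.
by rewrite powRr1.
Qed.

Lemma power_mean_le p v w : 0 < p -> continuous v -> continuous w ->
  (forall t, 0 <= v t) -> (forall t, v t <= w t) -> power_mean p v <= power_mean p w.
Proof.
move=> p0 cv cw v0 vw.
have w0 t : 0 <= w t by exact: le_trans (vw t).
apply: (powR_le_inv p0 (power_mean_ge0 _ _) (power_mean_ge0 _ _)).
rewrite (power_meanK v p0) (power_meanK w p0).
apply: circle_avg_le; [exact: continuous_powR|exact: continuous_powR|].
by move=> t; apply: ge0_ler_powR; rewrite ?nnegrE// ltW.
Qed.

Lemma continuous_scale k v : continuous v -> continuous (fun t => k * v t).
Proof. by move=> cv t; apply: cvgMr; exact: cv. Qed.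

Lemma continuousDf v w : continuous v -> continuous w -> continuous (fun t => v t + w t).
Proof. by move=> cv cw t; apply: cvgD; [exact: cv|exact: cw]. Qed.

Lemma continuousMf v w : continuous v -> continuous w -> continuous (fun t => v t * w t).
Proof. by move=> cv cw t; apply: cvgM; [exact: cv|exact: cw]. Qed.

Lemma power_meanZ p k v : 0 < p -> 0 <= k -> (forall t, 0 <= v t) -> continuous v ->
  power_mean p (fun t => k * v t) = k * power_mean p v.
Proof.
move=> p0 k0 v0 cv; rewrite !power_meanE.
under [in LHS]eq_fun do rewrite powRM//.
rewrite circle_avgZ; last exact: continuous_powR.
rewrite powRM ?powR_ge0//; last by apply: circle_avg_ge0 => t; exact: powR_ge0.
by rewrite -powRrM mulfV ?gt_eqF// powRr1.
Qed.

(** Dividing by any number above the mean makes pointwise convexity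
    inequalities usable, without a case distinction for a vanishing mean. *)
Lemma power_mean_normalized p v A : 0 < p -> (forall t, 0 <= v t) -> continuous v ->
  power_mean p v < A -> circle_avg (fun t => (A^-1 * v t) `^ p) <= 1.
Proof.
move=> p0 v0 cv vA.
have A0 : 0 < A by exact: le_lt_trans (power_mean_ge0 p v) vA.
have Ai0 : 0 <= A^-1 by rewrite invr_ge0 ltW.
rewrite -power_meanK// power_meanZ//.
rewrite -[leRHS](powR1E p); apply: ge0_ler_powR; rewrite ?nnegrE ?(ltW p0)//.
  by rewrite mulr_ge0// power_mean_ge0.
by rewrite mulrC ler_pdivrMr// mul1r ltW.
Qed.

Lemma hoelder_mean p q v w : 0 < p -> 0 < q -> p^-1 + q^-1 = 1 ->
  (forall t, 0 <= v t) -> (forall t, 0 <= w t) -> continuous v -> continuous w ->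
  circle_avg (fun t => v t * w t) <= power_mean p v * power_mean q w.
Proof.
move=> p0 q0 pq v0 w0 cv cw.
have key A B : power_mean p v < A -> power_mean q w < B ->
    circle_avg (fun t => v t * w t) <= A * B.
  move=> vA wB.
  have A0 : 0 < A by exact: le_lt_trans (power_mean_ge0 p v) vA.
  have B0 : 0 < B by exact: le_lt_trans (power_mean_ge0 q w) wB.
  have vn := power_mean_normalized p0 v0 cv vA.
  have wn := power_mean_normalized q0 w0 cw wB.
  have cvA : continuous (fun t => (A^-1 * v t) `^ p).
    apply: continuous_powR => //; last exact: continuous_scale.
    by move=> t; rewrite mulr_ge0// invr_ge0 ltW.
  have cwB : continuous (fun t => (B^-1 * w t) `^ q).
    apply: continuous_powR => //; last exact: continuous_scale.
    by move=> t; rewrite mulr_ge0// invr_ge0 ltW.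
  rewrite -[leRHS]mulr1 -ler_pdivrMl ?mulr_gt0// -circle_avgZ; last exact: continuousMf.
  apply: (@le_trans _ _ (circle_avg (fun t => p^-1 * (A^-1 * v t) `^ p + q^-1 * (B^-1 * w t) `^ q))).
    apply: circle_avg_le; [by apply: continuous_scale; exact: continuousMf|
      by apply: continuousDf; exact: continuous_scale|].
    move=> t; rewrite invfM mulrACA [p^-1 * _]mulrC [q^-1 * _]mulrC.
    by apply: conjugate_powR => //; rewrite mulr_ge0// invr_ge0 ltW.
  rewrite circle_avgD ?circle_avgZ//; [|exact: continuous_scale|exact: continuous_scale].
  rewrite -pq; apply: lerD; rewrite -[leRHS]mulr1.
    by apply: (ler_wpM2l _ vn); rewrite invr_ge0 ltW.
  by apply: (ler_wpM2l _ wn); rewrite invr_ge0 ltW.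
have [P Q] := (power_mean_ge0 p v, power_mean_ge0 q w).
apply/ler_addgt0Pr => e e0.
pose D := power_mean p v + power_mean q w + 1.
have D0 : 0 < D by rewrite ltr_wpDl// addr_ge0.
pose d := Num.min 1 (e / D).
have d0 : 0 < d by rewrite lt_min ltr01 divr_gt0.
apply: le_trans (key (power_mean p v + d) (power_mean q w + d) _ _) _; rewrite ?ltrDl//.
have d1 : d <= 1 by rewrite ge_min lexx.
have dD : d * D <= e.
  by rewrite -ler_pdivlMr// ge_min lexx orbT.
rewrite mulrDl !mulrDr -addrA lerD2l.
apply: le_trans dD; rewrite /D; nra.
Qed.

Lemma convex_powR_le p x y l : 1 <= p -> 0 <= l <= 1 -> 0 <= x -> 0 <= y ->
  (l * x + (1 - l) * y) `^ p <= l * x `^ p + (1 - l) * y `^ p.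
Proof.
move=> p1 /andP[l0 l1] x0 y0.
have lI : Itv.spec (@Itv.num_sem R) (Itv.Real `[0%Z, 1%Z]) l.
  by rewrite /=/Itv.num_sem/= ger0_real//= in_itv/= l0 l1.
pose t := Itv.mk lI.
have := @convex_powR R p p1 t x y; rewrite !inE/= !in_itv/= !andbT => /(_ x0 y0).
by rewrite !convRE.
Qed.

Lemma minkowski_mean p v w : 1 <= p ->
  (forall t, 0 <= v t) -> (forall t, 0 <= w t) -> continuous v -> continuous w ->
  power_mean p (fun t => v t + w t) <= power_mean p v + power_mean p w.
Proof.
move=> p1 v0 w0 cv cw; have p0 : 0 < p by exact: lt_le_trans p1.
have key A B : power_mean p v < A -> power_mean p w < B ->
    power_mean p (fun t => v t + w t) <= A + B.
  move=> vA wB.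
  have A0 : 0 < A by exact: le_lt_trans (power_mean_ge0 p v) vA.
  have B0 : 0 < B by exact: le_lt_trans (power_mean_ge0 p w) wB.
  have AB0 : 0 < A + B by rewrite addr_gt0.
  have vn := power_mean_normalized p0 v0 cv vA.
  have wn := power_mean_normalized p0 w0 cw wB.
  have vA0 t : 0 <= A^-1 * v t by rewrite mulr_ge0// invr_ge0 ltW.
  have wB0 t : 0 <= B^-1 * w t by rewrite mulr_ge0// invr_ge0 ltW.
  have cvA : continuous (fun t => (A^-1 * v t) `^ p).
    by apply: continuous_powR => //; exact: continuous_scale.
  have cwB : continuous (fun t => (B^-1 * w t) `^ p).
    by apply: continuous_powR => //; exact: continuous_scale.
  have -> : (fun t => v t + w t) = (fun t => (A + B) * ((A + B)^-1 * (v t + w t))).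
    by apply/funext => t; rewrite mulVKf// gt_eqF.
  have vw0 t : 0 <= (A + B)^-1 * (v t + w t).
    by rewrite mulr_ge0 ?addr_ge0// invr_ge0 ltW.
  have cvw : continuous (fun t => (A + B)^-1 * (v t + w t)).
    by apply: continuous_scale; exact: continuousDf.
  rewrite power_meanZ ?(ltW AB0)//.
  rewrite -[leRHS]mulr1; apply: ler_wpM2l; first exact: ltW.
  apply: (powR_le_inv p0 (power_mean_ge0 _ _) ler01).
  rewrite power_meanK// powR1E.
  pose l := A / (A + B).
  have l1E : 1 - l = B / (A + B) by rewrite /l; field; rewrite gt_eqF.
  have l01 : 0 <= l <= 1.
    rewrite divr_ge0 ?(ltW A0) ?(ltW AB0)//= ler_pdivrMr// mul1r.
    by rewrite lerDl ltW.
  apply: (@le_trans _ _ (circle_avg (fun t => l * (A^-1 * v t) `^ p + (1 - l) * (B^-1 * w t) `^ p))).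
    apply: circle_avg_le; [exact: continuous_powR|
      by apply: continuousDf; exact: continuous_scale|].
    move=> t.
    have -> : (A + B)^-1 * (v t + w t) = l * (A^-1 * v t) + (1 - l) * (B^-1 * w t).
      by rewrite l1E /l; field; rewrite !gt_eqF.
    exact: convex_powR_le.
  rewrite circle_avgD ?circle_avgZ//; [|exact: continuous_scale|exact: continuous_scale].
  case/andP: l01 => l0 l1.
  rewrite -[leRHS](subrKC l); apply: lerD.
    by rewrite -[leRHS]mulr1; exact: (ler_wpM2l l0 vn).
  by rewrite -[leRHS]mulr1; apply: (ler_wpM2l _ wn); rewrite subr_ge0.
apply/ler_addgt0Pr => e e0.
have e2 : 0 < e / 2 by rewrite divr_gt0.
apply: le_trans (key (power_mean p v + e / 2) (power_mean p w + e / 2) _ _) _; rewrite ?ltrDl//.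
lra.
Qed.

Lemma power_mean_shift p v s : 0 < p -> continuous v -> periodic2pi v -> (forall t, 0 <= v t) ->
  power_mean p (fun t => v (t + s)) = power_mean p v.
Proof.
move=> p0 cv pv v0; rewrite !power_meanE; congr (_ `^ _).
apply: (@circle_avg_shift _ (fun t => v t `^ p)).
- exact: continuous_powR.
- by move=> t; rewrite pv.
- by move=> t; exact: powR_ge0.
Qed.

Lemma power_mean1 v : (forall t, 0 <= v t) -> power_mean 1 v = circle_avg v.
Proof.
move=> v0; rewrite !power_meanE invr1 powRr1.
  by congr (@circle_avg R _); apply/funext => t; rewrite powRr1.
by apply: circle_avg_ge0 => t; exact: powR_ge0.
Qed.

End PowerMean.

(** * Exact quadrature for convolutions *)

Section Cis.
Context {R : realType}.
Implicit Types (s t x r : R) (z : R[i]).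

Definition cis t : R[i] := cos t +i* sin t.

Lemma cis0 : cis 0 = 1.
Proof. by rewrite /cis cos0 sin0. Qed.

Lemma cisD s t : cis (s + t) = cis s * cis t.
Proof. by rewrite /cis cosD sinD; congr (_ +i* _); rewrite addrC. Qed.

Lemma normc_cis t : normc (cis t) = 1.
Proof. by rewrite /cis /normc cos2Dsin2 sqrtr1. Qed.

Lemma cis_neq0 t : cis t != 0.
Proof.
apply/eqP => h; have := normc_cis t; rewrite h normc0 => /eqP.
by rewrite eq_sym oner_eq0.
Qed.

Lemma cisN t : cis (- t) = (cis t)^-1.
Proof.
by apply: (mulfI (cis_neq0 t)); rewrite -cisD subrr cis0 mulfV// cis_neq0.
Qed.

Lemma cis2pi : cis (2 * pi) = 1.
Proof. by rewrite /cis mulr_natl cos2pi sin2pi. Qed.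

Lemma cis_periodic t : cis (t + 2 * pi) = cis t.
Proof. by rewrite cisD cis2pi mulr1. Qed.

Lemma cisX t n : cis (n%:R * t) = cis t ^+ n.
Proof.
elim: n => [|n IH]; first by rewrite mul0r cis0 expr0.
by rewrite -natr1 mulrDl mul1r cisD IH exprSr.
Qed.

Lemma cis_neq1 t : 0 < t < 2 * pi -> cis t != 1.
Proof.
move=> /andP[t0 t1]; apply/eqP => -[h _].
have s0 : 0 < sin (t / 2).
  by apply: sin_gt0_pi; rewrite divr_gt0//= ltr_pdivrMr// mulrC.
have : cos t = 1 - 2 * sin (t / 2) ^+ 2.
  rewrite {1}[t]splitr cosD -!expr2 cos2sin2; lra.
rewrite h; nra.
Qed.

Definition root1 N : R[i] := cis (2 * pi / N%:R).

Lemma root1_prim N : (0 < N)%N -> N.-primitive_root (root1 N).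
Proof.
move=> N0; apply/andP; split => //; apply/forallP => i.
rewrite unity_rootE -cisX; apply/eqP.
have NN : N%:R != 0 :> R by rewrite pnatr_eq0 -lt0n.
have pp : 0 < 2 * pi :> R by rewrite mulr_gt0// pi_gt0.
have [iN|iN] := eqVneq i.+1 N.
  by rewrite iN mulrC divfK// cis2pi eqxx.
apply/negbTE; apply: cis_neq1.
have lt : (i.+1 < N)%N by rewrite ltn_neqAle iN ltn_ord.
have N0' : 0 < N%:R :> R by rewrite ltr0n.
by rewrite mulr_gt0 ?divr_gt0//= mulrA ltr_pdivrMr// mulrC ltr_pM2l// ltr_nat.
Qed.

Lemma sum_root1 N (z : R[i]) : (0 < N)%N -> z ^+ N = 1 -> z != 1 -> \sum_(k < N) z ^+ k = 0.
Proof.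
move=> N0 zN z1; have := subrX1 z N; rewrite zN subrr => /esym/eqP.
by rewrite mulf_eq0 subr_eq0 (negbTE z1) => /eqP.
Qed.

End Cis.

Section DiscreteConvolution.
Context {R : realType}.
Variables (M : nat) (c d e : nat -> R[i]).
Hypotheses (M0 : (0 < M)%N) (e0 : e 0%N = 0).
Implicit Types (s t : R).
Let N := (2 * M)%N.

Definition trig_poly t : R[i] := \sum_(n < M) c n * cis t ^+ n.
Definition trig_poly2 t : R[i] :=
  \sum_(n < M) d n * cis t ^+ n + \sum_(n < M) e n * (cis t)^-1 ^+ n.
Definition node k : R := k%:R * (2 * pi / N%:R).

(** Frequencies are below [M], so [2 * M] nodes separate them: summing
    [(w ^+ n / w ^+ m) ^+ k] over the nodes gives zero unless [m = n]. The part of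
    [trig_poly2] in the conjugate variable contributes the frequencies
    [m + n], and these are not multiples of [2 * M], since [e] has no constant
    term. A convolution is thus a finite sum, for every shift [s] of the nodes. *)
Lemma trig_conv s t :
  \sum_(k < N) trig_poly (t - (s + node k)) * trig_poly2 (s + node k) =
  N%:R * \sum_(n < M) c n * d n * cis t ^+ n.
Proof.
have N0 : (0 < N)%N by rewrite muln_gt0.
have wp := @root1_prim R N N0; set w := root1 N in wp.
have w0 : w != 0 by exact: cis_neq0.
set u := cis t; set z := cis s.
have z0 : z != 0 by exact: cis_neq0.
have wN : w ^+ N = 1 by exact: prim_expr_order.
have wE (k : nat) : cis (s + node k) = z * w ^+ k by rewrite cisD cisX.
have uE (k : nat) : cis (t - (s + node k)) = u / (z * w ^+ k) by rewrite cisD cisN wE.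
pose S1 m n := \sum_(k < N) (w ^+ n / w ^+ m) ^+ k.
pose S2 m n := \sum_(k < N) (w ^+ (m + n))^-1 ^+ k.
have S1E (m n : 'I_M) : S1 m n = if m == n then N%:R else 0.
  have mN : (m < N)%N by rewrite (leq_trans (ltn_ord m))// leq_pmull.
  have nN : (n < N)%N by rewrite (leq_trans (ltn_ord n))// leq_pmull.
  rewrite /S1; case: eqVneq => [->|mn].
    rewrite mulfV ?expf_neq0//; under eq_bigr do rewrite expr1n.
    by rewrite sumr_const card_ord.
  apply: sum_root1 => //.
    by rewrite expr_div_n -!exprM (mulnC n) (mulnC m) !(exprM w N) wN !expr1n divr1.
  apply: contra mn => /eqP h.
  have : w ^+ n == w ^+ m by apply/eqP/divr1_eq.
  by rewrite (eq_prim_root_expr wp) !modn_small// eq_sym.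
(* The frequency [m + n] lies strictly between [0] and [2 * M]. *)
have S2E (m n : 'I_M) : e n * S2 m n = 0.
  have [n0|n0] := eqVneq (n : nat) 0%N; first by rewrite n0 e0 mul0r.
  rewrite /S2 sum_root1 ?mulr0//.
    by rewrite exprVn -exprM mulnC (exprM w N) wN expr1n invr1.
  rewrite invr_eq1 -(expr0 w) (eq_prim_root_expr wp) mod0n modn_small.
    by rewrite addn_eq0 negb_and n0 orbT.
  by rewrite /N mul2n -addnn; apply: leq_trans (leq_add (ltn_ord m) (ltnW (ltn_ord n))); rewrite addSn.
transitivity (\sum_(m < M) \sum_(n < M)
   (c m * d n * u ^+ m * (z ^+ n / z ^+ m) * S1 m n + c m * u ^+ m * (z ^+ (m + n))^-1 * (e n * S2 m n))).
  under eq_bigr => k _.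
    rewrite /trig_poly /trig_poly2 uE wE mulr_suml.
    under eq_bigr => m _ do rewrite -big_split/= mulr_sumr.
    over.
  rewrite exchange_big/=; apply: eq_bigr => m _.
  rewrite exchange_big/=; apply: eq_bigr => n _.
  rewrite /S1 /S2 !mulr_sumr -big_split/=; apply: eq_bigr => k _.
  rewrite mulrDr; congr (_ + _).
    by rewrite !expr_div_n !exprMn (exprAC w n k) (exprAC w m k) !invfM; ring.
  rewrite expr_div_n !exprVn !exprMn !exprD exprMn (exprAC w n k) (exprAC w m k).
  by rewrite !invfM; ring.
rewrite mulr_sumr; apply: eq_bigr => m _.
rewrite (bigD1 m)//= S1E eqxx S2E mulr0 addr0 big1 ?addr0.
  by rewrite mulfV ?expf_neq0// mulr1 mulrC.
by move=> n nm; rewrite S1E S2E eq_sym (negbTE nm) !mulr0 addr0.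
Qed.

End DiscreteConvolution.

(** * Power series on circles *)

HB.lock Definition circ (R : realType) (c : nat -> R[i]) (r t : R) : R[i] :=
  psum c (r%:C * cis t).
Arguments circ {R} c r t.

Lemma circE (R : realType) (c : nat -> R[i]) (r t : R) : circ c r t = psum c (r%:C * cis t).
Proof. by rewrite unlock. Qed.

Section CircleFunctions.
Context {R : realType}.
Implicit Types (c d e : nat -> R[i]) (r s t : R) (u : R -> R[i]).

Lemma continuous_normc u : continuous u -> continuous (fun t => normc (u t)).
Proof.
move=> cu t; apply/cvgrPdist_lt => eps eps0.
have /cvgc_normP/(_ eps eps0) := cu t.
apply: filterS => s; apply: le_lt_trans.
rewrite ler_norml; apply/andP; split.
  by rewrite lerNl opprB; exact: ler_normcB.
by rewrite normcBC; exact: ler_normcB.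
Qed.

Lemma continuous_cis : continuous (@cis R).
Proof.
move=> t; apply/cvgc_normP => eps eps0.
have eps2 : 0 < eps / 2 by rewrite divr_gt0.
near=> s.
have hc : `|cos t - cos s| < eps / 2.
  by near: s; move/cvgrPdist_lt : (@continuous_cos R t); exact.
have hs : `|sin t - sin s| < eps / 2.
  by near: s; move/cvgrPdist_lt : (@continuous_sin R t); exact.
apply: le_lt_trans (le_normc_ReIm _) _.
by rewrite [eps]splitr /= distrC (distrC (sin s)); exact: ltrD.
Unshelve. all: end_near. Qed.

Lemma continuous_oppr_arg u t : continuous u -> continuous (fun s => u (t - s)).
Proof.
move=> cu s; apply: (@continuous_comp _ _ _ (fun s => t - s) u); last exact: cu.
by apply: cvgB; [exact: cvg_cst|exact: cvg_id].
Qed.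

Lemma continuous_shift_arg u t : continuous u -> continuous (fun s => u (s + t)).
Proof.
move=> cu s; apply: (@continuous_comp _ _ _ (fun s => s + t) u); last exact: cu.
by apply: cvgD; [exact: cvg_id|exact: cvg_cst].
Qed.

Lemma continuousXc u n : continuous u -> continuous (fun t => u t ^+ n).
Proof.
move=> cu; elim: n => [|n IH] t.
  by rewrite (_ : (fun _ => _) = cst 1); [exact: cvg_cst|apply/funext => s; rewrite expr0].
rewrite (_ : (fun _ => _) = (fun t => u t * u t ^+ n)).
  by apply: cvgM; [exact: cu|exact: IH].
by apply/funext => s; rewrite exprS.
Qed.

Lemma continuous_sumc n (F : 'I_n -> R -> R[i]) : (forall i, continuous (F i)) ->
  continuous (fun t => \sum_(i < n) F i t).
Proof.
elim: n F => [|n IH] F cF.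
  rewrite (_ : (fun _ => _) = cst 0); first by move=> ?; exact: cvg_cst.
  by apply/funext => t; rewrite big_ord0.
rewrite (_ : (fun _ => _) = fun t => F ord0 t + \sum_(i < n) F (lift ord0 i) t).
  by move=> t; apply: cvgD; [exact: cF|apply: IH].
by apply/funext => t; rewrite big_ord_recl.
Qed.

Lemma continuous_trig_poly M c : continuous (@trig_poly R M c).
Proof.
apply: continuous_sumc => i t; apply: cvgM; first exact: cvg_cst.
exact: (continuousXc continuous_cis).
Qed.

Lemma trig_poly2E M d e t : @trig_poly2 R M d e t = trig_poly M d t + trig_poly M e (- t).
Proof. by rewrite /trig_poly2 /trig_poly cisN. Qed.

Lemma continuous_trig_poly2 M d e : continuous (@trig_poly2 R M d e).
Proof.
rewrite (_ : trig_poly2 _ _ _ = fun t => trig_poly M d t + trig_poly M e (0 - t)); last first.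
  by apply/funext => t; rewrite trig_poly2E sub0r.
move=> t; apply: cvgD; first exact: continuous_trig_poly.
exact: (continuous_oppr_arg (@continuous_trig_poly _ _)).
Qed.

Lemma periodic_trig_poly M c t : @trig_poly R M c (t + 2 * pi) = trig_poly M c t.
Proof. by rewrite /trig_poly cis_periodic. Qed.

Lemma periodic_trig_poly2 M d e t : @trig_poly2 R M d e (t + 2 * pi) = trig_poly2 M d e t.
Proof. by rewrite /trig_poly2 cis_periodic. Qed.

(** The shift of the nodes is free, and averaging over it turns quadrature sums
    back into means. *)
Lemma circle_avg_nodes M (v : R -> R) : (0 < M)%N -> continuous v -> periodic2pi v ->
  (forall t, 0 <= v t) ->
  circle_avg (fun s => (2 * M)%:R^-1 * \sum_(k < 2 * M) v (s + node M k)) = circle_avg v.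
Proof.
move=> M0 cv pv v0.
have cs (x : R) : continuous (fun s => v (s + x)).
  move=> s; apply: (@continuous_comp _ _ _ (fun s => s + x) v); last exact: cv.
  by apply: cvgD; [exact: cvg_id|exact: cvg_cst].
rewrite circle_avgZ; last exact: continuous_sum_ord.
rewrite circle_avg_sum//.
under eq_bigr do rewrite circle_avg_shift//.
rewrite sumr_const card_ord -(mulr_natl (circle_avg v)) mulKf// pnatr_eq0 muln_eq0.
by rewrite negb_or /= -lt0n M0.
Qed.

(** A kernel with an analytic part and a part in the conjugate variable, as the
    Poisson kernel has. *)
Definition kern d e r t : R[i] := circ d r t + circ e r (- t).

Lemma normc_rcis r t : 0 <= r -> normc (r%:C * cis t) = r.
Proof. by move=> r0; rewrite normcM normc_cis mulr1 normc_real ger0_norm. Qed.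

Definition dilate c r : nat -> R[i] := fun n => c n * r%:C ^+ n.

Lemma circ_approx c r : tame c -> 0 <= r < 1 ->
  exists K x, [/\ 0 <= K, 0 <= x < 1 &
    forall M t, normc (circ c r t - trig_poly M (dilate c r) t) <= K * x ^+ M].
Proof.
move=> tc /[dup] r01 /andP[r0 r1]; have [K [x [K0 x01 H]]] := psum_tail tc r01.
exists K, x; split => // M t.
have -> : trig_poly M (dilate c r) t = \sum_(k < M) c k * (r%:C * cis t) ^+ k.
  by apply: eq_bigr => i _; rewrite /dilate exprMn mulrA.
by rewrite circE; apply: H; rewrite normc_rcis.
Qed.

Lemma continuous_circ c r : tame c -> 0 <= r < 1 -> continuous (circ c r).
Proof.
move=> tc /[dup] r01 /andP[r0 r1]; have [K K0 HK] := psum_lip tc r01.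
move=> t; apply/cvgc_normP => eps eps0.
have K1 : 0 < K + 1 by rewrite ltr_wpDl.
have /cvgc_normP/(_ (eps / (K + 1))) := @continuous_cis t.
rewrite divr_gt0// => /(_ isT); apply: filterS => s hs.
rewrite !circE; apply: le_lt_trans (HK _ _ _ _) _; rewrite ?normc_rcis//.
rewrite -mulrBr normcM normc_real ger0_norm//.
apply: (@le_lt_trans _ _ ((K + 1) * normc (cis s - cis t))).
  apply: ler_pM => //; rewrite ?mulr_ge0 ?normc_ge0//; first by rewrite lerDl.
  by rewrite ler_piMl ?normc_ge0// ltW.
by rewrite mulrC -ltr_pdivlMr.
Qed.

Lemma circ_periodic c r t : circ c r (t + 2 * pi) = circ c r t.
Proof. by rewrite !circE cis_periodic. Qed.

Lemma continuous_kern d e r : tame d -> tame e -> 0 <= r < 1 -> continuous (kern d e r).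
Proof.
move=> td te r01; rewrite (_ : kern _ _ _ = fun t => circ d r t + circ e r (0 - t)); last first.
  by apply/funext => t; rewrite /kern sub0r.
move=> t; apply: cvgD; first exact: continuous_circ.
exact: (continuous_oppr_arg (continuous_circ te r01)).
Qed.

Lemma kern_approx d e r : tame d -> tame e -> 0 <= r < 1 ->
  exists K x, [/\ 0 <= K, 0 <= x < 1 &
    forall M t, normc (kern d e r t - trig_poly2 M (dilate d r) (dilate e r) t) <= K * x ^+ M].
Proof.
move=> td te r01.
have [K [x [K0 /andP[x0 x1] H]]] := circ_approx td r01.
have [L [y [L0 /andP[y0 y1] H']]] := circ_approx te r01.
exists (K + L), (Num.max x y); split; first by rewrite addr_ge0.
  by rewrite le_max x0 gt_max x1.
move=> M t; rewrite trig_poly2E /kern opprD addrACA mulrDl.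
apply: le_trans (le_normcD _ _) _; apply: lerD.
  apply: le_trans (H _ _) _; apply: ler_wpM2l => //.
  by apply: lerXn2r; rewrite ?nnegrE ?le_max ?x0 ?lexx.
apply: le_trans (H' _ _) _; apply: ler_wpM2l => //.
by apply: lerXn2r; rewrite ?nnegrE ?le_max ?y0 ?lexx ?orbT.
Qed.

Section PolynomialConvolution.
Variables (M : nat) (c d e : nat -> R[i]).
Hypotheses (M0 : (0 < M)%N) (e0 : e 0%N = 0).
Notation G := (trig_poly M c).
Notation K := (trig_poly2 M d e).
Notation T := (trig_poly M (fun n => c n * d n)).

Lemma trig_conv_norm s t : normc (T t) <=
  (2 * M)%:R^-1 * \sum_(k < 2 * M) normc (G (t - (s + node M k))) * normc (K (s + node M k)).
Proof.
have N0 : 0 < (2 * M)%:R :> R by rewrite ltr0n muln_gt0.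
rewrite ler_pdivlMl//.
have := trig_conv c d M0 e0 s t => h.
have -> : (2 * M)%:R * normc (T t) = normc ((2 * M)%:R * T t).
  by rewrite normcM normc_nat.
rewrite -h; apply: le_trans (le_normc_sum _ _ _) _.
by apply: ler_sum => k _; rewrite normcM.
Qed.

Lemma trig_conv_ptwise t :
  normc (T t) <= circle_avg (fun s => normc (G (t - s)) * normc (K s)).
Proof.
set v := (fun s => _).
have cv : continuous v.
  apply: continuousMf; apply: continuous_normc; last exact: continuous_trig_poly2.
  exact: (continuous_oppr_arg (@continuous_trig_poly _ _)).
have pv : periodic2pi v.
  move=> s; rewrite /v periodic_trig_poly2.
  by rewrite -(periodic_trig_poly _ _ (t - (s + _))) opprD addrA subrK.
have v0 s : 0 <= v s by rewrite mulr_ge0 ?normc_ge0.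
rewrite -(circle_avg_nodes M0 cv pv v0); apply: circle_avg_exists.
  apply: continuous_scale; apply: continuous_sum_ord => k s.
  apply: (@continuous_comp _ _ _ (fun s => s + node M k) v); last exact: cv.
  by apply: cvgD; [exact: cvg_id|exact: cvg_cst].
by move=> s; exact: trig_conv_norm.
Qed.

(** Minkowski's inequality for the sum over the nodes, then averaging over their
    shift. *)
Lemma trig_conv_young p : 1 <= p ->
  power_mean p (fun t => normc (T t)) <=
  circle_avg (fun s => normc (K s)) * power_mean p (fun t => normc (G t)).
Proof.
move=> p1; have p0 : 0 < p by exact: lt_le_trans p1.
have cG : continuous (fun t => normc (G t)) by apply: continuous_normc; exact: continuous_trig_poly.
have cK : continuous (fun t => normc (K t)) by apply: continuous_normc; exact: continuous_trig_poly2.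
have cGx (x : R) : continuous (fun t => normc (G (t + x))).
  by apply: continuous_normc; apply: continuous_shift_arg; exact: continuous_trig_poly.
have cT : continuous (fun t => normc (T t)) by apply: continuous_normc; exact: continuous_trig_poly.
have pK : periodic2pi (fun t => normc (K t)) by move=> t; rewrite periodic_trig_poly2.
have pG : periodic2pi (fun t => normc (G t)) by move=> t; rewrite periodic_trig_poly.
have K0 t : 0 <= normc (K t) by exact: normc_ge0.
rewrite -(circle_avg_nodes M0 cK pK K0) mulrC -circle_avgZ; last first.
  apply: continuous_scale; apply: continuous_sum_ord => k s.
  apply: (@continuous_comp _ _ _ (fun s => s + node M k) (fun t => normc (K t))); last exact: cK.
  by apply: cvgD; [exact: cvg_id|exact: cvg_cst].
apply: circle_avg_exists.
  apply: continuous_scale; apply: continuous_scale; apply: continuous_sum_ord => k s.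
  apply: (@continuous_comp _ _ _ (fun s => s + node M k) (fun t => normc (K t))); last exact: cK.
  by apply: cvgD; [exact: cvg_id|exact: cvg_cst].
move=> s; rewrite mulrCA.
have Ni0 : 0 <= (2 * M)%:R^-1 :> R by rewrite invr_ge0.
have gen (I : seq 'I_(2 * M)) : power_mean p (fun t => \sum_(k <- I) normc (K (s + node M k)) * normc (G (t + (- (s + node M k)))))
    <= power_mean p (fun t => normc (G t)) * \sum_(k <- I) normc (K (s + node M k))
   /\ continuous (fun t => \sum_(k <- I) normc (K (s + node M k)) * normc (G (t + (- (s + node M k))))).
  elim: I => [|k I [IH cI]].
    rewrite big_nil mulr0 (_ : (fun _ => _) = fun=> 0); last by apply/funext => t; rewrite big_nil.
    by rewrite power_mean_cst//; split=> // t; exact: cvg_cst.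
  rewrite (_ : (fun _ => _) = fun t => normc (K (s + node M k)) * normc (G (t + (- (s + node M k))))
      + \sum_(k <- I) normc (K (s + node M k)) * normc (G (t + (- (s + node M k))))); last first.
    by apply/funext => t; rewrite big_cons.
  split; last by apply: continuousDf => //; apply: continuous_scale; exact: cGx.
  apply: le_trans (minkowski_mean p1 _ _ _ _) _ => //.
  - by move=> t; rewrite mulr_ge0 ?normc_ge0.
  - by move=> t; apply: sumr_ge0 => i _; rewrite mulr_ge0 ?normc_ge0.
  - by apply: continuous_scale; exact: cGx.
  rewrite big_cons mulrDr; apply: lerD => //.
  rewrite (power_meanZ p0 (normc_ge0 _) (fun t => normc_ge0 _) (cGx _)).
  rewrite (@power_mean_shift _ p (fun t => normc (G t)) _ p0 cG pG (fun t => normc_ge0 _)).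
  by rewrite mulrC.
have [H1 H2] := gen (index_enum 'I_(2 * M)).
apply: (@le_trans _ _ (power_mean p (fun t => (2 * M)%:R^-1 *
  \sum_(k < 2 * M) normc (K (s + node M k)) * normc (G (t + (- (s + node M k))))))).
  apply: power_mean_le => //.
  - exact: continuous_scale.
  - by move=> t; exact: normc_ge0.
  - move=> t; apply: le_trans (trig_conv_norm s t) _.
    apply: ler_wpM2l => //; apply: ler_sum => k _; by rewrite mulrC.
rewrite power_meanZ//; first exact: ler_wpM2l.
by move=> t; apply: sumr_ge0 => i _; rewrite mulr_ge0 ?normc_ge0.
Qed.

End PolynomialConvolution.

End CircleFunctions.

(** * Young's inequality on the circle *)

Section Convolution.
Context {R : realType}.
Implicit Types (c d e : nat -> R[i]) (r s t p : R) (u w : R -> R).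

Lemma geo_max2 (I J : Type) (a : I -> nat -> R) (b : J -> nat -> R) :
  (exists K x, [/\ 0 <= K, 0 <= x < 1 & forall n i, a i n <= K * x ^+ n]) ->
  (exists K x, [/\ 0 <= K, 0 <= x < 1 & forall n i, b i n <= K * x ^+ n]) ->
  exists K x, [/\ 0 <= K, 0 <= x < 1, forall n i, a i n <= K * x ^+ n
    & forall n i, b i n <= K * x ^+ n].
Proof.
move=> [K [x [K0 /andP[x0 x1] H]]] [L [y [L0 /andP[y0 y1] H']]].
exists (K + L), (Num.max x y); split; first by rewrite addr_ge0.
- by rewrite le_max x0 gt_max x1.
- move=> n i; apply: le_trans (H _ _) _; apply: ler_pM => //.
  + exact: exprn_ge0.
  + by rewrite lerDl.
  + by apply: lerXn2r; rewrite ?nnegrE ?le_max ?x0 ?lexx.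
- move=> n i; apply: le_trans (H' _ _) _; apply: ler_pM => //.
  + exact: exprn_ge0.
  + by rewrite lerDr.
  + by apply: lerXn2r; rewrite ?nnegrE ?le_max ?y0 ?lexx ?orbT.
Qed.

Lemma power_mean_le_add p u w eps : 1 <= p -> continuous u -> continuous w ->
  (forall t, 0 <= u t) -> (forall t, 0 <= w t) -> 0 <= eps ->
  (forall t, u t <= w t + eps) -> power_mean p u <= power_mean p w + eps.
Proof.
move=> p1 cu cw u0 w0 e0 H; have p0 : 0 < p by exact: lt_le_trans p1.
have ce : continuous (fun _ : R => eps) by move=> ?; exact: cvg_cst.
rewrite -[X in _ + X](power_mean_cst p0 e0).
apply: le_trans (@minkowski_mean R p w (fun=> eps) p1 w0 (fun=> e0) cw ce).
apply: power_mean_le => //; exact: continuousDf.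
Qed.

Lemma circle_avg_le_add u w eps : continuous u -> continuous w ->
  (forall t, u t <= w t + eps) -> circle_avg u <= circle_avg w + eps.
Proof.
move=> cu cw H.
have ce : continuous (fun _ : R => eps) by move=> ?; exact: cvg_cst.
rewrite -[X in _ + X]circle_avg_cst -circle_avgD//.
apply: circle_avg_le => //; exact: continuousDf.
Qed.

Lemma normc_le_add (z w : R[i]) eps : normc (z - w) <= eps -> normc z <= normc w + eps.
Proof. by move=> h; rewrite -lerBlDl; apply: le_trans h; exact: ler_normcB. Qed.

Lemma dilateM c d r1 r2 : (fun n => dilate c r1 n * dilate d r2 n) =
  dilate (fun n => c n * d n) (r1 * r2).
Proof.
by apply/funext => n; rewrite /dilate rmorphM exprMn mulrACA.
Qed.

Lemma dilate0 e r : e 0%N = 0 -> dilate e r 0%N = 0.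
Proof. by move=> e0; rewrite /dilate e0 mul0r. Qed.

Lemma conv_approx c d e r1 r2 : tame c -> tame d -> tame e ->
  0 <= r1 < 1 -> 0 <= r2 < 1 ->
  exists K x, [/\ 0 <= K, 0 <= x < 1 & forall M t,
   [/\ normc (circ c r1 t - trig_poly M (dilate c r1) t) <= K * x ^+ M,
      normc (kern d e r2 t - trig_poly2 M (dilate d r2) (dilate e r2) t) <= K * x ^+ M &
      normc (circ (fun n => c n * d n) (r1 * r2) t -
        trig_poly M (fun n => dilate c r1 n * dilate d r2 n) t) <= K * x ^+ M]].
Proof.
move=> tc td te r01 r02.
have r12 : 0 <= r1 * r2 < 1.
  case/andP: r01 => a0 a1; case/andP: r02 => b0 b1.
  by rewrite mulr_ge0//= mulr_ilt1.
have [K [x [K0 x01 H1 H2]]] := geo_max2 (circ_approx tc r01) (kern_approx td te r02).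
have [|K' [x' [K'0 x'01 H1' H2']]] := @geo_max2 (R + R) R
  (fun i n => match i with
     | inl t => normc (circ c r1 t - trig_poly n (dilate c r1) t)
     | inr t => normc (kern d e r2 t - trig_poly2 n (dilate d r2) (dilate e r2) t) end)
  (fun t n => normc (circ (fun n => c n * d n) (r1 * r2) t - trig_poly n (dilate (fun n => c n * d n) (r1 * r2)) t))
  _ (circ_approx (tameM tc td) r12).
  by exists K, x; split => // n [t|t].
exists K', x'; split => // M t; rewrite dilateM; split; [exact: (H1' M (inl t))|exact: (H1' M (inr t))|exact: H2'].
Qed.

(** The inequality for trigonometric polynomials, passed to the limit with
    [le_geo]. The left-hand side is the Hadamard product of two power series. *)
Lemma conv_young c d e r1 r2 p : tame c -> tame d -> tame e -> e 0%N = 0 ->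
  0 <= r1 < 1 -> 0 <= r2 < 1 -> 1 <= p ->
  power_mean p (fun t => normc (circ (fun n => c n * d n) (r1 * r2) t)) <=
  circle_avg (fun s => normc (kern d e r2 s)) * power_mean p (fun t => normc (circ c r1 t)).
Proof.
move=> tc td te e0 r01 r02 p1; have p0 : 0 < p by exact: lt_le_trans p1.
have r12 : 0 <= r1 * r2 < 1.
  case/andP: r01 => a0 a1; case/andP: r02 => b0 b1.
  by rewrite mulr_ge0//= mulr_ilt1.
have [K [x [K0 /[dup] x01 /andP[x0 x1] H]]] := conv_approx tc td te r01 r02.
set A := circle_avg _; set B := power_mean p (fun t => normc (circ c r1 t)).
have cG := continuous_normc (continuous_circ tc r01).
have cK := continuous_normc (continuous_kern td te r02).
have cT := continuous_normc (continuous_circ (tameM tc td) r12).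
have A0 : 0 <= A by apply: circle_avg_ge0 => t; exact: normc_ge0.
have B0 : 0 <= B by exact: power_mean_ge0.
apply: (@le_geo _ ((A + B + K + 1) * K) x) => // n.
set eps := K * x ^+ n.+1.
have eps0 : 0 <= eps by rewrite mulr_ge0// exprn_ge0.
have epsn : eps <= K * x ^+ n.
  by rewrite ler_wpM2l// exprS ler_piMl ?exprn_ge0// ltW.
have epsK : eps <= K.
  by rewrite -[leRHS]mulr1 ler_wpM2l// exprn_ile1// ltW.
have n0 : (0 < n.+1)%N by [].
have c1 := continuous_normc (@continuous_trig_poly R n.+1 (dilate c r1)).
have c2 := continuous_normc (@continuous_trig_poly2 R n.+1 (dilate d r2) (dilate e r2)).
have c3 := continuous_normc (@continuous_trig_poly R n.+1 (fun n => dilate c r1 n * dilate d r2 n)).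
have S1 := power_mean_le_add p1 cT c3 (fun t => normc_ge0 _) (fun t => normc_ge0 _) eps0
  (fun t => normc_le_add (let: And3 _ _ h := H n.+1 t in h)).
apply: le_trans S1 _.
have S2 := @trig_conv_young R n.+1 (dilate c r1) (dilate d r2) (dilate e r2) n0 (dilate0 r2 e0) p p1.
apply: le_trans (lerD S2 (lexx eps)) _.
have S3 : circle_avg (fun t => normc (trig_poly2 n.+1 (dilate d r2) (dilate e r2) t)) <= A + eps.
  apply: circle_avg_le_add => // t; apply: normc_le_add; rewrite normcBC.
  by have [] := H n.+1 t.
have S4 : power_mean p (fun t => normc (trig_poly n.+1 (dilate c r1) t)) <= B + eps.
  apply: (power_mean_le_add p1 c1 cG (fun t => normc_ge0 _) (fun t => normc_ge0 _) eps0) => t.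
  by apply: normc_le_add; rewrite normcBC; have [] := H n.+1 t.
have S5 : circle_avg (fun t => normc (trig_poly2 n.+1 (dilate d r2) (dilate e r2) t)) *
   power_mean p (fun t => normc (trig_poly n.+1 (dilate c r1) t)) <= (A + eps) * (B + eps).
  apply: ler_pM => //; last exact: power_mean_ge0.
  by apply: circle_avg_ge0 => t; exact: normc_ge0.
apply: le_trans (lerD S5 (lexx eps)) _.
clearbody A B eps.
apply: (@le_trans _ _ (A * B + (A + B + K + 1) * eps)).
  have := ler_wpM2r eps0 epsK; lra.
by rewrite lerD2l -mulrA; apply: ler_wpM2l => //; lra.
Qed.

(** The pointwise form, which turns into bounds for suprema by Hoelder's
    inequality. *)
Lemma conv_ptwise c d e r1 r2 t : tame c -> tame d -> tame e -> e 0%N = 0 ->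
  0 <= r1 < 1 -> 0 <= r2 < 1 ->
  normc (circ (fun n => c n * d n) (r1 * r2) t) <=
  circle_avg (fun s => normc (circ c r1 (t - s)) * normc (kern d e r2 s)).
Proof.
move=> tc td te e0 r01 r02.
have [K [x [K0 /[dup] x01 /andP[x0 x1] H]]] := conv_approx tc td te r01 r02.
have cG := continuous_normc (continuous_oppr_arg (t:=t) (continuous_circ tc r01)).
have cK := continuous_normc (continuous_kern td te r02).
set A := circle_avg _.
have [B [B0 HG HK]] : exists B, [/\ 0 <= B, (forall s, normc (circ c r1 s) <= B) &
   forall s, normc (kern d e r2 s) <= B].
  have [B1 B10 HB1] := psum_bounded tc r01.
  have [B2 B20 HB2] := psum_bounded td r02.
  have [B3 B30 HB3] := psum_bounded te r02.
  case/andP: r01 => a0 a1; case/andP: r02 => b0 b1.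
  exists (B1 + B2 + B3); split; first by rewrite !addr_ge0.
    by move=> s; rewrite circE; apply: le_trans (HB1 _ _) _; rewrite ?normc_rcis//; lra.
  move=> s; apply: le_trans (le_normcD _ _) _.
  have h2 : normc (circ d r2 s) <= B2 by rewrite circE; apply: HB2; rewrite normc_rcis.
  have h3 : normc (circ e r2 (- s)) <= B3 by rewrite circE; apply: HB3; rewrite normc_rcis.
  lra.
apply: (@le_geo _ ((2 * B + K + 1) * K) x) => // n.
set eps := K * x ^+ n.+1.
have eps0 : 0 <= eps by rewrite mulr_ge0// exprn_ge0.
have epsn : eps <= K * x ^+ n.
  by rewrite ler_wpM2l// exprS ler_piMl ?exprn_ge0// ltW.
have epsK : eps <= K.
  by rewrite -[leRHS]mulr1 ler_wpM2l// exprn_ile1// ltW.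
have n0 : (0 < n.+1)%N by [].
have c1 := continuous_normc (continuous_oppr_arg (t:=t) (@continuous_trig_poly R n.+1 (dilate c r1))).
have c2 := continuous_normc (@continuous_trig_poly2 R n.+1 (dilate d r2) (dilate e r2)).
have [_ _ h3] := H n.+1 t.
apply: le_trans (normc_le_add h3) _.
have S2 := @trig_conv_ptwise R n.+1 (dilate c r1) (dilate d r2) (dilate e r2) n0 (dilate0 r2 e0) t.
apply: le_trans (lerD S2 (lexx eps)) _.
have S3 : circle_avg (fun s => normc (trig_poly n.+1 (dilate c r1) (t - s)) *
   normc (trig_poly2 n.+1 (dilate d r2) (dilate e r2) s)) <= A + eps * (2 * B + K).
  apply: circle_avg_le_add; [exact: continuousMf|exact: continuousMf|] => s.
  have g1 : normc (trig_poly n.+1 (dilate c r1) (t - s)) <= normc (circ c r1 (t - s)) + eps.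
    by apply: normc_le_add; rewrite normcBC; have [] := H n.+1 (t - s).
  have k1 : normc (trig_poly2 n.+1 (dilate d r2) (dilate e r2) s) <= normc (kern d e r2 s) + eps.
    by apply: normc_le_add; rewrite normcBC; have [] := H n.+1 s.
  have := HG (t - s); have := HK s.
  move: (normc_ge0 (circ c r1 (t - s))) (normc_ge0 (kern d e r2 s)).
  have := ler_pM (normc_ge0 _) (normc_ge0 _) g1 k1.
  move: (normc (circ c r1 (t - s))) (normc (kern d e r2 s)) => G k.
  move=> h G0 k00 kB GB; apply: le_trans h _.
  have := ler_wpM2l eps0 GB; have := ler_wpM2l eps0 kB; have := ler_wpM2l eps0 epsK.
  lra.
apply: le_trans (lerD S3 (lexx eps)) _.
have h4 : eps * (2 * B + K) + eps = (2 * B + K + 1) * eps by ring.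
rewrite -addrA lerD2l h4 -[leRHS]mulrA.
by apply: (ler_wpM2l _ epsn); rewrite !addr_ge0// mulr_ge0.
Qed.

End Convolution.

(** * The Poisson kernel and the growth of integral means *)

Section Poisson.
Context {R : realType}.
Implicit Types (c d e : nat -> R[i]) (r s t p q x : R) (z : R[i]).

Definition mono (k : R[i]) n : nat -> R[i] := fun m => if m == n then k else 0.

Lemma tame_mono k n : tame (mono k n).
Proof.
move=> r /andP[r0 r1]; exists (normc k) => m; rewrite /mono.
case: eqP => _; last by rewrite normc0 mul0r normc_ge0.
by rewrite ler_piMr ?normc_ge0// exprn_ile1// ltW.
Qed.

Lemma psum_mono k n z : psum (mono k n) z = k * z ^+ n.
Proof.
rewrite psumE; apply: cvgc_unique; apply/cvgc_seqP => eps e0; exists n.+1 => m nm.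
rewrite /series /= big_mkord (bigD1 (Ordinal nm))//= /mono eqxx big1 ?addr0.
  by rewrite subrr normc0.
move=> i ni; case: eqP => [h|_]; last by rewrite mul0r.
by move: ni; rewrite -val_eqE /= h eqxx.
Qed.

Lemma tame0 : tame (fun=> 0 : R[i]).
Proof. by move=> r _; exists 0 => n; rewrite normc0 mul0r. Qed.

Lemma kern0 d r t : kern d (fun=> 0) r t = circ d r t.
Proof.
rewrite /kern [circ (fun=> 0) _ _]circE (_ : (fun=> 0) = mono 0 0) ?psum_mono ?mul0r ?addr0//.
by apply/funext => n; rewrite /mono; case: ifP.
Qed.

Definition ones : nat -> R[i] := fun=> 1.

Lemma tame_ones : tame ones.
Proof.
move=> r /andP[r0 r1]; exists 1 => m.
by rewrite /ones normc1 mul1r exprn_ile1// ltW.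
Qed.

Definition shiftr c : nat -> R[i] := fun n => if n is m.+1 then c m else 0.

Lemma tame_shiftr c : tame c -> tame (shiftr c).
Proof. exact: tame_cons. Qed.

Lemma psum_shiftr c z : tame c -> normc z < 1 -> psum (shiftr c) z = z * psum c z.
Proof. exact: psum_cons. Qed.

Lemma normc_lt1_neq z : normc z < 1 -> 1 - z != 0.
Proof.
move=> z1; rewrite subr_eq0; apply: contraTneq z1 => <-.
by rewrite normc1 ltxx.
Qed.

(** Multiplication by [1 - z] takes differences of successive coefficients. *)
Lemma psum_partial_sums c z : tame c -> normc z < 1 ->
  psum (partial_sums c) z = psum c z / (1 - z).
Proof.
move=> tc z1; apply: (mulIf (normc_lt1_neq z1)).
have tS := tame_partial_sums tc.
rewrite mulfVK ?normc_lt1_neq// mulrBr mulr1 [_ * z]mulrC -psum_shiftr//.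
rewrite -psumB//; last exact: tame_shiftr.
congr psum; apply/funext => -[|n]; rewrite /partial_sums /=.
  by rewrite subr0 big_ord1.
by rewrite big_ord_recr/= addrC addrK.
Qed.

Lemma psum_ones z : normc z < 1 -> psum ones z = (1 - z)^-1.
Proof.
move=> z1; have -> : ones = partial_sums (mono 1 0).
  apply/funext => n; rewrite /partial_sums (bigD1 ord0)//= /mono eqxx big1 ?addr0//.
  by move=> i; rewrite -val_eqE /= => /negbTE ->.
by rewrite psum_partial_sums ?psum_mono ?expr0 ?mul1r//; exact: tame_mono.
Qed.

Definition cauchy_norm r t : R := (normc (1 - r%:C * cis t))^-1.

Definition poisson r t : R := (1 - r ^+ 2) * cauchy_norm r t ^+ 2.

Lemma sub_le_normc1B r t : 0 <= r < 1 -> 1 - r <= normc (1 - r%:C * cis t).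
Proof.
move=> /andP[r0 r1]; apply: le_trans (ler_normcB _ _).
by rewrite normc1 normc_rcis.
Qed.

Lemma normc1B_le2 r t : 0 <= r < 1 -> normc (1 - r%:C * cis t) <= 2.
Proof.
move=> /andP[r0 r1]; apply: le_trans (le_normcD _ _) _.
by rewrite normcN normc1 normc_rcis//; lra.
Qed.

Lemma normc1B_gt0 r t : 0 <= r < 1 -> 0 < normc (1 - r%:C * cis t).
Proof.
move=> /[dup] r01 /andP[r0 r1]; apply: lt_le_trans (sub_le_normc1B t r01).
by rewrite subr_gt0.
Qed.

Lemma cauchy_norm_ge0 r t : 0 <= cauchy_norm r t.
Proof. by rewrite invr_ge0 normc_ge0. Qed.

Lemma poisson_ge0 r t : 0 <= r < 1 -> 0 <= poisson r t.
Proof.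
move=> /andP[r0 r1]; rewrite mulr_ge0 ?exprn_ge0 ?cauchy_norm_ge0//.
by rewrite subr_ge0 exprn_ile1// ltW.
Qed.

Lemma circ_onesE r t : 0 <= r < 1 -> normc (circ ones r t) = cauchy_norm r t.
Proof.
move=> /andP[r0 r1]; rewrite circE psum_ones ?normc_rcis//.
by rewrite normcV.
Qed.

Lemma continuous_cauchy_norm r : 0 <= r < 1 -> continuous (cauchy_norm r).
Proof.
move=> r01; rewrite (_ : cauchy_norm r = fun t => normc (circ ones r t)).
  by apply: continuous_normc; apply: continuous_circ => //; exact: tame_ones.
by apply/funext => t; rewrite circ_onesE.
Qed.

Lemma cauchy_normN r t : cauchy_norm r (- t) = cauchy_norm r t.
Proof.
rewrite /cauchy_norm /cis cosN sinN; congr (_ ^-1); rewrite /normc /=.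
by rewrite !mul0r !subr0 !addr0 sub0r mulrN opprK sub0r sqrrN.
Qed.

Lemma cauchy_norm_periodic r t : cauchy_norm r (t + 2 * pi) = cauchy_norm r t.
Proof. by rewrite /cauchy_norm cis_periodic. Qed.

(** The Poisson kernel is the Cauchy kernel plus its conjugate without the
    constant term. *)
Lemma kern_poisson r t : 0 <= r < 1 -> kern ones (shiftr ones) r t = (poisson r t)%:C.
Proof.
move=> /[dup] r01 /andP[r0 r1].
rewrite /kern !circE psum_shiftr ?psum_ones ?normc_rcis//; last exact: tame_ones.
rewrite /poisson /cauchy_norm.
set z := r%:C * cis t; set w := r%:C * cis (- t).
have zw : z * w = (r ^+ 2)%:C.
  by rewrite /z /w cisN mulrACA mulfV ?cis_neq0// mulr1 rmorphXn.
have z1 : 1 - z != 0 by rewrite normc_lt1_neq// normc_rcis.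
have w1 : 1 - w != 0 by rewrite normc_lt1_neq// normc_rcis.
have pzw : (1 - z) * (1 - w) = (normc (1 - z) ^+ 2)%:C.
  rewrite /z /w /cis cosN sinN /normc sqr_sqrtr ?addr_ge0 ?sqr_ge0//=.
  simpc; congr (_ +i* _); ring.
have -> : ((1 - r ^+ 2) * (normc (1 - z))^-1 ^+ 2)%:C = (1 - z * w) / ((1 - z) * (1 - w)).
  have e1 (a b : R) : ((1 - a) * b^-1)%:C = (1 - a%:C) / b%:C.
    by rewrite rmorphM rmorphB rmorph1 fmorphV.
  by rewrite zw pzw exprVn e1.
by field; rewrite z1 w1.
Qed.

(** The quadrature formula against the constant function one: all nonzero
    frequencies cancel. *)
Lemma poisson_avg_le1 r : 0 <= r < 1 -> circle_avg (poisson r) <= 1.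
Proof.
move=> r01; have cc := continuous_cauchy_norm r01.
have cp : continuous (poisson r).
  rewrite (_ : poisson r = fun t => (1 - r ^+ 2) * (cauchy_norm r t * cauchy_norm r t)).
    by apply: continuous_scale; exact: continuousMf.
  by apply/funext => t; rewrite /poisson expr2.
have pp : periodic2pi (poisson r) by move=> t; rewrite /poisson cauchy_norm_periodic.
have to := tame_ones; have ts := tame_shiftr to.
have [K [x [K0 /[dup] x01 /andP[x0 x1] H]]] := kern_approx to ts r01.
apply: (@le_geo _ K x) => // n.
have M0 : (0 < n.+1)%N by [].
rewrite -(circle_avg_nodes M0 cp pp (fun t => poisson_ge0 t r01)).
rewrite -[leRHS]circle_avg_cst; apply: circle_avg_le.
- apply: continuous_scale; apply: continuous_sum_ord => k s.
  apply: (@continuous_comp _ _ _ (fun s => s + node n.+1 k) (poisson r)); last exact: cp.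
  by apply: cvgD; [exact: cvg_id|exact: cvg_cst].
- by move=> ?; exact: cvg_cst.
move=> s; have N0 : 0 < (2 * n.+1)%:R :> R by rewrite ltr0n.
rewrite ler_pdivrMl//.
have := @trig_conv R n.+1 (mono 1 0) (dilate ones r) (dilate (shiftr ones) r) M0 (dilate0 r erefl) s 0.
have G1 t : trig_poly n.+1 (mono 1 0) t = 1.
  rewrite /trig_poly (bigD1 ord0)//= /mono eqxx mul1r expr0 big1 ?addr0//.
  by move=> i; rewrite -val_eqE /= => /negbTE ->; rewrite mul0r.
have -> : \sum_(i < n.+1) mono 1 0 i * dilate ones r i * cis 0 ^+ i = 1.
  rewrite (bigD1 ord0)//= big1 ?addr0.
    by rewrite /mono eqxx /dilate /ones !expr0 !mulr1.
  by move=> i; rewrite -val_eqE /= /mono => /negbTE ->; rewrite !mul0r.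
rewrite mulr1 => E.
have {}E : \sum_(k < 2 * n.+1) trig_poly2 n.+1 (dilate ones r) (dilate (shiftr ones) r) (s + node n.+1 k)
  = (2 * n.+1)%:R%:C.
  rewrite rmorph_nat -E; apply: eq_bigr => k _.
  by rewrite -[LHS]mul1r; congr (_ * _); rewrite G1.
have ReE : \sum_(k < 2 * n.+1) Re (trig_poly2 n.+1 (dilate ones r) (dilate (shiftr ones) r) (s + node n.+1 k))
  = (2 * n.+1)%:R.
  rewrite -[RHS]/(Re ((2 * n.+1)%:R%:C)) -E.
  rewrite (big_morph (@complex.Re R) (id1 := 0) (op1 := +%R))//.
  by case=> ? ? [].
apply: (@le_trans _ _ (\sum_(k < 2 * n.+1) (Re (trig_poly2 n.+1 (dilate ones r) (dilate (shiftr ones) r) (s + node n.+1 k)) + K * x ^+ n))); last first.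
  by rewrite big_split/= ReE sumr_const card_ord -(mulr_natl (K * _)) mulrDr mulr1.
apply: ler_sum => k _; rewrite -lerBlDl.
have h := H n.+1 (s + node n.+1 k).
rewrite kern_poisson// in h.
apply: (@le_trans _ _ (K * x ^+ n.+1)); last first.
  by rewrite ler_wpM2l// exprS ler_piMl ?exprn_ge0// ltW.
apply: le_trans h; apply: le_trans (le_Re_normc _).
apply: le_trans (ler_norm _).
by case: (trig_poly2 _ _ _ _).
Qed.

Definition Mp p c r := power_mean p (fun t => normc (circ c r t)).

(** The function on the smaller circle is the convolution of the one on the larger
    circle with a Poisson kernel. *)
Lemma Mp_mul p c r1 r2 : tame c -> 1 <= p -> 0 <= r1 < 1 -> 0 <= r2 < 1 ->
  Mp p c (r1 * r2) <= Mp p c r1.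
Proof.
move=> tc p1 r01 r02; have to := tame_ones; have ts := tame_shiftr to.
have := @conv_young R c ones (shiftr ones) r1 r2 p tc to ts erefl r01 r02 p1.
have -> : (fun n => c n * ones n) = c by apply/funext => n; rewrite /ones mulr1.
have -> : (fun s => normc (kern ones (shiftr ones) r2 s)) = poisson r2.
  by apply/funext => s; rewrite kern_poisson// normc_real ger0_norm// poisson_ge0.
move=> h; apply: le_trans h _; rewrite ler_piMl ?power_mean_ge0//.
exact: poisson_avg_le1.
Qed.

Lemma Mp_le p c r1 r2 : tame c -> 1 <= p -> 0 <= r1 -> r1 <= r2 -> r2 < 1 ->
  Mp p c r1 <= Mp p c r2.
Proof.
move=> tc p1 r10; rewrite le_eqVlt => /predU1P[->//|r12] r21.
have r20 : 0 < r2 by exact: le_lt_trans r12.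
have -> : r1 = r2 * (r1 / r2) by rewrite mulrC divfK// gt_eqF.
apply: Mp_mul => //; first by rewrite ltW.
by rewrite divr_ge0 ?(ltW r20)//= ltr_pdivrMr// mul1r.
Qed.

Lemma Mp_ge0 p c r : 0 <= Mp p c r.
Proof. exact: power_mean_ge0. Qed.

End Poisson.

(** * Means of the Cauchy kernel *)

Section KernelEstimates.
Context {R : realType}.
Implicit Types (c d e : nat -> R[i]) (r s t p q x y : R) (z : R[i]) (u v w : R -> R).

(** Where [|1 - r e^{it}|] is about [2^j (1 - r)], a power of the Cauchy kernel is
    controlled by the Poisson kernel of radius [1 - 2^j (1 - r)]. The minimum with
    one keeps that radius nonnegative. *)
Lemma cauchy_norm_dyadic q r t J : 1 < q -> 0 <= r < 1 -> 2 < 2 ^+ J * (1 - r) ->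
  cauchy_norm r t `^ q <=
  32 * \sum_(j < J) (2 ^+ j * (1 - r)) `^ (1 - q) *
     poisson (1 - Num.min (2 ^+ j * (1 - r)) 1) t.
Proof.
move=> q1 /[dup] r01 /andP[r0 r1] HJ.
set x := 1 - r; have x0 : 0 < x by rewrite subr_gt0.
set u := normc (1 - r%:C * cis t).
have u0 : 0 < u by exact: normc1B_gt0.
have xu : x <= u by exact: sub_le_normc1B.
have u2 : u <= 2 by exact: normc1B_le2.
have [j jJ /andP[ju uj]] : exists2 j, (j < J)%N & 2 ^+ j * x <= u < 2 ^+ j.+1 * x.
  have ex : exists k, u < 2 ^+ k * x by exists J; exact: le_lt_trans HJ.
  have k0 := ex_minnP ex; case: k0 => -[|k] uk min.
    by move: uk; rewrite expr0 mul1r ltNge xu.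
  exists k; last by rewrite uk andbT leNgt; apply/negP => /min; rewrite ltnn.
  by apply: (leq_trans _ (min J _)) => //; exact: le_lt_trans HJ.
set lam := 2 ^+ j * x; set mu := Num.min lam 1.
have xlam : x <= lam by rewrite ler_peMl ?(ltW x0)// exprn_ege1// ler1n.
have lam0 : 0 < lam by rewrite mulr_gt0// exprn_gt0.
have mu0 : 0 < mu by rewrite lt_min lam0 ltr01.
have mu1 : mu <= 1 by rewrite ge_min lexx orbT.
have mulam : mu <= lam by rewrite ge_min lexx.
have lammu : lam / 2 <= mu.
  have lam2 : lam <= 2 by exact: le_trans ju u2.
  by rewrite le_min !ler_pdivrMr// mul1r lam2 andbT ler_peMr ?(ltW lam0)// ler1n.
have xmu : x <= mu by rewrite le_min xlam /x; lra.
set P := poisson (1 - mu) t.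
have rmu : 0 <= 1 - mu < 1 by apply/andP; split; lra.
have key : 1 <= 32 * lam * P.
  set U := normc (1 - (1 - mu)%:C * cis t).
  have U0 : 0 < U by exact: normc1B_gt0.
  have UU : U <= 4 * lam.
    have -> : U = normc ((1 - r%:C * cis t) + (mu - x)%:C * cis t).
      by rewrite /U /x !rmorphB; congr normc; ring.
    apply: le_trans (le_normcD _ _) _.
    rewrite normc_rcis ?subr_ge0// -/u.
    have u2lam : u < 2 * lam by rewrite /lam mulrA -exprS.
    clear -u2lam mulam x0 lam0; lra.
  rewrite /P /poisson /cauchy_norm -/U exprVn mulrA ler_pdivlMr ?exprn_gt0// mul1r.
  have h : mu <= 1 - (1 - mu) ^+ 2 by rewrite expr2; nra.
  have h2 : U ^+ 2 <= (4 * lam) ^+ 2 by apply: lerXn2r; rewrite ?nnegrE ?(ltW U0)// mulr_ge0// ltW.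
  apply: le_trans h2 _.
  apply: (@le_trans _ _ (32 * lam * (lam / 2))); first by rewrite exprMn; lra.
  by apply: ler_wpM2l; [rewrite mulr_ge0// ltW|exact: le_trans h].
have qu : u^-1 `^ q <= lam `^ (- q).
  rewrite -(powR_inv1 (ltW u0)) -powRrM mulN1r !powRN lef_pV2 ?posrE ?powR_gt0//.
  by apply: ge0_ler_powR; rewrite ?nnegrE ?(ltW lam0) ?(ltW u0)//; lra.
rewrite /cauchy_norm -/u; apply: le_trans qu _.
rewrite (bigD1 (Ordinal jJ))//= -/lam -/mu -/P mulrDr.
apply: (@le_trans _ _ (32 * (lam `^ (1 - q) * P))); last first.
  rewrite lerDl mulr_ge0// sumr_ge0// => i _; rewrite mulr_ge0 ?powR_ge0// poisson_ge0//.
  have m0 : 0 < Num.min (2 ^+ i * x) 1 by rewrite lt_min ltr01 mulr_gt0// exprn_gt0.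
  have m1 : Num.min (2 ^+ i * x) 1 <= 1 by rewrite ge_min lexx orbT.
  by apply/andP; split; lra.
have -> : lam `^ (1 - q) = lam * lam `^ (- q).
  by rewrite powRD ?powRr1 ?(ltW lam0)// (gt_eqF lam0) implybT.
have -> : 32 * (lam * lam `^ (- q) * P) = lam `^ (- q) * (32 * lam * P) by ring.
by rewrite ler_peMr ?powR_ge0.
Qed.

(** Poisson kernels have mean at most one, and the dyadic weights decrease
    geometrically since [1 < q]. *)
Lemma cauchy_norm_mean q : 1 < q -> exists2 C, 0 <= C &
  forall r, 0 <= r < 1 -> circle_avg (fun t => cauchy_norm r t `^ q) <= C * (1 - r) `^ (1 - q).
Proof.
move=> q1; set th := 2 `^ (1 - q) : R.
have th0 : 0 <= th by exact: powR_ge0.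
have th1 : th < 1.
  rewrite /th -[1 - q]opprB powRN invf_lt1 ?powR_gt0//.
  have q10 : 0 < q - 1 by rewrite subr_gt0.
  have := @gt0_ltr_powR R _ q10 1 2; rewrite powR1E !nnegrE; apply => //.
  by rewrite ltr1n.
exists (32 * (1 - th)^-1); first by rewrite mulr_ge0// invr_ge0 subr_ge0 ltW.
move=> r /[dup] r01 /andP[r0 r1].
have x0 : 0 < 1 - r by rewrite subr_gt0.
have [J HJ] : exists J, 2 < 2 ^+ J * (1 - r).
  exists (Num.truncn (2 / (1 - r))).+1; rewrite -ltr_pdivrMr//.
  apply: lt_le_trans (truncnS_gt _) _.
  by rewrite -natrX ler_nat ltnW// ltn_expl.
have rj (j : nat) : 0 <= 1 - Num.min (2 ^+ j * (1 - r)) 1 < 1.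
  have m0 : 0 < Num.min (2 ^+ j * (1 - r)) 1 by rewrite lt_min ltr01 mulr_gt0// exprn_gt0.
  have m1 : Num.min (2 ^+ j * (1 - r)) 1 <= 1 by rewrite ge_min lexx orbT.
  by apply/andP; split; lra.
have cpo (j : nat) : continuous (poisson (1 - Num.min (2 ^+ j * (1 - r)) 1)).
  have cc := continuous_cauchy_norm (rj j).
  rewrite (_ : poisson _ = fun t => (1 - (1 - Num.min (2 ^+ j * (1 - r)) 1) ^+ 2) *
     (cauchy_norm (1 - Num.min (2 ^+ j * (1 - r)) 1) t * cauchy_norm (1 - Num.min (2 ^+ j * (1 - r)) 1) t)).
    by apply: continuous_scale; exact: continuousMf.
  by apply/funext => t; rewrite /poisson expr2.
have cs (j : 'I_J) : continuous (fun t => (2 ^+ j * (1 - r)) `^ (1 - q) *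
     poisson (1 - Num.min (2 ^+ j * (1 - r)) 1) t).
  exact: continuous_scale.
apply: (@le_trans _ _ (circle_avg (fun t => 32 * \sum_(j < J) (2 ^+ j * (1 - r)) `^ (1 - q) *
     poisson (1 - Num.min (2 ^+ j * (1 - r)) 1) t))).
  apply: circle_avg_le.
  - apply: continuous_powR; [by lra|by move=> t; exact: cauchy_norm_ge0|exact: continuous_cauchy_norm].
  - by apply: continuous_scale; exact: continuous_sum_ord.
  - by move=> t; exact: cauchy_norm_dyadic.
rewrite circle_avgZ; last exact: continuous_sum_ord.
rewrite circle_avg_sum// -mulrA; apply: ler_wpM2l => //.
apply: (@le_trans _ _ (\sum_(j < J) th ^+ j * (1 - r) `^ (1 - q))).
  apply: ler_sum => j _; rewrite circle_avgZ//.
  have e : (2 ^+ j : R) `^ (1 - q) = th ^+ j.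
    by rewrite -powR_mulrn// -powRrM mulrC powRrM powR_mulrn.
  rewrite powRM ?exprn_ge0 ?(ltW x0)// e.
  apply: ler_piMr; first by rewrite mulr_ge0 ?exprn_ge0 ?powR_ge0.
  exact: poisson_avg_le1.
by rewrite -mulr_suml; apply: ler_wpM2r; [exact: powR_ge0|apply: sum_geo_le; rewrite th0].
Qed.

Lemma conj_gt1 p q : 1 < p -> p^-1 + q^-1 = 1 -> 1 < q.
Proof.
move=> p1 pq; have p0 : 0 < p by exact: lt_trans p1.
have pi0 : 0 < p^-1 by rewrite invr_gt0.
have pi1 : p^-1 < 1 by rewrite invf_lt1.
have qE : q^-1 = 1 - p^-1 by rewrite -pq (addrC p^-1) addrK.
have q0 : 0 < q by rewrite -invr_gt0 qE subr_gt0.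
by rewrite -invf_lt1// qE; lra.
Qed.

Lemma cauchy_norm_power_mean p q : 1 < p -> p^-1 + q^-1 = 1 -> exists2 C, 0 <= C &
  forall r, 0 <= r < 1 -> power_mean q (cauchy_norm r) <= C * (1 - r) `^ (- p^-1).
Proof.
move=> p1 pq; have q1 := conj_gt1 p1 pq; have q0 : 0 < q by exact: lt_trans q1.
have [C C0 HC] := cauchy_norm_mean q1.
exists (C `^ q^-1); first exact: powR_ge0.
move=> r /[dup] r01 /andP[r0 r1].
rewrite power_meanE.
have -> : - p^-1 = (1 - q) * q^-1.
  have qn : q != 0 by rewrite gt_eqF.
  by rewrite mulrBl mulfV// mul1r -pq; lra.
rewrite powRrM -powRM ?powR_ge0//.
apply: ge0_ler_powR; rewrite ?nnegrE ?invr_ge0 ?(ltW q0) ?mulr_ge0 ?powR_ge0//.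
  by apply: circle_avg_ge0 => t; exact: powR_ge0.
exact: HC.
Qed.

(** Hoelder's inequality against the Cauchy kernel of radius [r2]. *)
Lemma circ_sup p : 1 < p -> exists2 C, 0 <= C &
  forall c r1 r2 t, tame c -> 0 <= r1 < 1 -> 0 <= r2 < 1 ->
    normc (circ c (r1 * r2) t) <= C * (1 - r2) `^ (- p^-1) * Mp p c r1.
Proof.
move=> p1; have p0 : 0 < p by exact: lt_trans p1.
pose q := p / (p - 1).
have pq : p^-1 + q^-1 = 1 by rewrite /q; field; rewrite !gt_eqF// subr_gt0.
have q1 := conj_gt1 p1 pq; have q0 : 0 < q by exact: lt_trans q1.
have [C C0 HC] := cauchy_norm_power_mean p1 pq.
exists C => // c r1 r2 t tc r01 r02.
have := @conv_ptwise R ones c (fun=> 0) r2 r1 t tame_ones tc (@tame0 R) erefl r02 r01.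
rewrite mulrC (_ : (fun n => ones n * c n) = c); last first.
  by apply/funext => n; rewrite /ones mul1r.
move=> h; apply: le_trans h _.
have fE : (fun s => normc (circ ones r2 (t - s)) * normc (kern c (fun=> 0) r1 s)) =
    (fun s => cauchy_norm r2 (s - t) * normc (circ c r1 s)).
  by apply/funext => s; rewrite kern0 circ_onesE// -cauchy_normN opprB.
rewrite fE.
have cc := continuous_cauchy_norm r02.
have cc' : continuous (fun s => cauchy_norm r2 (s - t)).
  move=> s; apply: (@continuous_comp _ _ _ (fun s => s - t) (cauchy_norm r2)); last exact: cc.
  by apply: cvgB; [exact: cvg_id|exact: cvg_cst].
have cf := continuous_normc (continuous_circ tc r01).
have qp : q^-1 + p^-1 = 1 by rewrite addrC.
apply: le_trans (hoelder_mean q0 p0 qp (fun s => cauchy_norm_ge0 _ _) (fun s => normc_ge0 _) cc' cf) _.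
apply: ler_wpM2r; first exact: Mp_ge0.
rewrite (@power_mean_shift R q (cauchy_norm r2) (- t) q0 cc (@cauchy_norm_periodic R r2) (fun s => cauchy_norm_ge0 _ _)).
exact: HC.
Qed.

End KernelEstimates.

(** * Mean value inequality and dyadic circles *)

Section MeanValue.
Context {R : realType}.
Implicit Types (c : nat -> R[i]) (a b r s t p L : R) (u v w : R -> R).

(** The properties shared by power means and by evaluations at a point of the
    circle; the mean value inequality is needed for both. *)
Definition mean_like (nu : (R -> R) -> R) : Prop :=
  [/\ forall u w, continuous u -> continuous w -> (forall t, 0 <= u t) -> (forall t, 0 <= w t) ->
        nu (fun t => u t + w t) <= nu u + nu w,
      forall u w, continuous u -> continuous w -> (forall t, 0 <= u t) ->
        (forall t, u t <= w t) -> nu u <= nu w,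
      forall k : R, 0 <= k -> nu (fun=> k) <= k &
      forall (k : R) u, 0 <= k -> continuous u -> (forall t, 0 <= u t) ->
        nu (fun t => k * u t) <= k * nu u].

Lemma mean_like_power_mean p : 1 <= p -> mean_like (power_mean p).
Proof.
move=> p1; have p0 : 0 < p by exact: lt_le_trans p1.
split=> [u w cu cw u0 w0|u w cu cw u0 uw|k k0|k u k0 cu u0].
- exact: minkowski_mean.
- exact: power_mean_le.
- by rewrite power_mean_cst.
- by rewrite power_meanZ.
Qed.

Lemma mean_like_eval t : mean_like (fun u => u t).
Proof. by split. Qed.

Lemma continuous_circB c a b : tame c -> 0 <= a < 1 -> 0 <= b < 1 ->
  continuous (fun t => normc (circ c b t - circ c a t)).
Proof.
move=> tc a01 b01; apply: (@continuous_normc R (fun t => circ c b t - circ c a t)) => t.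
by apply: cvgB; apply: continuous_circ.
Qed.

(** Along a subdivision into [n] equal steps the second-order Taylor remainders
    add up to a quantity of order [1 / n]. *)
Lemma mean_value nu c a b L : mean_like nu -> tame c -> 0 <= a -> a <= b -> b < 1 ->
  (forall r, a <= r -> r <= b -> nu (fun t => normc (circ (shift_deriv c) r t)) <= L) ->
  nu (fun t => normc (circ c b t - circ c a t)) <= (b - a) * L.
Proof.
move=> [nuD nu_le nu_cst nuZ] tc a0 ab b1 HL.
have b01 : 0 <= b < 1 by rewrite (le_trans a0 ab).
have a01 : 0 <= a < 1 by rewrite a0 (le_lt_trans ab b1).
have [K K0 HK] := psum_taylor2 tc b01.
have step x y : a <= x -> x <= y -> y <= b ->
    nu (fun t => normc (circ c y t - circ c x t)) <= (y - x) * L + K * (y - x) ^+ 2.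
  move=> ax xy yb.
  have x01 : 0 <= x < 1 by rewrite (le_trans a0 ax) (le_lt_trans (le_trans xy yb) b1).
  have y01 : 0 <= y < 1.
    by rewrite (le_trans a0 (le_trans ax xy)) (le_lt_trans yb b1).
  have yx0 : 0 <= y - x by rewrite subr_ge0.
  have Kyx : 0 <= K * (y - x) ^+ 2 by rewrite mulr_ge0// exprn_ge0.
  have cd := continuous_normc (continuous_circ (tame_deriv tc) x01).
  have cy := continuous_circB tc x01 y01.
  have ck : continuous (fun _ : R => K * (y - x) ^+ 2) by move=> ?; exact: cvg_cst.
  have cds : continuous (fun t => (y - x) * normc (circ (shift_deriv c) x t)) by exact: continuous_scale.
  have ds0 t : 0 <= (y - x) * normc (circ (shift_deriv c) x t) by rewrite mulr_ge0 ?normc_ge0.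
  apply: (@le_trans _ _ (nu (fun t => (y - x) * normc (circ (shift_deriv c) x t) + K * (y - x) ^+ 2))).
    apply: nu_le => //; first exact: continuousDf.
      by move=> t; exact: normc_ge0.
    move=> t; rewrite !circE.
    have /andP[x0 x1] := x01; have /andP[y0 y1] := y01.
    have := HK (x%:C * cis t) (y%:C * cis t).
    rewrite !normc_rcis// (le_trans xy yb) yb => /(_ isT isT).
    rewrite -mulrBl -rmorphB normcM normc_cis mulr1 normc_real ger0_norm// => h.
    set A := psum _ _ - psum _ _ in h *.
    set B := _ * psum (shift_deriv c) _ in h.
    have -> : (y - x) * normc (psum (shift_deriv c) (x%:C * cis t)) = normc B.
      by rewrite /B !normcM normc_cis mulr1 normc_real ger0_norm.
    by rewrite -[A](subrK B); apply: le_trans (le_normcD _ _) _; rewrite [leLHS]addrC lerD2l.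
  apply: le_trans (nuD _ _ cds ck ds0 (fun=> Kyx)) _; apply: lerD; last exact: nu_cst.
  apply: le_trans (nuZ _ _ yx0 cd (fun t => normc_ge0 _)) _.
  by apply: ler_wpM2l => //; apply: HL => //; exact: le_trans xy yb.
have sub n : nu (fun t => normc (circ c b t - circ c a t)) <= (b - a) * L + K * (b - a) ^+ 2 / n.+1%:R.
  pose h := (b - a) / n.+1%:R.
  have h0 : 0 <= h by rewrite divr_ge0// subr_ge0.
  have hn : n.+1%:R * h = b - a by rewrite mulrC divfK.
  have ind k : (k <= n.+1)%N -> nu (fun t => normc (circ c (a + k%:R * h) t - circ c a t))
      <= k%:R * (h * L + K * h ^+ 2).
    elim: k => [_|k IH kn].
      rewrite !mul0r addr0 (_ : (fun _ => _) = fun=> 0) ?nu_cst//.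
      by apply/funext => t; rewrite subrr normc0.
    have kb (m : nat) : (m <= n.+1)%N -> a <= a + m%:R * h /\ a + m%:R * h <= b.
      move=> mn; split; first by rewrite lerDl mulr_ge0.
      by rewrite -lerBrDl -hn ler_wpM2r// ler_nat.
    have [k1 k2] := kb k (ltnW kn); have [k3 k4] := kb _ kn.
    have k01 : 0 <= a + k%:R * h < 1 by rewrite (le_trans a0 k1) (le_lt_trans k2 b1).
    have k01' : 0 <= a + k.+1%:R * h < 1 by rewrite (le_trans a0 k3) (le_lt_trans k4 b1).
    have kk : a + k%:R * h <= a + k.+1%:R * h by rewrite lerD2l ler_wpM2r// ler_nat.
    have c1 := continuous_circB tc k01 k01'.
    have c2 := continuous_circB tc a01 k01.
    apply: (@le_trans _ _ (nu (fun t => normc (circ c (a + k.+1%:R * h) t - circ c (a + k%:R * h) t)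
        + normc (circ c (a + k%:R * h) t - circ c a t)))).
      apply: nu_le => //; first exact: (continuous_circB tc a01 k01').
      - exact: continuousDf.
      - by move=> t; exact: normc_ge0.
      - move=> t; rewrite -(subrKA (circ c (a + k%:R * h) t)); exact: le_normcD.
    apply: le_trans (nuD _ _ c1 c2 (fun t => normc_ge0 _) (fun t => normc_ge0 _)) _.
    have := lerD (step _ _ k1 kk k4) (IH (ltnW kn)).
    have -> : a + k.+1%:R * h - (a + k%:R * h) = h by rewrite -natr1; ring.
    move=> H; apply: le_trans H _; rewrite -[k.+1%:R]natr1; lra.
  have := ind n.+1 (leqnn _); rewrite hn subrKC => H; apply: le_trans H _.
  rewrite le_eqVlt; apply/orP; left; apply/eqP.
  by rewrite /h; field; rewrite ?natr1 ?nat1r pnatr_eq0.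
apply/ler_addgt0Pr => e e0.
pose n := Num.truncn (K * (b - a) ^+ 2 / e).
apply: le_trans (sub n) _; rewrite lerD2l ler_pdivrMr//.
by rewrite [e * _]mulrC -ler_pdivrMr//; apply: ltW; exact: truncnS_gt.
Qed.

End MeanValue.

Section Dyadic.
Context {R : realType}.
Implicit Types (c : nat -> R[i]) (r s t p q x y : R) (u v w : R -> R).

(** Pointwise, [u ^ p1] is at most [B ^ (p1 - p) * u ^ p]. *)
Lemma power_mean_interp p p1 u B : 0 < p -> p <= p1 -> continuous u -> (forall t, 0 <= u t) ->
  (forall t, u t <= B) ->
  power_mean p1 u <= B `^ (1 - p / p1) * power_mean p u `^ (p / p1).
Proof.
move=> p0 pp1 cu u0 uB.
have p10 : 0 < p1 by exact: lt_le_trans pp1.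
have B0 : 0 <= B by exact: le_trans (u0 0) (uB 0).
rewrite powRrM power_meanK// power_meanE.
have -> : 1 - p * p1^-1 = (p1 - p) * p1^-1.
  by rewrite mulrBl mulfV// gt_eqF.
have cup : continuous (fun t => u t `^ p) by exact: continuous_powR.
rewrite [X in X * _]powRrM -powRM ?powR_ge0//; last first.
  by apply: circle_avg_ge0 => t; exact: powR_ge0.
rewrite -circle_avgZ//.
apply: ge0_ler_powR; rewrite ?nnegrE ?invr_ge0 ?(ltW p10)//.
- by apply: circle_avg_ge0 => t; exact: powR_ge0.
- by apply: circle_avg_ge0 => t; rewrite mulr_ge0 ?powR_ge0.
apply: circle_avg_le; [exact: continuous_powR|exact: continuous_scale|].
move=> t; have [ut|ut] := eqVneq (u t) 0.
  by rewrite ut powR0 ?gt_eqF// mulr_ge0 ?powR_ge0.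
have -> : u t `^ p1 = u t `^ (p1 - p) * u t `^ p.
  by rewrite -powRD ?subrK// ut implybT.
apply: ler_wpM2r; first exact: powR_ge0.
by apply: ge0_ler_powR; rewrite ?nnegrE ?subr_ge0.
Qed.

Definition dstep j : R := 2^-1 ^+ j.
Definition drad j : R := 1 - dstep j.

Lemma dstep_gt0 j : 0 < dstep j.
Proof. by rewrite exprn_gt0// invr_gt0. Qed.

Lemma dstepS j : dstep j.+1 = dstep j / 2.
Proof. by rewrite /dstep exprSr. Qed.

Lemma dstep_le1 j : dstep j <= 1.
Proof. by rewrite exprn_ile1// invf_le1// ler1n. Qed.

Lemma drad01 j : 0 <= drad j < 1.
Proof. by rewrite subr_ge0 dstep_le1/= ltrBlDr ltrDl dstep_gt0. Qed.

Lemma drad_le i j : (i <= j)%N -> drad i <= drad j.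
Proof.
move=> ij; rewrite lerD2l lerN2; apply: ler_wiXn2l => //.
by rewrite invf_le1// ler1n.
Qed.

Lemma drad0 : drad 0 = 0.
Proof. by rewrite /drad /dstep expr0 subrr. Qed.

Lemma drad_gt0 j : 2^-1 <= drad j.+1.
Proof. by rewrite /drad dstepS; have := dstep_le1 j; lra. Qed.

(** A circle up to the [j]-th dyadic one, seen from the next one, is still at
    relative distance of order [dstep j] from its boundary. *)
Lemma drad_ratio j r : 0 <= r -> r <= drad j ->
  0 <= r / drad j.+1 < 1 /\ dstep j / 2 <= 1 - r / drad j.+1.
Proof.
move=> r1 rj.
have r0 : 0 < drad j.+1 by apply: lt_le_trans (drad_gt0 j); rewrite invr_gt0.
have d0 := dstep_gt0 j.
have E : drad j.+1 = drad j + dstep j / 2 by rewrite /drad dstepS; lra.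
split; first by rewrite divr_ge0 ?(ltW r0)//= ltr_pdivrMr// mul1r E; lra.
rewrite lerBrDr -lerBrDl ler_pdivrMr// mulrBl mul1r.
apply: le_trans rj _; rewrite E.
have /andP[_ h] := drad01 j.+1; rewrite E in h.
rewrite -[leLHS](addrK (dstep j / 2)) lerD2l lerN2.
rewrite -[leRHS]mulr1; apply: ler_wpM2l; [by rewrite divr_ge0// ltW|exact: ltW].
Qed.

Lemma sup_dyadic p : 1 < p -> exists2 C, 0 <= C & forall c j r t, tame c ->
  0 <= r -> r <= drad j ->
  normc (circ c r t) <= C * dstep j `^ (- p^-1) * Mp p c (drad j.+1).
Proof.
move=> p1; have p0 : 0 < p by exact: lt_trans p1.
have [C C0 HC] := @circ_sup R p p1.
exists (C * 2 `^ (p^-1)); first by rewrite mulr_ge0// powR_ge0.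
move=> c j r t tc rr0 rj.
have r0 : 0 < drad j.+1 by apply: lt_le_trans (drad_gt0 j); rewrite invr_gt0.
have [h1 h2] := drad_ratio rr0 rj.
have -> : r = drad j.+1 * (r / drad j.+1) by rewrite mulrC divfK// gt_eqF.
apply: le_trans (HC c _ _ t tc (drad01 _) h1) _.
apply: ler_wpM2r; first exact: Mp_ge0.
rewrite -mulrA; apply: ler_wpM2l => //.
have d0 := dstep_gt0 j.
have -> : 2 `^ p^-1 * dstep j `^ (- p^-1) = (dstep j / 2) `^ (- p^-1).
  rewrite powRM ?(ltW d0)// mulrC; congr (_ * _).
  by rewrite -(powR_inv1 (ler0n _ 2)) -powRrM mulN1r opprK.
rewrite !powRN lef_pV2 ?posrE ?powR_gt0 ?divr_gt0//; last by apply: lt_le_trans h2; rewrite divr_gt0.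
apply: ge0_ler_powR; rewrite ?nnegrE ?invr_ge0 ?(ltW p0)//.
  by rewrite divr_ge0// ltW.
by apply: le_trans h2; rewrite divr_ge0// ltW.
Qed.

End Dyadic.

(** * Growth of means of a higher exponent *)

Section Growth.
Context {R : realType}.
Implicit Types (c d : nat -> R[i]) (r s t p q x y : R) (u v w : R -> R).

Lemma powR_addr_exp (x a b : R) : 0 < x -> x `^ (a + b) = x `^ a * x `^ b.
Proof. by move=> x0; rewrite powRD// (gt_eqF x0) implybT. Qed.

(** Both the mean of order [p] and the supremum of the increment are bounded by the
    mean value inequality, and the mean of order [p1] lies between the two. *)
Lemma increment_dyadic p p1 : 1 < p -> p <= p1 -> exists2 C, 0 <= C & forall c i, tame c ->
  power_mean p1 (fun t => normc (circ c (drad i.+1) t - circ c (drad i) t)) <=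
  C * dstep i `^ (1 - p^-1 + p1^-1) * Mp p (shift_deriv c) (drad i.+2).
Proof.
move=> p_1 pp1; have p0 : 0 < p by exact: lt_trans p_1.
have p10 : 0 < p1 by exact: lt_le_trans pp1.
have [C C0 HC] := @sup_dyadic R p p_1.
set C' := C * 2 `^ p^-1.
have C'0 : 0 <= C' by rewrite mulr_ge0// powR_ge0.
exists (C' `^ (1 - p / p1)); first exact: powR_ge0.
move=> c i tc; set H := Mp p _ _.
have H0 : 0 <= H by exact: Mp_ge0.
have d0 := dstep_gt0 (R := R) i.
have /andP[ri0 ri1] := @drad01 R i; have /andP[rj0 rj1] := @drad01 R i.+1.
have rij : drad i <= drad i.+1 :> R by exact: drad_le.
have rd : drad i.+1 - drad i <= dstep i :> R by rewrite /drad dstepS; lra.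
have rd0 : 0 <= drad i.+1 - drad i :> R by rewrite subr_ge0.
have tc' := tame_deriv tc.
have A : power_mean p (fun t => normc (circ c (drad i.+1) t - circ c (drad i) t)) <= dstep i * H.
  apply: le_trans (@mean_value R (power_mean p) c (drad i) (drad i.+1) H (mean_like_power_mean (ltW p_1)) tc ri0 rij rj1 _) _.
    move=> r ir ri.
    have h1 : drad i.+1 <= drad i.+2 :> R by apply: drad_le.
    apply: (Mp_le tc' (ltW p_1) (le_trans ri0 ir) (le_trans ri h1)).
    by have /andP[] := @drad01 R i.+2.
  by apply: ler_wpM2r.
pose B := dstep i * (C' * dstep i `^ (- p^-1)) * H.
have hB t : normc (circ c (drad i.+1) t - circ c (drad i) t) <= B.
  apply: le_trans (@mean_value R (fun u => u t) c (drad i) (drad i.+1)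
     (C' * dstep i `^ (- p^-1) * H) (mean_like_eval t) tc ri0 rij rj1 _) _.
    move=> r ir ri; apply: le_trans (HC _ i.+1 r t tc' (le_trans ri0 ir) ri) _.
    apply: ler_wpM2r => //; rewrite /C' -mulrA; apply: ler_wpM2l => //.
    rewrite dstepS powRM ?(ltW d0)// mulrC; apply: ler_wpM2r; first exact: powR_ge0.
    by rewrite -(powR_inv1 (ler0n _ 2)) -powRrM mulN1r opprK.
  rewrite /B -[leRHS]mulrA; apply: ler_wpM2r => //.
  by rewrite mulr_ge0// mulr_ge0// powR_ge0.
have th1 : p / p1 <= 1 by rewrite ler_pdivrMr// mul1r.
have cu := continuous_circB tc (@drad01 R i) (@drad01 R i.+1).
apply: le_trans (power_mean_interp p0 pp1 cu (fun t => normc_ge0 _) hB) _.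
have B0 : 0 <= B by exact: le_trans (normc_ge0 _) (hB 0).
apply: (@le_trans _ _ (B `^ (1 - p / p1) * (dstep i * H) `^ (p / p1))).
  apply: ler_wpM2l; first exact: powR_ge0.
  by apply: ge0_ler_powR; rewrite ?nnegrE ?power_mean_ge0 ?divr_ge0 ?mulr_ge0 ?(ltW p0) ?(ltW p10) ?(ltW d0).
have BE : B = (dstep i * H) * (C' * dstep i `^ (- p^-1)) by rewrite /B; ring.
have dH0 : 0 <= dstep i * H by rewrite mulr_ge0// ltW.
have Cd0 : 0 <= C' * dstep i `^ (- p^-1) by rewrite mulr_ge0// powR_ge0.
rewrite BE (powRM _ dH0 Cd0) (powRM _ C'0 (powR_ge0 _ _)) -powRrM.
have dHE : (dstep i * H) `^ (1 - p / p1) * (dstep i * H) `^ (p / p1) = dstep i * H.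
  by rewrite -powRD ?subrK ?powRr1// oner_eq0.
have -> : - p^-1 * (1 - p / p1) = - p^-1 + p1^-1.
  by field; rewrite !gt_eqF.
have -> : dstep i `^ (1 - p^-1 + p1^-1) = dstep i * dstep i `^ (- p^-1 + p1^-1).
  by rewrite -addrA powR_addr_exp// powRr1 ?(ltW d0).
rewrite le_eqVlt; apply/orP; left; apply/eqP.
by rewrite mulrAC dHE; ring.
Qed.

Lemma circ_drad0 c t : tame c -> circ c (drad 0) t = c 0%N.
Proof. by move=> tc; rewrite circE drad0 mul0r psum0. Qed.

Lemma growth_dyadic p p1 : 1 < p -> p <= p1 -> exists2 C, 0 <= C & forall c j, tame c ->
  Mp p1 c (drad j) <= normc (c 0%N) +
    C * \sum_(i < j) dstep i `^ (1 - p^-1 + p1^-1) * Mp p (shift_deriv c) (drad i.+2).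
Proof.
move=> p_1 pp1; have [C C0 HC] := increment_dyadic p_1 pp1.
have p11 : 1 <= p1 by exact: le_trans (ltW p_1) pp1.
have p10 : 0 < p1 by exact: lt_le_trans p11.
exists C => // c j tc; elim: j => [|j IH].
  rewrite big_ord0 mulr0 addr0 /Mp (_ : (fun _ => _) = fun=> normc (c 0%N)).
    by rewrite power_mean_cst ?normc_ge0.
  by apply/funext => t; rewrite circ_drad0.
rewrite big_ord_recr/= mulrDr addrA.
have c1 := continuous_normc (continuous_circ tc (@drad01 R j)).
have c2 := continuous_normc (continuous_circ tc (@drad01 R j.+1)).
have c3 := continuous_circB tc (@drad01 R j) (@drad01 R j.+1).
apply: (@le_trans _ _ (power_mean p1 (fun t => normc (circ c (drad j) t) +
   normc (circ c (drad j.+1) t - circ c (drad j) t)))).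
  apply: power_mean_le => //; first exact: continuousDf.
    by move=> t; exact: normc_ge0.
  by move=> t; rewrite -{1}(subrKC (circ c (drad j) t) (circ c (drad j.+1) t)); exact: le_normcD.
apply: le_trans (minkowski_mean p11 (fun t => normc_ge0 _) (fun t => normc_ge0 _) c1 c3) _.
by apply: lerD; [exact: IH|rewrite mulrA; exact: HC].
Qed.

(** The partial sums are the coefficients of [f / (1 - z)]. Hoelder's inequality
    separates the two factors, and a large exponent [p1] makes the loss
    [dstep j `^ (- p1^-1)] from the Cauchy kernel as mild as desired. *)
Lemma M1_partial_sums p p1 : 1 < p -> p <= p1 -> exists2 C, 0 <= C & forall c j, tame c ->
  Mp 1 (partial_sums c) (drad j) <= C * dstep j `^ (- p1^-1) * (normc (c 0%N) +
    \sum_(i < j) dstep i `^ (1 - p^-1 + p1^-1) * Mp p (shift_deriv c) (drad i.+2)).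
Proof.
move=> p_1 pp1.
have p11 : 1 < p1 by exact: lt_le_trans p_1 pp1.
have p10 : 0 < p1 by exact: lt_trans p11.
pose q := p1 / (p1 - 1).
have pq : p1^-1 + q^-1 = 1 by rewrite /q; field; rewrite !gt_eqF// subr_gt0.
have q1 := conj_gt1 p11 pq; have q0 : 0 < q by exact: lt_trans q1.
have [C C0 HC] := cauchy_norm_power_mean p11 pq.
have [D D0 HD] := growth_dyadic p_1 pp1.
exists (C * (D + 1)); first by rewrite mulr_ge0// addr_ge0.
move=> c j tc; set S := \sum_(i < j) _.
have S0 : 0 <= S by apply: sumr_ge0 => i _; rewrite mulr_ge0 ?powR_ge0 ?Mp_ge0.
have /andP[r0 r1] := @drad01 R j.
rewrite /Mp power_mean1; last by move=> t; exact: normc_ge0.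
have -> : (fun t => normc (circ (partial_sums c) (drad j) t)) =
  (fun t => normc (circ c (drad j) t) * cauchy_norm (drad j) t).
  apply/funext => t; rewrite !circE psum_partial_sums ?normc_rcis//.
  by rewrite normcM normcV.
apply: le_trans (hoelder_mean p10 q0 pq (fun t => normc_ge0 _) (fun t => cauchy_norm_ge0 _ _)
  (continuous_normc (continuous_circ tc (@drad01 R j))) (continuous_cauchy_norm (@drad01 R j))) _.
have h1 := HD c j tc; have h2 := HC _ (@drad01 R j).
have rE : 1 - drad j = dstep j :> R by rewrite /drad subKr.
rewrite rE in h2.
apply: le_trans (ler_pM (Mp_ge0 _ _ _) (power_mean_ge0 _ _) h1 h2) _.
rewrite -/S [leLHS]mulrC.
rewrite [leRHS](_ : _ = C * dstep j `^ (- p1^-1) * ((D + 1) * (normc (c 0%N) + S))); last by ring.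
apply: ler_wpM2l; first by rewrite mulr_ge0// powR_ge0.
by have := normc_ge0 (c 0%N); nra.
Qed.

End Growth.

(** * Weighted dyadic sums *)

Section DyadicHardy.
Context {R : realType}.
Implicit Types (c d : nat -> R[i]) (r s t p q x y : R) (e : nat -> R).

Lemma pow2_lt1 x : x < 0 -> (2 : R) `^ x < 1.
Proof.
move=> x0; have x0' : 0 < - x by rewrite oppr_gt0.
rewrite -[x]opprK powRN invf_lt1 ?powR_gt0//.
have := @gt0_ltr_powR R _ x0' 1 2; rewrite powR1E !nnegrE; apply => //.
by rewrite ltr1n.
Qed.

Lemma dstepE j : dstep j = 2 `^ (- j%:R) :> R.
Proof. by rewrite powRN powR_mulrn// /dstep exprVn. Qed.

Lemma dstep_powE j x : (dstep j : R) `^ x = (2 `^ (- x)) ^+ j.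
Proof.
rewrite dstepE -powRrM -[RHS]powR_mulrn ?powR_ge0// -powRrM; congr (_ `^ _).
by rewrite !mulNr mulrC.
Qed.

Lemma dstep_pow_ge1 j x : x <= 0 -> 1 <= (dstep j : R) `^ x.
Proof.
move=> x0; rewrite dstep_powE; apply: exprn_ege1.
have h : (2 : R) `^ 0 <= 2 `^ (- x) by apply: ler_powR; rewrite ?ler1n ?oppr_ge0.
by rewrite powRr0 in h.
Qed.

Lemma sum_dstep_le x : 0 < x -> exists2 C, 0 <= C & forall J, \sum_(j < J) (dstep j : R) `^ x <= C.
Proof.
move=> x0; have h : (2 : R) `^ (- x) < 1 by apply: pow2_lt1; rewrite oppr_lt0.
exists (1 - 2 `^ (- x))^-1; first by rewrite invr_ge0 subr_ge0 ltW.
move=> J; under eq_bigr do rewrite dstep_powE.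
by apply: sum_geo_le; rewrite powR_ge0.
Qed.

Lemma powR_add_le p x y (m : R) : 1 <= p -> 0 < m < 1 -> 0 <= x -> 0 <= y ->
  (x + y) `^ p <= m `^ (1 - p) * x `^ p + (1 - m) `^ (1 - p) * y `^ p.
Proof.
move=> p1 /andP[m0 m1] x0 y0.
have n0 : 0 < 1 - m by rewrite subr_gt0.
have m01 : 0 <= m <= 1 by rewrite !ltW.
have E (k z : R) : 0 < k -> 0 <= z -> k * (k^-1 * z) `^ p = k `^ (1 - p) * z `^ p.
  move=> k0 z0; rewrite powRM ?invr_ge0 ?(ltW k0)// mulrA; congr (_ * _).
  rewrite -(powR_inv1 (ltW k0)) -powRrM mulN1r.
  by rewrite powR_addr_exp// powRr1 ?(ltW k0).
have := @convex_powR_le R p (m^-1 * x) ((1 - m)^-1 * y) m p1 m01.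
rewrite !mulVKf ?gt_eqF// => H.
apply: le_trans (H _ _) _; first by rewrite mulr_ge0// invr_ge0 ltW.
  by rewrite mulr_ge0// invr_ge0 ltW.
by rewrite !E.
Qed.

(** Peeling the last term off the inner sums reproduces the left-hand side with the
    factor [th < 1], which is then absorbed. *)
Lemma dyadic_hardy p x : 1 <= p -> 0 < x -> exists2 C, 0 <= C &
  forall e J, (forall j, 0 <= e j) ->
  \sum_(j < J) (dstep j : R) `^ x * (\sum_(i < j) e i) `^ p <=
  C * \sum_(j < J) dstep j `^ x * e j `^ p.
Proof.
move=> p1 x0; have p0 : 0 < p by exact: lt_le_trans p1.
(* The convexity parameter is so close to one that [2 `^ (- x)] beats [m `^ (1 - p)]. *)
pose m : R := 2 `^ (- (x / (2 * p))).
have m01 : 0 < m < 1.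
  by rewrite powR_gt0//= pow2_lt1// oppr_lt0 divr_gt0// mulr_gt0.
pose th : R := 2 `^ (- x) * m `^ (1 - p).
have th0 : 0 <= th by rewrite mulr_ge0 ?powR_ge0.
have th1 : th < 1.
  rewrite /th /m -powRrM -powR_addr_exp//; apply: pow2_lt1.
  have -> : - x + - (x / (2 * p)) * (1 - p) = - (x * (p + 1) / (2 * p)).
    by field; rewrite gt_eqF.
  by rewrite oppr_lt0 divr_gt0 ?mulr_gt0// addr_gt0.
pose C0 := 2 `^ (- x) * (1 - m) `^ (1 - p) : R.
have C00 : 0 <= C0 by rewrite mulr_ge0 ?powR_ge0.
have t1 : 0 < 1 - th by rewrite subr_gt0.
exists (C0 / (1 - th)); first by rewrite divr_ge0// ltW.
move=> e J e0; set Y := fun J => \sum_(j < J) dstep j `^ x * e j `^ p.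
have S0 k : 0 <= \sum_(i < k) e i by apply: sumr_ge0.
elim: J => [|J IH]; first by rewrite !big_ord0 mulr0.
rewrite big_ord_recl /= [X in _ * X `^ p]big_ord0 powR0 ?gt_eqF// mulr0 add0r.
apply: (@le_trans _ _ (th * (\sum_(j < J) dstep j `^ x * (\sum_(i < j) e i) `^ p) + C0 * Y J)).
  rewrite /Y !mulr_sumr -big_split /=; apply: ler_sum => j _.
  rewrite /bump /= add1n big_ord_recr /=.
  have dS : (dstep j.+1 : R) `^ x = 2 `^ (- x) * dstep j `^ x.
    rewrite dstepS powRM ?(ltW (dstep_gt0 _))// mulrC; congr (_ * _).
    by rewrite -(powR_inv1 (ler0n _ 2)) -powRrM mulN1r.
  rewrite dS; have := powR_add_le p1 m01 (S0 j) (e0 j) => h.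
  have w0 : 0 <= 2 `^ (- x) * (dstep j : R) `^ x by rewrite mulr_ge0 ?powR_ge0.
  apply: le_trans (ler_wpM2l w0 h) _; rewrite /th /C0.
  by rewrite le_eqVlt; apply/orP; left; apply/eqP; ring.
have YJ : Y J <= Y J.+1.
  by rewrite /Y big_ord_recr /= lerDl mulr_ge0 ?powR_ge0.
apply: (@le_trans _ _ (C0 / (1 - th) * Y J)); last first.
  by apply: ler_wpM2l => //; rewrite divr_ge0// ltW.
apply: le_trans (lerD (ler_wpM2l th0 IH) (lexx _)) _; rewrite -/(Y J).
rewrite le_eqVlt; apply/orP; left; apply/eqP.
by field; rewrite gt_eqF.
Qed.

(** The dyadic form of the weighted Bergman integral, which it is compared with in
    [dsum_le_bergman] and [bergman_le_dsum]. *)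
Definition dsum p a c J : R := \sum_(j < J) dstep j `^ (a + 1) * Mp p c (drad j) `^ p.

Lemma dsum_ge0 p a c J : 0 <= dsum p a c J.
Proof. by apply: sumr_ge0 => j _; rewrite mulr_ge0 ?powR_ge0. Qed.

Lemma powR_add2 p x y : 1 <= p -> 0 <= x -> 0 <= y ->
  (x + y) `^ p <= 2 `^ (p - 1) * (x `^ p + y `^ p).
Proof.
move=> p1 x0 y0; have h : 0 < (2^-1 : R) < 1.
  by rewrite invr_gt0 ltr0n/= invf_lt1// ltr1n.
have := powR_add_le p1 h x0 y0.
have -> : 1 - 2^-1 = 2^-1 :> R by lra.
rewrite -(powR_inv1 (ler0n _ 2)) -powRrM mulN1r opprB -mulrDr//.
Qed.

Lemma dsum_shift p a c J : 0 <= p -> \sum_(j < J) dstep j `^ (a + 1) * Mp p c (drad j.+2) `^ p <=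
  4 `^ (a + 1) * dsum p a c J.+2.
Proof.
move=> p0; rewrite /dsum 2!big_ord_recl /= !mulrDr.
apply: (@le_trans _ _ (4 `^ (a + 1) * \sum_(i < J) dstep i.+2 `^ (a + 1) * Mp p c (drad i.+2) `^ p)).
  rewrite mulr_sumr; apply: ler_sum => j _; rewrite mulrA -powRM ?(ltW (dstep_gt0 _))//.
  by rewrite !dstepS (_ : 4 * (dstep j / 2 / 2) = dstep j) //; field.
by rewrite addrA lerDr addr_ge0// mulr_ge0 ?powR_ge0// mulr_ge0 ?powR_ge0.
Qed.

(** The decisive estimate: multiplication by [1 / (1 - z)] maps the Dirichlet space
    into a mixed-norm space of first means. Since [p - 2 < a], an exponent [p2] can be
    chosen so large that [a + 2 - p - p / p2] is still positive, as Hardy's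
    inequality requires. *)
Lemma partial_sums_estimate p a : 1 < p -> p - 2 < a -> exists2 C, 0 <= C &
  forall c J, tame c ->
  \sum_(j < J) dstep j `^ (a + 2 - p) * Mp 1 (partial_sums c) (drad j) `^ p <=
  C * (normc (c 0%N) `^ p + dsum p a (shift_deriv c) J.+2).
Proof.
move=> p1 ap; have p0 : 0 < p by exact: lt_trans p1.
have tau0 : 0 < a + 2 - p by lra.
pose p2 := Num.max p (2 * p / (a + 2 - p)).
have pp2 : p <= p2 by rewrite le_max lexx.
have p20 : 0 < p2 by exact: lt_le_trans pp2.
pose sg := a + 2 - p - p / p2.
have sg0 : 0 < sg.
  have h : 2 * p / (a + 2 - p) <= p2 by rewrite le_max lexx orbT.
  rewrite subr_gt0 ltr_pdivrMr//.
  have h2 : 2 * p <= p2 * (a + 2 - p) by rewrite -ler_pdivrMr.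
  by rewrite mulrC; lra.
have [C1 C10 H1] := M1_partial_sums p1 pp2.
have [C2 C20 H2] := @dyadic_hardy p sg (ltW p1) sg0.
have [C3 C30 H3] := sum_dstep_le sg0.
set A := C1 `^ p * 2 `^ (p - 1).
have A0 : 0 <= A by rewrite mulr_ge0 ?powR_ge0.
exists (A * (C3 + C2 * 4 `^ (a + 1))).
  by rewrite mulr_ge0// addr_ge0// mulr_ge0// powR_ge0.
move=> c J tc.
pose e i := dstep i `^ (1 - p^-1 + p2^-1) * Mp p (shift_deriv c) (drad i.+2).
have e0 i : 0 <= e i by rewrite mulr_ge0 ?powR_ge0 ?Mp_ge0.
have S0 k : 0 <= \sum_(i < k) e i by apply: sumr_ge0.
have n0 := normc_ge0 (c 0%N).
apply: (@le_trans _ _ (A * (normc (c 0%N) `^ p * \sum_(j < J) dstep j `^ sg +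
   \sum_(j < J) dstep j `^ sg * (\sum_(i < j) e i) `^ p))).
  rewrite mulr_sumr -big_split/= mulr_sumr; apply: ler_sum => j _.
  have d0 := dstep_gt0 (R := R) j.
  have h := H1 c j tc; rewrite -/(e _) in h.
  have h' : Mp 1 (partial_sums c) (drad j) `^ p <=
      (C1 * dstep j `^ (- p2^-1) * (normc (c 0%N) + \sum_(i < j) e i)) `^ p.
    apply: ge0_ler_powR; rewrite ?nnegrE ?Mp_ge0 ?(ltW p0)//.
    by rewrite mulr_ge0 ?addr_ge0// mulr_ge0 ?powR_ge0.
  apply: le_trans (ler_wpM2l (powR_ge0 _ _) h') _.
  rewrite powRM ?addr_ge0 ?mulr_ge0 ?powR_ge0// powRM ?powR_ge0// -powRrM.
  apply: (@le_trans _ _ (dstep j `^ (a + 2 - p) * (C1 `^ p * dstep j `^ (- p2^-1 * p) *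
     (2 `^ (p - 1) * (normc (c 0%N) `^ p + (\sum_(i < j) e i) `^ p))))).
    apply: ler_wpM2l; first exact: powR_ge0.
    apply: ler_wpM2l; first by rewrite mulr_ge0 ?powR_ge0.
    exact: (powR_add2 (ltW p1)).
  have -> : dstep j `^ sg = dstep j `^ (a + 2 - p) * dstep j `^ (- p2^-1 * p) :> R.
    by rewrite -powR_addr_exp//; congr (_ `^ _); rewrite /sg; lra.
  by rewrite /A le_eqVlt; apply/orP; left; apply/eqP; ring.
rewrite -[leRHS]mulrA; apply: ler_wpM2l => //.
have h2 := H2 e J e0; have h3 := ler_wpM2l (powR_ge0 (normc (c 0%N)) p) (H3 J).
have h4 : \sum_(j < J) dstep j `^ sg * e j `^ p <= 4 `^ (a + 1) * dsum p a (shift_deriv c) J.+2.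
  apply: le_trans (@dsum_shift p a (shift_deriv c) J (ltW p0)).
  rewrite le_eqVlt; apply/orP; left; apply/eqP; apply: eq_bigr => j _.
  rewrite /e powRM ?powR_ge0 ?Mp_ge0// -powRrM mulrA -powR_addr_exp ?dstep_gt0//.
  congr (_ `^ _ * _); rewrite /sg; field; rewrite !gt_eqF//.
apply: le_trans (lerD h3 h2) _.
have h5 := ler_wpM2l C20 h4.
apply: le_trans (lerD (lexx _) h5) _.
have D0 := dsum_ge0 p a (shift_deriv c) J.+2.
have q0 : 0 <= C2 * (4 : R) `^ (a + 1) by rewrite mulr_ge0// powR_ge0.
have N0 := powR_ge0 (normc (c 0%N)) p.
have u1 := mulr_ge0 C30 D0; have u2 := mulr_ge0 q0 N0.
rewrite mulrA; move: u1 u2; set q := C2 * _; set D := dsum _ _ _ _; set N := normc _ `^ _.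
by rewrite mulrDr !mulrDl; lra.
Qed.

End DyadicHardy.

(** * The operator on Taylor coefficients *)

Section RhalyCoefficients.
Context {R : realType}.
Implicit Types (c d eta : nat -> R[i]) (r s t p a b x y : R).

Definition rhaly_coef eta c : nat -> R[i] := fun n => eta n * partial_sums c n.

Lemma tame_rhaly eta c : tame eta -> tame c -> tame (rhaly_coef eta c).
Proof. by move=> te tc; apply: tameM => //; exact: tame_partial_sums. Qed.

Lemma young p c d r1 r2 : 1 <= p -> tame c -> tame d -> 0 <= r1 < 1 -> 0 <= r2 < 1 ->
  Mp p (fun n => c n * d n) (r1 * r2) <= Mp 1 d r2 * Mp p c r1.
Proof.
move=> p1 tc td r01 r02.
have := @conv_young R c d (fun=> 0) r1 r2 p tc td tame0 erefl r01 r02 p1.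
rewrite /Mp (power_mean1 (fun t => normc_ge0 _)).
by under [X in circle_avg X]eq_fun do rewrite kern0.
Qed.

Lemma Mp_shiftr p c r : 0 < p -> tame c -> 0 <= r < 1 -> Mp p (shiftr c) r = r * Mp p c r.
Proof.
move=> p0 tc /[dup] r01 /andP[r0 r1]; rewrite /Mp.
rewrite -(power_meanZ p0 r0 (fun t => normc_ge0 _) (continuous_normc (continuous_circ tc r01))).
congr (power_mean _ _); apply/funext => t.
by rewrite !circE psum_shiftr ?normc_rcis// normcM normc_rcis.
Qed.

(** The derivative of the image, multiplied by [z], has as coefficients the products
    of those of [z * g'(z)] and those of [f(z) / (1 - z)], so Young's inequality
    applies. The factors [z] are the reason for [shiftr]; removing them costs the
    factor [2]. *)
Lemma Mp_rhaly p eta c j : 1 <= p -> tame eta -> tame c ->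
  Mp p (shift_deriv (rhaly_coef eta c)) (drad j) <=
  2 * (Mp p (shift_deriv eta) (drad j.+1) * Mp 1 (partial_sums c) (drad j.+1)).
Proof.
move=> p1 te tc; have p0 : 0 < p by exact: lt_le_trans p1.
have tS := tame_partial_sums tc; have te' := tame_deriv te.
have tr' := tame_deriv (tame_rhaly te tc).
set r := (drad j.+1 : R).
have r01 : 0 <= r < 1 by exact: drad01.
have rh : 2^-1 <= r by exact: drad_gt0.
have /andP[r0 r1] := r01.
have rp : 0 < r by lra.
have := young p1 (tame_shiftr te') tS r01 r01.
have -> : (fun n => shiftr (shift_deriv eta) n * partial_sums c n) =
    shiftr (shift_deriv (rhaly_coef eta c)).
  by apply/funext => -[|n] /=; rewrite ?mul0r// /shift_deriv /rhaly_coef mulrA.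
have rr : 0 <= r * r < 1 by rewrite mulr_ge0//= mulr_ilt1.
rewrite !Mp_shiftr// mulrCA -[r * r * _]mulrA ler_pM2l// => h.
have jr : drad j <= r * r.
  by rewrite /r /drad dstepS; have := dstep_gt0 (R := R) j; nra.
have /andP[d0 d1] := @drad01 R j; have /andP[_ rr1] := rr.
have h2 := Mp_le tr' p1 d0 jr rr1.
apply: le_trans h2 _; move: h.
have M0 := Mp_ge0 p (shift_deriv (rhaly_coef eta c)) (r * r).
move: M0; set M := Mp p _ (r * r); set X := Mp 1 _ _; set Y := Mp p _ r.
move=> M0 h; rewrite [Y * X]mulrC.
have : 2^-1 * M <= r * M by apply: ler_wpM2r.
lra.
Qed.

(** Young's inequality against a monomial. *)
Lemma coef_le_Mp p c r n : 1 <= p -> tame c -> 0 <= r < 1 -> normc (c n) * r ^+ n <= Mp p c r.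
Proof.
move=> p1 tc /[dup] r01 /andP[r0 r1]; have p0 : 0 < p by exact: lt_le_trans p1.
have h01 : 0 <= (2^-1 : R) < 1 by rewrite invr_ge0 ler0n/= invf_lt1// ltr1n.
have := young p1 tc (@tame_mono R 1 n) r01 h01.
have h0 : 0 < (2^-1 : R) ^+ n by rewrite exprn_gt0// invr_gt0.
have Mmono (k : R[i]) (q x : R) : 1 <= q -> 0 <= x -> Mp q (mono k n) x = normc k * x ^+ n.
  move=> q1 x0; have q0 : 0 < q by exact: lt_le_trans q1.
  rewrite /Mp (_ : (fun _ => _) = fun=> normc k * x ^+ n) ?power_mean_cst//.
    by rewrite mulr_ge0 ?normc_ge0 ?exprn_ge0.
  by apply/funext => t; rewrite circE psum_mono normcM normcX normc_rcis.
have -> : (fun m => c m * mono 1 n m) = mono (c n) n.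
  by apply/funext => m; rewrite /mono; case: eqP => [->|]; rewrite ?mulr1 ?mulr0.
rewrite !Mmono ?mulr_ge0 ?invr_ge0// normc1 mul1r exprMn mulrA mulrC ler_pM2l//.
Qed.

(** The constant [k] of the symbol is kept visible: it is fixed when boundedness is
    shown, and small when compactness is. *)
Lemma rhaly_term p a b k eta c j : 1 <= p -> tame eta -> tame c -> 0 <= k ->
  Mp p (shift_deriv eta) (drad j.+1) <= k * dstep j.+1 `^ ((a - b + 1) / p - 1) ->
  dstep j `^ (b + 1) * Mp p (shift_deriv (rhaly_coef eta c)) (drad j) `^ p <=
  2 `^ (p + b + 1) * (k `^ p * (dstep j.+1 `^ (a + 2 - p) * Mp 1 (partial_sums c) (drad j.+1) `^ p)).
Proof.
move=> p1 te tc k0 hk; have p0 : 0 < p by exact: lt_le_trans p1.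
have d0 := dstep_gt0 (R := R) j.+1.
set M := Mp 1 _ _; have M0 : 0 <= M by exact: Mp_ge0.
have h : Mp p (shift_deriv (rhaly_coef eta c)) (drad j) `^ p <=
   (2 * (k * dstep j.+1 `^ ((a - b + 1) / p - 1) * M)) `^ p.
  apply: ge0_ler_powR; rewrite ?nnegrE ?Mp_ge0 ?(ltW p0)//.
    by rewrite mulr_ge0// mulr_ge0// mulr_ge0// powR_ge0.
  apply: le_trans (Mp_rhaly j p1 te tc) _; apply: ler_wpM2l => //.
  by apply: ler_wpM2r.
apply: le_trans (ler_wpM2l (powR_ge0 _ _) h) _.
have -> : dstep j = 2 * dstep j.+1 :> R by rewrite dstepS; field.
rewrite !powRM ?mulr_ge0 ?powR_ge0 ?(ltW d0)// -powRrM.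
have -> : dstep j.+1 `^ (a + 2 - p) = dstep j.+1 `^ (b + 1) * dstep j.+1 `^ (((a - b + 1) / p - 1) * p) :> R.
  rewrite -powR_addr_exp//; congr (_ `^ _).
  by field; rewrite gt_eqF.
have -> : (2 : R) `^ (p + b + 1) = 2 `^ (b + 1) * 2 `^ p.
  by rewrite -powR_addr_exp//; congr (_ `^ _); ring.
by rewrite le_eqVlt; apply/orP; left; apply/eqP; ring.
Qed.

Lemma rhaly_dsum p a b eta K : 1 < p -> p - 2 < a -> tame eta -> 0 <= K ->
  (forall j, Mp p (shift_deriv eta) (drad j) <= K * dstep j `^ ((a - b + 1) / p - 1)) ->
  exists2 C, 0 <= C & forall c J, tame c ->
   dsum p b (shift_deriv (rhaly_coef eta c)) J <=
   C * (normc (c 0%N) `^ p + dsum p a (shift_deriv c) J.+3).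
Proof.
move=> p1 ap te K0 HK; have [C C0 HC] := partial_sums_estimate p1 ap.
pose D := 2 `^ (p + b + 1) * K `^ p.
have D0 : 0 <= D by rewrite mulr_ge0 ?powR_ge0.
exists (D * C); first by rewrite mulr_ge0.
move=> c J tc; rewrite -mulrA.
apply: le_trans (_ : D * \sum_(j < J.+1) dstep j `^ (a + 2 - p) * Mp 1 (partial_sums c) (drad j) `^ p <= _); last first.
  by apply: ler_wpM2l => //; exact: HC.
rewrite big_ord_recl /= mulrDr.
apply: (@le_trans _ _ (D * \sum_(i < J) dstep i.+1 `^ (a + 2 - p) * Mp 1 (partial_sums c) (drad i.+1) `^ p)).
  rewrite mulr_sumr; apply: ler_sum => j _.
  by rewrite /D -mulrA; apply: rhaly_term => //; exact: ltW.
by rewrite lerDr mulr_ge0// mulr_ge0 ?powR_ge0.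
Qed.

End RhalyCoefficients.

(** * Families of power series converging coefficientwise *)

Section Domination.
Context {R : realType}.
Implicit Types (c d : nat -> R[i]) (v : nat -> nat -> R[i]) (env : nat -> R) (r : R).

(** A common majorant of the coefficients which itself belongs to an analytic
    function. On such families coefficientwise convergence is locally uniform, by
    [circ_small]. *)
Definition dominated env v := tame (fun k => (env k)%:C) /\ forall n k, normc (v n k) <= env k.

Lemma dominated_tame env v n : dominated env v -> tame (v n).
Proof.
move=> [te H] r r01; have [B HB] := te r r01; exists B => k.
apply: le_trans (HB k); apply: ler_wpM2r; first by case/andP: r01 => r0 _; exact: exprn_ge0.
by rewrite normc_real; apply: le_trans (H n k) (ler_norm _).
Qed.

Lemma dominated_deriv env v : dominated env v ->
  dominated (fun k => k.+1%:R * env k.+1) (fun n => shift_deriv (v n)).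
Proof.
move=> [te H]; split.
  have := tame_deriv te; congr tame; apply/funext => k.
  by rewrite /shift_deriv rmorphM rmorph_nat.
by move=> n k; rewrite /shift_deriv normcM normc_nat; apply: ler_wpM2l.
Qed.

Lemma dominated_partial_sums env v : dominated env v ->
  dominated (fun k => \sum_(i < k.+1) env i) (fun n => partial_sums (v n)).
Proof.
move=> [te H]; split.
  have := tame_partial_sums te; congr tame; apply/funext => k.
  by rewrite /partial_sums rmorph_sum.
move=> n k; rewrite /partial_sums; apply: le_trans (le_normc_sum _ _ _) _.
by apply: ler_sum => i _.
Qed.

Definition coefwise0 v := forall k (e : R), 0 < e -> exists N, forall n, (N <= n)%N -> normc (v n k) <= e.

Lemma sum_small (F : nat -> nat -> R) M :
  (forall k (e : R), 0 < e -> exists N, forall n, (N <= n)%N -> F n k <= e) ->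
  forall e, 0 < e -> exists N, forall n, (N <= n)%N -> \sum_(k < M) F n k <= e.
Proof.
move=> H; elim: M => [|M IH] e e0.
  by exists 0%N => n _; rewrite big_ord0 ltW.
have e2 : 0 < e / 2 by rewrite divr_gt0.
have [N1 H1] := IH _ e2; have [N2 H2] := H M _ e2.
exists (maxn N1 N2) => n; rewrite geq_max => /andP[n1 n2].
by rewrite big_ord_recr /= [e]splitr lerD// ?H1 ?H2.
Qed.

Lemma coefwise0_deriv v : coefwise0 v -> coefwise0 (fun n => shift_deriv (v n)).
Proof.
move=> H k e e0; have k0 : 0 < k.+1%:R :> R by [].
have [N HN] := H k.+1 (e / k.+1%:R) (divr_gt0 e0 k0).
by exists N => n /HN; rewrite ler_pdivlMr// mulrC /shift_deriv normcM normc_nat.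
Qed.

Lemma coefwise0_partial_sums v : coefwise0 v -> coefwise0 (fun n => partial_sums (v n)).
Proof.
move=> H k e e0.
have [N HN] := @sum_small (fun n k => normc (v n k)) k.+1 H e e0.
by exists N => n /HN; apply: le_trans; exact: le_normc_sum.
Qed.

Lemma circ_small env v r e : dominated env v -> coefwise0 v -> 0 <= r < 1 -> 0 < e ->
  exists N, forall n, (N <= n)%N -> forall t, normc (circ (v n) r t) <= e.
Proof.
move=> dv v0 /[dup] r01 /andP[r0 r1] e0.
have [te H] := dv; have [B [x [B0 /[dup] x01 /andP[x0 x1] HB]]] := tame_geo te r01.
have e2 : 0 < e / 2 by rewrite divr_gt0.
set K := B * (1 - x)^-1.
have K0 : 0 <= K by rewrite mulr_ge0// invr_ge0 subr_ge0 ltW.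
have [M HM] : exists M, K * x ^+ M <= e / 2.
  apply: contrapT => h; have : e / 2 <= 0.
    apply: (@le_geo _ K x) => // n; rewrite add0r leNgt; apply/negP => hn.
    by apply: h; exists n; exact: ltW.
  by rewrite leNgt e2.
have [N HN] := @sum_small (fun n k => normc (v n k)) M v0 (e / 2) e2.
exists N => n nN t; rewrite circE.
have tv := dominated_tame n dv.
have zr : normc (r%:C * cis t) <= r by rewrite normc_rcis.
have Hv k : normc (v n k) * r ^+ k <= B * x ^+ k.
  apply: le_trans (HB k); apply: ler_wpM2r; first exact: exprn_ge0.
  by rewrite normc_real; apply: le_trans (H n k) (ler_norm _).
have h := psum_tail_geo tv r1 B0 x01 Hv zr M.
apply: le_trans (normc_le_add h) _; rewrite [leRHS]splitr; apply: lerD; last exact: HM.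
apply: le_trans (HN n nN); apply: le_trans (le_normc_sum _ _ _) _.
apply: ler_sum => k _; rewrite normcM normcX normc_rcis// ler_piMr ?normc_ge0//.
by rewrite exprn_ile1// ltW.
Qed.

Lemma Mp_small p env v r e : 1 <= p -> dominated env v -> coefwise0 v -> 0 <= r < 1 -> 0 < e ->
  exists N, forall n, (N <= n)%N -> Mp p (v n) r <= e.
Proof.
move=> p1 dv v0 r01 e0; have p0 : 0 < p by exact: lt_le_trans p1.
have [N HN] := circ_small dv v0 r01 e0.
exists N => n nN; rewrite -(power_mean_cst p0 (ltW e0)).
apply: power_mean_le => //.
- by apply: continuous_normc; apply: continuous_circ => //; exact: dominated_tame dv.
- by move=> ?; exact: cvg_cst.
- by move=> t; exact: normc_ge0.
- exact: HN.
Qed.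

(** The envelope is the supremum of the moduli of each coefficient. *)
Lemma uniformly_tame_dominated v :
  (forall r, 0 <= r < 1 -> exists B, forall n k, normc (v n k) * r ^+ k <= B) ->
  exists env, dominated env v.
Proof.
move=> H; pose env k := sup [set normc (v n k) | n in setT].
have bnd k : exists B, forall n, normc (v n k) <= B.
  have [|B HB] := H 2^-1; first by rewrite invr_ge0 ler0n/= invf_lt1// ltr1n.
  exists (B / 2^-1 ^+ k) => n; rewrite ler_pdivlMr ?exprn_gt0 ?invr_gt0//.
have hs k : has_sup [set normc (v n k) | n in setT].
  split; first by exists (normc (v 0%N k)); exists 0%N.
  by have [B HB] := bnd k; exists B => _ [n _ <-].
exists env; split; last first.
  by move=> n k; apply: sup_upper_bound => //; exists n.
move=> r r01; have [B HB] := H r r01; exists B => k.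
have env0 : 0 <= env k.
  by apply: le_trans (normc_ge0 (v 0%N k)) _; apply: sup_upper_bound => //; exists 0%N.
rewrite normc_real ger0_norm//.
have [rk|rk] := eqVneq (r ^+ k) 0.
  by rewrite rk mulr0; apply: le_trans (HB 0%N k); rewrite rk mulr0.
have rk0 : 0 < r ^+ k by rewrite lt_def rk exprn_ge0//; case/andP: r01.
rewrite -ler_pdivlMr//; apply: ge_sup; first by case: (hs k).
by move=> _ [n _ <-]; rewrite ler_pdivlMr.
Qed.

End Domination.

(** * Rotations of the plane *)

(** Named so that it can carry the structure of a sigma-finite measure. *)
Definition area {R : realType} :
    set (measurableTypeR R * measurableTypeR R) -> \bar R :=
  (@lebesgue_measure R \x @lebesgue_measure R)%E.
HB.instance Definition _ (R : realType) := Measure.on (@area R).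

Lemma area_sigma_finite (R : realType) : sigma_finite setT (@area R).
Proof.
pose I (n : nat) : set (measurableTypeR R) := `[- n%:R, n%:R]%classic.
exists (fun n => I n `*` I n).
  apply/esym; rewrite -subTset => -[x y] _.
  pose n := (Num.truncn `|x| + Num.truncn `|y|).+1.
  have hn z : `|z| <= `|x| \/ `|z| <= `|y| -> I n z.
    move=> h; rewrite /I /= in_itv /= -ler_norml.
    have nx : `|x| <= n%:R.
      apply: ltW; apply: lt_le_trans (truncnS_gt _) _.
      by rewrite ler_nat ltnS leq_addr.
    have ny : `|y| <= n%:R.
      apply: ltW; apply: lt_le_trans (truncnS_gt _) _.
      by rewrite ler_nat ltnS leq_addl.
    by case: h => /le_trans; apply.
  by exists n => //; split => /=; apply: hn; [left|right].
move=> n; have mI : measurable (I n) by exact: measurable_itv.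
split; first exact: measurableX.
have fI : (@lebesgue_measure R (I n) < +oo)%E.
  by rewrite /I lebesgue_measure_itv /=; case: ifP => _; rewrite ?ltry.
rewrite /area product_measure1E// lte_mul_pinfty// ge0_fin_numE//.
Qed.

HB.instance Definition _ (R : realType) :=
  Measure_isSigmaFinite.Build _ _ _ (@area R) (@area_sigma_finite R).

Section PlaneMeasure.
Context {R : realType}.
Notation mu := (@lebesgue_measure R).
Notation T := (measurableTypeR R).
Notation mu2 := (@area R).
Implicit Types (F : T * T -> \bar R) (t k s : R) (w : T * T).
Local Open Scope ereal_scope.

Lemma ge0_integral_affineT (f : R -> \bar R) (c : R) : (0 < c)%R ->
  measurable_fun setT f -> (forall x, 0 <= f x) ->
  \int[mu]_x f x = c%:E * \int[mu]_x f (c * x)%R.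
Proof.
move=> c0 mf f0.
have mE := @measurable_affine R c 0.
have -> : \int[mu]_x f x = \int[mscale (NngNum (ltW c0)) (pushforward mu (affine c 0))]_x f x.
  move=> m; apply: eq_measure_integral => // A mA _.
  exact: lebesgue_affine.
rewrite ge0_integral_mscale//; congr (_ * _).
rewrite (ge0_integral_pushforward mE)//.
by apply: eq_integral => x _ /=; rewrite /affine addr0.
Qed.

Definition shear_x k w : T * T := (w.1 + k * w.2, w.2)%R.
Definition shear_y k w : T * T := (w.1, w.2 + k * w.1)%R.
Definition plane_rot t w : T * T := (cos t * w.1 - sin t * w.2, sin t * w.1 + cos t * w.2)%R.

Definition measure_preserving (f : T * T -> T * T) :=
  measurable_fun setT f /\
  forall F, measurable_fun setT F -> (forall w, 0 <= F w) ->
    \int[mu2]_w F (f w) = \int[mu2]_w F w.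

Lemma measure_preserving_comp f g :
  measure_preserving f -> measure_preserving g -> measure_preserving (f \o g).
Proof.
move=> [mf Hf] [mg Hg]; split; first exact: measurableT_comp.
move=> F mF F0; rewrite -(Hf F mF F0).
rewrite -(Hg (fun w => F (f w)))//; exact: measurableT_comp.
Qed.

Lemma shear_x_preserving k : measure_preserving (shear_x k).
Proof.
have m : measurable_fun setT (shear_x k).
  apply: measurable_fun_pair; last exact: measurable_snd.
  apply: measurable_funD; first exact: measurable_fst.
  by apply: measurable_funM => //; exact: measurable_snd.
split=> // F mF F0.
have mFs : measurable_fun setT (fun w => F (shear_x k w)) by exact: measurableT_comp.
rewrite (fubini_tonelli2 _ mFs (fun w => F0 _)) (fubini_tonelli2 F mF F0).
apply: eq_integral => y _; rewrite /fubini_G /shear_x /=.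
rewrite -(@ge0_integral_shiftT R (fun x => F (x, y)) (k * y)%R)//.
exact: measurable_fun_pair1.
Qed.

Lemma shear_y_preserving k : measure_preserving (shear_y k).
Proof.
have m : measurable_fun setT (shear_y k).
  apply: measurable_fun_pair; first exact: measurable_fst.
  apply: measurable_funD; first exact: measurable_snd.
  by apply: measurable_funM => //; exact: measurable_fst.
split=> // F mF F0.
have mFs : measurable_fun setT (fun w => F (shear_y k w)) by exact: measurableT_comp.
rewrite (fubini_tonelli1 _ mFs (fun w => F0 _)) (fubini_tonelli1 F mF F0).
apply: eq_integral => x _; rewrite /fubini_F /shear_y /=.
rewrite -(@ge0_integral_shiftT R (fun y => F (x, y)) (k * x)%R)//.
exact: measurable_fun_pair2.
Qed.

(** A rotation is a product of three shears, each of which translates lines and so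
    preserves area by Tonelli's theorem. *)
Lemma plane_rot_preserving_sin t : (sin t != 0)%R -> measure_preserving (plane_rot t).
Proof.
move=> s0; pose k : R := ((cos t - 1) / sin t)%R.
have -> : plane_rot t = shear_x k \o (shear_y (sin t) \o shear_x k).
  apply/funext => -[x y]; rewrite /plane_rot /shear_x /shear_y /= /k.
  have cs := @sin2cos2 R t.
  congr (_, _); last by field.
  have ks : ((cos t - 1) / sin t * sin t = cos t - 1)%R by rewrite divfK.
  have kc : ((cos t - 1) / sin t * (1 + cos t) = - sin t)%R.
    apply: (mulIf s0); rewrite mulrAC ks mulNr -expr2 cs; ring.
  rewrite -mulNr -kc; move: ks; set q := (_ / sin t)%R => ks.
  have -> : cos t = (1 + q * sin t)%R by rewrite ks subrKC.
  ring.
apply: measure_preserving_comp; first exact: shear_x_preserving.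
by apply: measure_preserving_comp; [exact: shear_y_preserving|exact: shear_x_preserving].
Qed.

Lemma plane_rotD s t w : plane_rot (s + t) w = plane_rot s (plane_rot t w).
Proof. by rewrite /plane_rot /= cosD sinD; congr (_, _); ring. Qed.

Lemma plane_rot0 : plane_rot 0 = id.
Proof. by apply/funext => -[x y]; rewrite /plane_rot cos0 sin0 /=; congr (_, _); ring. Qed.

(** The rotation is performed in two halves, since [sin t] may vanish. *)
Lemma plane_rot_preserving t : (0 <= t <= 2 * pi)%R -> measure_preserving (plane_rot t).
Proof.
move=> /andP[t0 t1].
have idp : measure_preserving id by split.
have [->|tn0] := eqVneq t 0%R; first by rewrite plane_rot0.
have [->|tn1] := eqVneq t (2 * pi)%R.
  rewrite (_ : plane_rot _ = id)//; apply/funext => -[x y].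
  by rewrite /plane_rot mulr_natl cos2pi sin2pi /=; congr (_, _); ring.
have s0 : (0 < sin (t / 2))%R.
  apply: sin_gt0_pi; rewrite divr_gt0//=; last by rewrite lt_def tn0.
  by rewrite ltr_pdivrMr// mulrC lt_def eq_sym tn1.
have -> : plane_rot t = plane_rot (t / 2) \o plane_rot (t / 2).
  by apply/funext => w /=; rewrite -plane_rotD -splitr.
by apply: measure_preserving_comp; apply: plane_rot_preserving_sin; rewrite gt_eqF.
Qed.

Lemma measurable_plane_rot2 : measurable_fun [set: T * (T * T)] (fun x => plane_rot x.1 x.2).
Proof.
have mc : measurable_fun [set: T * (T * T)] (fun x => cos x.1).
  apply: (@measurableT_comp _ _ _ _ _ _ (@cos R)); last exact: measurable_fst.
  by apply: continuous_measurable_fun; exact: continuous_cos.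
have ms : measurable_fun [set: T * (T * T)] (fun x => sin x.1).
  apply: (@measurableT_comp _ _ _ _ _ _ (@sin R)); last exact: measurable_fst.
  by apply: continuous_measurable_fun; exact: continuous_sin.
have m1 : measurable_fun [set: T * (T * T)] (fun x => x.2.1).
  by apply: measurableT_comp; [exact: measurable_fst|exact: measurable_snd].
have m2 : measurable_fun [set: T * (T * T)] (fun x => x.2.2).
  by apply: measurableT_comp; [exact: measurable_snd|exact: measurable_snd].
apply: measurable_fun_pair.
  by apply: measurable_funB; exact: measurable_funM.
by apply: measurable_funD; exact: measurable_funM.
Qed.

(** Tonelli's theorem, each rotation preserving area. *)
Lemma integral_rot_average F : measurable_fun setT F -> (forall w, 0 <= F w) ->
  measurable_fun setT (fun w => \int[mu]_(t in `[0%R, (2 * pi)%R]) F (plane_rot t w)) /\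
  (2 * pi)%:E * \int[mu2]_w F w = \int[mu2]_w \int[mu]_(t in `[0%R, (2 * pi)%R]) F (plane_rot t w).
Proof.
move=> mF F0; have pi0 : (0 <= 2 * pi :> R)%R by rewrite mulr_ge0// pi_ge0.
pose I : set T := `[0%R, (2 * pi)%R]%classic.
have mI : measurable I by exact: measurable_itv.
pose H (x : T * (T * T)) : \bar R := (\1_I x.1)%:E * F (plane_rot x.1 x.2).
have mH : measurable_fun setT H.
  apply: emeasurable_funM.
    apply/measurable_EFinP; apply: (@measurableT_comp _ _ _ _ _ _ (\1_I : T -> R)); last exact: measurable_fst.
    exact: measurable_indic.
  by apply: (@measurableT_comp _ _ _ _ _ _ F) => //; exact: measurable_plane_rot2.
have H0 x : 0 <= H x by rewrite /H mule_ge0// lee_fin.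
have E1 w : \int[mu]_(t in I) F (plane_rot t w) = \int[mu]_t H (t, w).
  rewrite integral_mkcond; apply: eq_integral => t _.
  by rewrite /H /= patchE indicE; case: ifPn => _; rewrite ?mul1e ?mul0e.
split.
  rewrite (_ : (fun w => _) = fubini_G mu H); last by apply/funext => w; exact: E1.
  exact: measurable_fun_fubini_tonelli_G.
have E2 t : \int[mu2]_w H (t, w) = (\1_I t)%:E * \int[mu2]_w F w.
  rewrite /H /= indicE; case: (boolP (t \in I)) => [|_].
    rewrite inE /I /= in_itv /= => tI.
    under eq_integral do rewrite mul1e.
    by rewrite mul1e; have [_ ->] := plane_rot_preserving tI.
  by rewrite mul0e; under eq_integral do rewrite mul0e; rewrite integral0.
under [RHS]eq_integral do rewrite E1.
rewrite -(@fubini_tonelli _ _ _ _ R mu mu2 H mH H0).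
under [RHS]eq_integral do rewrite E2.
rewrite ge0_integralZr//; last 2 first.
- by apply/measurable_EFinP; exact: measurable_indic.
- exact: integral_ge0.
congr (_ * _).
rewrite integral_indic// setIT /= lebesgue_measure_itv /= lte_fin.
by rewrite mulr_gt0 ?pi_gt0//= oppr0 adde0.
Qed.

End PlaneMeasure.

(** * Areas of discs and annuli *)

Section Annuli.
Context {R : realType}.
Notation mu := (@lebesgue_measure R).
Notation T := (measurableTypeR R).
Implicit Types (c : nat -> R[i]) (p r s t x y alpha : R) (w : T * T).

Definition cplx w : R[i] := w.1 +i* w.2.
Definition nrm w : R := normc (cplx w).

Lemma measurable_EFin_indic (A : set (T * T)) : measurable A ->
  measurable_fun [set: T * T] (fun w => (\1_A w : R)%:E).
Proof.
move=> mA; have m : measurable_fun [set: T * T] (\1_A : T * T -> R) by exact: measurable_indic.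
by move/measurable_EFinP : m.
Qed.

Lemma nrmE w : nrm w = Num.sqrt (w.1 ^+ 2 + w.2 ^+ 2).
Proof. by []. Qed.

Lemma nrm_ge0 w : 0 <= nrm w. Proof. exact: normc_ge0. Qed.

Lemma cplx_rot t w : cplx (plane_rot t w) = cis t * cplx w.
Proof. by rewrite /cplx /plane_rot /cis; congr (_ +i* _); rewrite /= addrC. Qed.

Lemma nrm_rot t w : nrm (plane_rot t w) = nrm w.
Proof. by rewrite /nrm cplx_rot normcM normc_cis mul1r. Qed.

Lemma measurable_nrm : measurable_fun setT nrm.
Proof.
apply: (@measurableT_comp _ _ _ _ _ _ (@Num.sqrt R) _ (fun w : T * T => w.1 ^+ 2 + w.2 ^+ 2)).
  by apply: continuous_measurable_fun; exact: sqrt_continuous.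
apply: measurable_funD; apply: measurable_funX.
  exact: measurable_fst.
exact: measurable_snd.
Qed.

Definition disk r : set (T * T) := [set w | nrm w < r].
Definition annulus r s : set (T * T) := [set w | r <= nrm w < s].

Lemma measurable_disk r : measurable (disk r).
Proof.
rewrite (_ : disk r = nrm @^-1` [set` `]-oo, r[]); last first.
  by apply/seteqP; split => w /=; rewrite in_itv.
by rewrite -[X in measurable X]setTI; apply: measurable_nrm.
Qed.

Lemma measurable_annulus r s : measurable (annulus r s).
Proof.
rewrite (_ : annulus r s = nrm @^-1` [set` `[r, s[]); last first.
  by apply/seteqP; split => w /=; rewrite in_itv.
by rewrite -[X in measurable X]setTI; apply: measurable_nrm.
Qed.

Lemma area_diskE r : (area (disk r) = \int[mu]_x \int[mu]_y (\1_(disk r) (x, y) : R)%:E)%E.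
Proof.
have mi : measurable_fun setT (fun w : T * T => (\1_(disk r) w : R)%:E).
  by apply: measurable_EFin_indic; exact: measurable_disk.
rewrite -(fubini_tonelli1 (m1 := mu) (m2 := mu) (fun w => (\1_(disk r) w : R)%:E) mi) => [|x]; last by rewrite lee_fin.
by rewrite integral_indic ?setIT//; exact: measurable_disk.
Qed.

(** Scaling, one coordinate at a time. *)
Lemma area_disk r : 0 < r -> area (disk r) = ((r ^+ 2)%:E * area (disk 1))%E.
Proof.
move=> r0; rewrite !area_diskE.
have mi s : measurable_fun setT (fun w : T * T => (\1_(disk s) w : R)%:E).
  by apply: measurable_EFin_indic; exact: measurable_disk.
have i0 s w : (0 <= (\1_(disk s) w : R)%:E :> \bar R)%E by rewrite lee_fin.
have step x : (\int[mu]_y (\1_(disk r) (r * x, y) : R)%:E = r%:E * \int[mu]_y (\1_(disk 1) (x, y) : R)%:E)%E.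
  rewrite (@ge0_integral_affineT _ (fun y => (\1_(disk r) (r * x, y) : R)%:E) r)//.
    congr (_ * _)%E; apply: eq_integral => y _; congr EFin.
    rewrite !indicE; have -> // : ((r * x, r * y) \in disk r) = ((x, y) \in disk 1).
    have E : nrm (r * x, r * y) = r * nrm (x, y).
      by rewrite !nrmE /= !exprMn -mulrDr sqrtrM ?sqr_ge0// sqrtr_sqr gtr0_norm.
    have lE : (r * nrm (x, y) < r) = (nrm (x, y) < 1) by rewrite -[X in _ < X]mulr1 ltr_pM2l.
    by apply/idP/idP; rewrite !inE /disk /= E lE.
  exact: (measurable_fun_pair2 (f := fun w : T * T => (\1_(disk r) w : R)%:E)).
have mF s : measurable_fun setT (fun x : T => \int[mu]_y (\1_(disk s) (x, y) : R)%:E)%E.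
  exact: (measurable_fun_fubini_tonelli_F (m2 := mu) (fun w : T * T => (\1_(disk s) w : R)%:E)).
have F0 s x : (0 <= \int[mu]_y (\1_(disk s) (x, y) : R)%:E)%E by apply: integral_ge0.
apply: (etrans (ge0_integral_affineT r0 (mF r) (F0 r))).
under eq_integral do rewrite step.
rewrite (ge0_integralZl _ _ (mF 1) _ _)//; last by rewrite lee_fin ltW.
by rewrite muleA -EFinM expr2.
Qed.

Lemma disk_subset r s : r <= s -> disk r `<=` disk s.
Proof. by move=> rs w /= h; exact: lt_le_trans rs. Qed.

Lemma area_rect a b : 0 <= a -> 0 <= b ->
  area ([set` `[-a, a]] `*` [set` `[- b, b]] : set (T * T)) = ((2 * a) * (2 * b))%:E.
Proof.
move=> a0 b0.
have H (x : R) : 0 <= x -> mu [set` `[-x, x]] = (2 * x)%:E.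
  move=> x0; rewrite lebesgue_measure_itv /= lte_fin; case: ifP => [_|].
    by rewrite -EFinD opprK mulr2n mulrDl mul1r.
  move=> /negbT; rewrite -leNgt => h; have -> : x = 0 by lra.
  by rewrite mulr0.
rewrite EFinM -(H a)// -(H b)//; apply: product_measure1E; exact: measurable_itv.
Qed.

Lemma area_disk1_bounds : (1%:E <= area (disk 1) <= 4%:E)%E.
Proof.
apply/andP; split.
  have -> : 1%:E = area ([set` `[- 2^-1, 2^-1]] `*` [set` `[- 2^-1, 2^-1]] : set (T * T)).
    by rewrite area_rect ?invr_ge0//; congr EFin; rewrite mulfV// mulr1.
  apply: le_measure; rewrite ?inE.
  - by apply: measurableX; exact: measurable_itv.
  - exact: measurable_disk.
  - move=> [x y] [] /=; rewrite !in_itv /= /disk /= nrmE /= => hx hy.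
    have hx' : x ^+ 2 <= 2^-1 ^+ 2 by rewrite -real_normK ?num_real// lerXn2r ?nnegrE ?invr_ge0// ler_norml.
    have hy' : y ^+ 2 <= 2^-1 ^+ 2 by rewrite -real_normK ?num_real// lerXn2r ?nnegrE ?invr_ge0// ler_norml.
    rewrite -[ltRHS]sqrtr1 ltr_sqrt//; apply: le_lt_trans (lerD hx' hy') _.
    by rewrite expr2; lra.
have -> : 4%:E = area ([set` `[- 1, 1]] `*` [set` `[- 1, 1]] : set (T * T)).
  by rewrite area_rect//; congr EFin; lra.
apply: le_measure; rewrite ?inE.
- exact: measurable_disk.
- by apply: measurableX; exact: measurable_itv.
- move=> [x y] /=; rewrite /disk /= => h; split; rewrite /= in_itv /= -ler_norml.
    exact: le_trans (le_Re_normc (cplx (x, y))) (ltW h).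
  exact: le_trans (le_Im_normc (cplx (x, y))) (ltW h).
Qed.

Definition kappa : R := fine (area (disk 1)).

Lemma kappaE : area (disk 1) = kappa%:E.
Proof.
have /andP[h1 h2] := area_disk1_bounds.
rewrite fineK// ge0_fin_numE ?measure_ge0//; apply: le_lt_trans h2 _; exact: ltry.
Qed.

Lemma kappa_ge1 : 1 <= kappa.
Proof. by have /andP[h1 h2] := area_disk1_bounds; rewrite kappaE lee_fin in h1. Qed.

Lemma area_annulus r s : 0 <= r -> r <= s -> 0 < s ->
  area (annulus r s) = (kappa * (s ^+ 2 - r ^+ 2))%:E.
Proof.
move=> r0 rs s0.
have E q : 0 <= q -> area (disk q) = (q ^+ 2 * kappa)%:E.
  rewrite le_eqVlt => /predU1P[<-|q0]; last by rewrite area_disk// kappaE EFinM.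
  rewrite expr0n mul0r (_ : disk 0 = set0) ?measure0//.
  by apply/seteqP; split => w //=; rewrite /disk /= ltNge nrm_ge0.
have -> : annulus r s = disk s `\` disk r.
  apply/seteqP; split => w /=; first by move=> /andP[h1 h2]; split=> //; apply/negP; rewrite -leNgt.
  by move=> [h1 /negP]; rewrite -leNgt => h2; apply/andP.
rewrite measureD; [|exact: measurable_disk|exact: measurable_disk|by rewrite /= E ?ltry// ltW].
rewrite setIidr; last exact: disk_subset.
have Es := E s (ltW s0); have Er := E r r0; rewrite /= in Es Er *.
rewrite Es Er -EFinB; congr EFin; ring.
Qed.

(** Averaging over the rotations replaces the integrand by its circular means. *)
Lemma integral_annulus (F : T * T -> R) r s lo hi :
  measurable_fun setT F -> (forall w, 0 <= F w) -> 0 <= r -> r <= s -> 0 < s -> 0 <= lo -> 0 <= hi ->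
  (forall w, annulus r s w -> exists2 m, lo <= m <= hi &
     (\int[mu]_(t in `[0%R, (2 * pi)%R]) (F (plane_rot t w))%:E = (2 * pi * m)%:E)%E) ->
  ((lo * (kappa * (s ^+ 2 - r ^+ 2)))%:E <= \int[area]_(w in annulus r s) (F w)%:E
    <= (hi * (kappa * (s ^+ 2 - r ^+ 2)))%:E)%E.
Proof.
move=> mF F0 r0 rs s0 lo0 hi0 H; set A := annulus r s.
have mA : measurable A by exact: measurable_annulus.
pose FA w : \bar R := ((F w)%:E * (\1_A w : R)%:E)%E.
have mFA : measurable_fun setT FA.
  by apply: emeasurable_funM; apply/measurable_EFinP => //; exact: measurable_indic.
have FA0 w : (0 <= FA w)%E by rewrite /FA mule_ge0// lee_fin.
have [mI E] := integral_rot_average mFA FA0.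
have pi0 : 0 < 2 * pi :> R by rewrite mulr_gt0// pi_gt0.
have EA : (\int[area]_(w in A) (F w)%:E = \int[area]_w FA w)%E.
  rewrite integral_mkcond; apply: eq_integral => w _.
  by rewrite patchE /FA indicE; case: ifPn => _; rewrite ?mule1 ?mule0.
have Arot t w : (plane_rot t w \in A) = (w \in A).
  by apply/idP/idP; rewrite !inE /A /annulus /= nrm_rot.
have EI w : (\int[mu]_(t in `[0%R, (2 * pi)%R]) FA (plane_rot t w) =
    \int[mu]_(t in `[0%R, (2 * pi)%R]) (F (plane_rot t w))%:E * (\1_A w : R)%:E)%E.
  rewrite indicE; case: (boolP (w \in A)) => wA.
    by rewrite mule1; apply: eq_integral => t _; rewrite /FA indicE Arot wA mule1.
  rewrite mule0 -[RHS](@integral0 _ _ _ mu `[0%R, (2 * pi)%R]%classic); apply: eq_integral => t _.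
  by rewrite /FA indicE Arot (negbTE wA) mule0.
have areaA : (\int[area]_w (\1_A w : R)%:E = (kappa * (s ^+ 2 - r ^+ 2))%:E)%E.
  by rewrite (integral_indic area measurableT mA) setIT; exact: area_annulus.
have cstA k : 0 <= k -> ((2 * pi)%:E * (k * (kappa * (s ^+ 2 - r ^+ 2)))%:E = \int[area]_w ((2 * pi * k)%:E * (\1_A w : R)%:E))%E.
  move=> k0; rewrite ge0_integralZl//.
  - by rewrite areaA -!EFinM; congr EFin; ring.
  - by apply/measurable_EFinP; exact: measurable_indic.
  - by rewrite lee_fin mulr_ge0// ltW.
have mk k : measurable_fun setT (fun w : T * T => (2 * pi * k)%:E * (\1_A w : R)%:E)%E.
  by apply: emeasurable_funM; apply/measurable_EFinP => //; exact: measurable_indic.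
have k0 k w : 0 <= k -> (0 <= (2 * pi * k)%:E * (\1_A w : R)%:E)%E.
  by move=> ?; rewrite mule_ge0// lee_fin// mulr_ge0// ltW.
have pe : (0 < (2 * pi)%:E :> \bar R)%E by rewrite lte_fin.
rewrite EA -(lee_pmul2l _ pe)// -[X in _ && X](lee_pmul2l _ pe)// E !cstA//.
have I0 w : (0 <= \int[mu]_(t in `[0%R, (2 * pi)%R]) FA (plane_rot t w))%E by apply: integral_ge0.
apply/andP; split; apply: ge0_le_integral => //.
- by move=> w _; exact: k0.
- move=> w _; rewrite EI indicE; case: (boolP (w \in A)) => wA; last by rewrite !mule0.
  have [m /andP[lm mh] ->] := H w (set_mem wA).
  by rewrite !mule1 lee_fin; apply: ler_wpM2l => //; exact: ltW.
- move=> w _; rewrite EI indicE; case: (boolP (w \in A)) => wA; last by rewrite !mule0.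
  have [m /andP[lm mh] ->] := H w (set_mem wA).
  by rewrite !mule1 lee_fin; apply: ler_wpM2l => //; exact: ltW.
Qed.

End Annuli.

(** * Powers of analytic functions over the disc *)

Section Polar.
Context {R : realType}.
Notation mu := (@lebesgue_measure R).
Notation T := (measurableTypeR R).
Implicit Types (c : nat -> R[i]) (p r s t x y alpha : R) (w : T * T) (h : R[i] -> R[i]).

Lemma polar w : exists t, cplx w = (nrm w)%:C * cis t.
Proof.
have [n0|n0] := eqVneq (nrm w) 0.
  by exists 0; rewrite n0 mul0r; exact: eq0_normc.
have ngt : 0 < nrm w by rewrite lt_def n0 nrm_ge0.
pose x := w.1 / nrm w.
have xn : x * nrm w = w.1 by rewrite divfK.
have hx : `|x| <= 1.
  rewrite normrM normfV (gtr0_norm ngt) ler_pdivrMr// mul1r.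
  exact: (le_Re_normc (cplx w)).
have hx' : -1 <= x <= 1 by rewrite -ler_norml.
have E : w.1 ^+ 2 + w.2 ^+ 2 = nrm w ^+ 2 by rewrite nrmE sqr_sqrtr// addr_ge0// sqr_ge0.
have S : nrm w * Num.sqrt (1 - x ^+ 2) = `|w.2|.
  rewrite -[X in X * _](gtr0_norm ngt) -sqrtr_sqr -sqrtrM ?sqr_ge0// -sqrtr_sqr; congr Num.sqrt.
  by rewrite mulrBr mulr1 -exprMn [nrm w * x]mulrC xn -E [w.1 ^+ 2 + _]addrC addrK.
exists (if 0 <= w.2 then acos x else - acos x).
rewrite /cplx /cis; congr (_ +i* _).
  case: ifP => _; rewrite ?cosN acosK ?in_itv//= mul0r subr0 mulrC xn//.
case: ifP => h; rewrite ?sinN sin_acos//= mul0r addr0.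
  by rewrite S ger0_norm.
by rewrite mulrN S ltr0_norm ?opprK// ltNge h.
Qed.

Lemma integral_circle_avg (v : R -> R) : continuous v -> (forall t, 0 <= v t) ->
  (\int[mu]_(t in `[0%R, (2 * pi)%R]) (v t)%:E = (2 * pi * circle_avg v)%:E)%E.
Proof.
move=> cv v0; rewrite circle_avgE mulrA mulfV ?mul1r; last first.
  by rewrite mulf_neq0// gt_eqF// pi_gt0.
rewrite /Rintegral fineK//; apply: integrable_fin_num; first exact: measurable_itv.
exact: (@continuous_integrable _ v).
Qed.

(** Cut off outside the disc, where the sum of the series has no meaning. *)
Definition disk_power p c w : R := (normc (psum c (cplx w)) * \1_(disk 1) w) `^ p.

Lemma disk_power_ge0 p c w : 0 <= disk_power p c w.
Proof. exact: powR_ge0. Qed.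

Lemma disk_powerE p c w : disk 1 w -> disk_power p c w = normc (psum c (cplx w)) `^ p.
Proof. by move=> h; rewrite /disk_power indicE mem_set// mulr1. Qed.

(** The modulus is a pointwise limit of moduli of polynomials. *)
Lemma measurable_disk_power p c : tame c -> measurable_fun setT (disk_power p c).
Proof.
move=> tc.
have mX k : measurable_fun setT (fun w : T * T => Re (c k * cplx w ^+ k)) /\
            measurable_fun setT (fun w : T * T => Im (c k * cplx w ^+ k)).
  have mP : measurable_fun setT (fun w : T * T => Re (cplx w ^+ k)) /\
            measurable_fun setT (fun w : T * T => Im (cplx w ^+ k)).
    elim: k => [|k [m1 m2]]; first by split; rewrite /=; exact: measurable_cst.
    have mR : measurable_fun setT (fun w : T * T => Re (cplx w)) by exact: measurable_fst.
    have mI : measurable_fun setT (fun w : T * T => Im (cplx w)) by exact: measurable_snd.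
    have EX w : Re (cplx w ^+ k.+1) = Re (cplx w) * Re (cplx w ^+ k) - Im (cplx w) * Im (cplx w ^+ k) /\
                Im (cplx w ^+ k.+1) = Re (cplx w) * Im (cplx w ^+ k) + Im (cplx w) * Re (cplx w ^+ k).
      by rewrite exprS; case: (cplx w) (cplx w ^+ k) => x y [u v].
    split.
      rewrite (_ : (fun w => _) = fun w => Re (cplx w) * Re (cplx w ^+ k) - Im (cplx w) * Im (cplx w ^+ k)).
        by apply: measurable_funB; apply: measurable_funM.
      by apply/funext => w; have [] := EX w.
    rewrite (_ : (fun w => _) = fun w => Re (cplx w) * Im (cplx w ^+ k) + Im (cplx w) * Re (cplx w ^+ k)).
      by apply: measurable_funD; apply: measurable_funM.
    by apply/funext => w; have [] := EX w.
  have EM w : Re (c k * cplx w ^+ k) = Re (c k) * Re (cplx w ^+ k) - Im (c k) * Im (cplx w ^+ k) /\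
              Im (c k * cplx w ^+ k) = Re (c k) * Im (cplx w ^+ k) + Im (c k) * Re (cplx w ^+ k).
    by case: (c k) (cplx w ^+ k) => x y [u v].
  split.
    rewrite (_ : (fun w => _) = fun w => Re (c k) * Re (cplx w ^+ k) - Im (c k) * Im (cplx w ^+ k)).
      by apply: measurable_funB; apply: measurable_funM => //; apply mP.
    by apply/funext => w; have [] := EM w.
  rewrite (_ : (fun w => _) = fun w => Re (c k) * Im (cplx w ^+ k) + Im (c k) * Re (cplx w ^+ k)).
    by apply: measurable_funD; apply: measurable_funM => //; apply mP.
  by apply/funext => w; have [] := EM w.
pose S n w := \sum_(k < n) c k * cplx w ^+ k.
have mS n : measurable_fun setT (fun w => Re (S n w)) /\ measurable_fun setT (fun w => Im (S n w)).
  elim: n => [|n [m1 m2]].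
    by split; rewrite /S; under eq_fun do rewrite big_ord0; exact: measurable_cst.
  have [x1 x2] := mX n; split.
    rewrite (_ : (fun w => _) = fun w => Re (S n w) + Re (c n * cplx w ^+ n)).
      exact: measurable_funD.
    by apply/funext => w; rewrite /S big_ord_recr raddfD.
  rewrite (_ : (fun w => _) = fun w => Im (S n w) + Im (c n * cplx w ^+ n)).
    exact: measurable_funD.
  by apply/funext => w; rewrite /S big_ord_recr raddfD.
have mI : measurable_fun setT (\1_(disk 1) : T * T -> R).
  by apply: measurable_indic; exact: measurable_disk.
have mN n : measurable_fun setT (fun w => normc (S n w) * \1_(disk 1) w).
  apply: measurable_funM => //.
  rewrite (_ : (fun w => _) = Num.sqrt \o fun w => Re (S n w) ^+ 2 + Im (S n w) ^+ 2); last first.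
    by apply/funext => w /=; case: (S n w).
  apply: measurableT_comp.
    by apply: continuous_measurable_fun; exact: sqrt_continuous.
  by apply: measurable_funD; apply: measurable_funX; apply mS.
apply: (@measurableT_comp _ _ _ _ _ _ (@powR R ^~ p) _ (fun w => normc (psum c (cplx w)) * \1_(disk 1) w)).
  exact: measurable_powR.
apply: (measurable_fun_cvg mN) => w _.
rewrite indicE; case: (boolP (w \in disk 1)) => [|_]; last first.
  rewrite mulr0; under eq_fun do rewrite mulr0; exact: cvg_cst.
rewrite inE => w1; rewrite mulr1; under eq_fun do rewrite mulr1.
apply/cvgrPdist_le => e e0.
have /cvgc_seqP/(_ e e0)[N HN] := psum_cvg tc w1.
exists N => // n /HN; rewrite seriesEord => /= h.
apply: le_trans (ltW h); rewrite -/(S n w) ler_norml -lerBlDr opprK.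
have h1 := ler_normcB (S n w) (psum c (cplx w)).
have h2 := ler_normcB (psum c (cplx w)) (S n w).
by rewrite normcBC in h2; rewrite -/(S n w); apply/andP; split; lra.
Qed.

Lemma disk_power_circle p c w : 0 < p -> tame c -> disk 1 w ->
  (\int[mu]_(t in `[0%R, (2 * pi)%R]) (disk_power p c (plane_rot t w))%:E =
   (2 * pi * Mp p c (nrm w) `^ p)%:E)%E.
Proof.
move=> p0 tc w1; have n01 : 0 <= nrm w < 1 by rewrite nrm_ge0.
have [s Es] := polar w.
have cc : continuous (fun t => normc (circ c (nrm w) t) `^ p).
  apply: continuous_powR => //; first by move=> t; exact: normc_ge0.
  by apply: continuous_normc; exact: continuous_circ.
have E t : disk_power p c (plane_rot t w) = normc (circ c (nrm w) (t + s)) `^ p.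
  rewrite disk_powerE; last by rewrite /disk /= nrm_rot.
  by rewrite cplx_rot Es circE cisD mulrCA.
under eq_integral do rewrite E.
rewrite integral_circle_avg.
- rewrite /Mp power_meanK// (@circle_avg_shift _ (fun t => normc (circ c (nrm w) t) `^ p))//.
  + by move=> t; rewrite circ_periodic.
  + by move=> t; exact: powR_ge0.
- move=> t; apply: (@continuous_comp _ _ _ (fun t => t + s) (fun t => normc (circ c (nrm w) t) `^ p)); last exact: cc.
  by apply: cvgD; [exact: cvg_id|exact: cvg_cst].
- by move=> t; exact: powR_ge0.
Qed.

End Polar.

(** * Bergman integrals as dyadic sums *)

Section BergmanSum.
Context {R : realType}.
Notation mu := (@lebesgue_measure R).
Notation T := (measurableTypeR R).
Implicit Types (c : nat -> R[i]) (p r s t x y alpha : R) (w : T * T) (h : R[i] -> R[i]).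

Lemma powR_comparable alpha x y : 0 < x -> 0 < y -> x <= 2 * y -> y <= 2 * x ->
  x `^ alpha <= 2 `^ `|alpha| * y `^ alpha.
Proof.
move=> x0 y0 xy yx; case: (lerP 0 alpha) => a0.
  rewrite ger0_norm// -powRM ?(ltW y0)//.
  by apply: ge0_ler_powR; rewrite ?nnegrE ?mulr_ge0 ?(ltW x0) ?(ltW y0).
rewrite ltr0_norm//.
have -> : 2 `^ (- alpha) * y `^ alpha = (y / 2) `^ alpha.
  by rewrite powRM ?invr_ge0 ?(ltW y0)// mulrC -powR_inv1// -powRrM mulN1r.
rewrite -[alpha]opprK !(powRN _ (- alpha)) lef_pV2 ?posrE ?powR_gt0 ?divr_gt0//.
apply: ge0_ler_powR; rewrite ?nnegrE; lra.
Qed.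

Lemma dstep_small (e : R) : 0 < e -> exists N, dstep N <= e.
Proof.
move=> e0; exists (Num.truncn e^-1).+1; rewrite /dstep exprVn.
rewrite -[leRHS]invrK lef_pV2 ?posrE ?invr_gt0 ?exprn_gt0//.
apply: le_trans (ltW (truncnS_gt _)) _.
by rewrite -natrX ler_nat ltnW// ltn_expl.
Qed.

Notation shell j := (@annulus R (drad j) (drad j.+1)).

Lemma dyadic_bracket r : 0 <= r < 1 -> exists j, drad j <= r < drad j.+1.
Proof.
move=> /andP[r0 r1]; have /dstep_small[N HN] : 0 < (1 - r) / 2 by rewrite divr_gt0// subr_gt0.
have ex : exists n, r < drad n by exists N; rewrite /drad; lra.
case: (ex_minnP ex) => [[|m]] h hmin; first by move: h; rewrite drad0 ltNge r0.
exists m; apply/andP; split=> //.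
by rewrite leNgt; apply/negP => /hmin; rewrite ltnn.
Qed.

Lemma disk_shells : disk 1 = \bigcup_j shell j.
Proof.
apply/seteqP; split => w /=.
  move=> w1; have [|j h] := @dyadic_bracket (nrm w); last by exists j.
  by rewrite nrm_ge0.
move=> [j _ /= /andP[_ h]]; apply: lt_trans h _.
by have /andP[] := @drad01 R j.+1.
Qed.

Lemma trivIset_shells : trivIset setT (fun j => shell j).
Proof.
apply/trivIsetP => i j _ _ ij; apply/seteqP; split => // w [/=] /andP[h1 h2] /andP[h3 h4].
have key m n : (m < n)%N -> nrm w < drad m.+1 -> drad n <= nrm w -> False.
  by move=> mn u v; have := @drad_le R _ _ mn; lra.
by case: (ltngtP i j) => [lij|lji|/eqP]; [exact: (key i j)|exact: (key j i)|rewrite (negbTE ij)].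
Qed.

Definition weight alpha w : R := (1 - nrm w ^+ 2) `^ alpha.

Lemma measurable_weight alpha : measurable_fun setT (weight alpha).
Proof.
apply: (@measurableT_comp _ _ _ _ _ _ (@powR R ^~ alpha) _ (fun w : T * T => 1 - nrm w ^+ 2)).
  exact: measurable_powR.
by apply: measurable_funB => //; apply: measurable_funX; exact: measurable_nrm.
Qed.

Lemma weight_shell alpha j w : shell j w ->
  2 `^ (- `|alpha|) * dstep j `^ alpha <= weight alpha w <= 2 `^ `|alpha| * dstep j `^ alpha.
Proof.
move=> /= /andP[]; rewrite /drad dstepS => h1 h2.
have d0 := @dstep_gt0 R j; have d1 := @dstep_le1 R j.
have n0 := nrm_ge0 w.
have E : 1 - nrm w ^+ 2 = (1 - nrm w) * (1 + nrm w) by ring.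
have u1 : 1 - nrm w <= 1 - nrm w ^+ 2 by rewrite E ler_peMr//; lra.
have u2 : 1 - nrm w ^+ 2 <= (1 - nrm w) * 2 by rewrite E ler_wpM2l//; lra.
have w0 : 0 < 1 - nrm w ^+ 2 by lra.
apply/andP; split; last by apply: powR_comparable => //; lra.
rewrite powRN ler_pdivrMl ?powR_gt0//; apply: powR_comparable => //; lra.
Qed.

Definition shell_integral p alpha c j : \bar R :=
  (\int[area]_(w in shell j) (disk_power p c w * weight alpha w)%:E)%E.

Lemma shell_integral_ge0 p alpha c j : (0 <= shell_integral p alpha c j)%E.
Proof. by apply: integral_ge0 => w _; rewrite lee_fin mulr_ge0 ?powR_ge0. Qed.

Lemma measurable_weighted p alpha c D : tame c ->
  measurable_fun D (fun w => (disk_power p c w * weight alpha w)%:E).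
Proof.
move=> tc; have m : measurable_fun setT (fun w => disk_power p c w * weight alpha w).
  by apply: measurable_funM; [exact: measurable_disk_power|exact: measurable_weight].
by apply: measurable_funTS; move/measurable_EFinP : m.
Qed.

Lemma shell_subset j : shell j `<=` @disk R 1.
Proof. by rewrite disk_shells => w h; exists j. Qed.

(** Circular means grow with the radius, and so are pinched between their values on
    the two bounding circles. *)
Lemma shell_power p c j : 1 <= p -> tame c ->
  ((Mp p c (drad j) `^ p * (kappa * (drad j.+1 ^+ 2 - drad j ^+ 2)))%:E
    <= \int[area]_(w in shell j) (disk_power p c w)%:E
    <= (Mp p c (drad j.+1) `^ p * (kappa * (drad j.+1 ^+ 2 - drad j ^+ 2)))%:E)%E.
Proof.
move=> p1 tc; have p0 : 0 < p by lra.
have /andP[r0 r1] := @drad01 R j; have /andP[s0 s1] := @drad01 R j.+1.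
apply: integral_annulus.
- exact: measurable_disk_power.
- exact: disk_power_ge0.
- by [].
- exact: drad_le.
- by apply: lt_le_trans (drad_gt0 j).
- exact: powR_ge0.
- exact: powR_ge0.
move=> w hw; exists (Mp p c (nrm w) `^ p); last first.
  by apply: disk_power_circle => //; exact: shell_subset hw.
move: hw => /= /andP[h1 h2].
apply/andP; split; apply: ge0_ler_powR; rewrite ?nnegrE ?Mp_ge0 ?(ltW p0)//.
  by apply: Mp_le => //; exact: lt_trans s1.
by apply: Mp_le => //; [exact: nrm_ge0|exact: ltW].
Qed.

Lemma drad_sqrB j : dstep j / 4 <= (drad j.+1 : R) ^+ 2 - drad j ^+ 2 <= dstep j.
Proof.
have d0 := @dstep_gt0 R j; have d1 := @dstep_le1 R j.
rewrite /drad dstepS; set d := dstep j in d0 d1 *.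
have -> : (1 - d / 2) ^+ 2 - (1 - d) ^+ 2 = d / 4 + 3 / 4 * (d * (1 - d)) by field.
have h : 0 <= d * (1 - d) by rewrite mulr_ge0//; lra.
have h' : d * (1 - d) <= d by rewrite ler_piMr//; lra.
apply/andP; split; lra.
Qed.

Lemma dstep_split alpha j : dstep j `^ (alpha + 1) = dstep j `^ alpha * dstep j :> R.
Proof. by rewrite powR_addr_exp ?dstep_gt0// powRr1// ltW// dstep_gt0. Qed.

Lemma shell_integral_lower p alpha c j : 1 <= p -> tame c ->
  ((dstep j `^ (alpha + 1) * Mp p c (drad j) `^ p)%:E
    <= (4 * 2 `^ `|alpha|)%:E * shell_integral p alpha c j)%E.
Proof.
move=> p1 tc; have /andP[h _] := shell_power j p1 tc.
have k0 : 0 < 2 `^ (- `|alpha|) * dstep j `^ alpha :> R by rewrite mulr_gt0 ?powR_gt0 ?dstep_gt0.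
have mD : measurable (shell j) by exact: measurable_annulus.
have mP : measurable_fun (shell j) (fun w => (disk_power p c w)%:E).
  by apply: measurable_funTS; have /measurable_EFinP := measurable_disk_power p tc.
have L : ((2 `^ (- `|alpha|) * dstep j `^ alpha)%:E * \int[area]_(w in shell j) (disk_power p c w)%:E
    <= shell_integral p alpha c j)%E.
  rewrite -(@ge0_integralZl _ _ _ area _ mD _ mP); last 2 first.
  - by move=> w _; rewrite lee_fin disk_power_ge0.
  - by rewrite lee_fin ltW.
  apply: ge0_le_integral => //.
  - by move=> w _; rewrite mule_ge0// lee_fin ?disk_power_ge0// ltW.
  - exact: measurable_funeM.
  - exact: measurable_weighted.
  move=> w hw; rewrite -EFinM lee_fin mulrC; apply: ler_wpM2l; first exact: disk_power_ge0.
  by have /andP[] := weight_shell alpha hw.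
have q0 : 0 < 4 * 2 `^ `|alpha| :> R by rewrite mulr_gt0// powR_gt0.
apply: le_trans (_ : ((4 * 2 `^ `|alpha|)%:E * ((2 `^ (- `|alpha|) * dstep j `^ alpha)%:E *
  (Mp p c (drad j) `^ p * (kappa * (drad j.+1 ^+ 2 - drad j ^+ 2)))%:E) <= _)%E); last first.
  apply: lee_wpmul2l; first by rewrite lee_fin ltW.
  by apply: le_trans L; apply: lee_wpmul2l => //; rewrite lee_fin ltW.
rewrite -!EFinM lee_fin.
have -> : 4 * 2 `^ `|alpha| * (2 `^ (- `|alpha|) * dstep j `^ alpha *
   (Mp p c (drad j) `^ p * (kappa * (drad j.+1 ^+ 2 - drad j ^+ 2)))) =
   dstep j `^ alpha * Mp p c (drad j) `^ p * (4 * (kappa * (drad j.+1 ^+ 2 - drad j ^+ 2))) :> R.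
  rewrite powRN; field; by rewrite gt_eqF// powR_gt0.
rewrite dstep_split mulrAC; apply: ler_wpM2l; first by rewrite mulr_ge0// powR_ge0.
have /andP[g1 _] := drad_sqrB j; have g2 := @kappa_ge1 R; have d0 := @dstep_gt0 R j.
have : (dstep j / 4 : R) <= kappa * (drad j.+1 ^+ 2 - drad j ^+ 2).
  have d1 : 0 <= (drad j.+1 : R) ^+ 2 - drad j ^+ 2 by apply: le_trans g1; rewrite divr_ge0// ltW.
  by apply: le_trans g1 _; exact: ler_peMl.
by lra.
Qed.

Lemma shell_integral_upper p alpha c j : 1 <= p -> tame c ->
  (shell_integral p alpha c j <=
   (2 `^ `|alpha| * kappa * 2 `^ (alpha + 1) *
     (dstep j.+1 `^ (alpha + 1) * Mp p c (drad j.+1) `^ p))%:E)%E.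
Proof.
move=> p1 tc; have /andP[_ h] := shell_power j p1 tc.
have k0 : 0 < 2 `^ `|alpha| * dstep j `^ alpha :> R by rewrite mulr_gt0 ?powR_gt0 ?dstep_gt0.
have mD : measurable (shell j) by exact: measurable_annulus.
have mP : measurable_fun (shell j) (fun w => (disk_power p c w)%:E).
  by apply: measurable_funTS; have /measurable_EFinP := measurable_disk_power p tc.
have L : (shell_integral p alpha c j <=
   (2 `^ `|alpha| * dstep j `^ alpha)%:E * \int[area]_(w in shell j) (disk_power p c w)%:E)%E.
  rewrite -(@ge0_integralZl _ _ _ area _ mD _ mP); last 2 first.
  - by move=> w _; rewrite lee_fin disk_power_ge0.
  - by rewrite lee_fin ltW.
  apply: ge0_le_integral => //.
  - by move=> w _; rewrite lee_fin mulr_ge0 ?powR_ge0.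
  - exact: measurable_weighted.
  - exact: measurable_funeM.
  move=> w hw; rewrite -EFinM lee_fin mulrC; apply: ler_wpM2r; first exact: disk_power_ge0.
  by have /andP[] := weight_shell alpha hw.
apply: (le_trans L).
apply: le_trans (_ : ((2 `^ `|alpha| * dstep j `^ alpha)%:E *
  (Mp p c (drad j.+1) `^ p * (kappa * (drad j.+1 ^+ 2 - drad j ^+ 2)))%:E <= _)%E).
  by apply: lee_wpmul2l => //; rewrite lee_fin ltW.
rewrite -!EFinM lee_fin.
have E : 2 `^ (alpha + 1) * dstep j.+1 `^ (alpha + 1) = dstep j `^ alpha * dstep j :> R.
  rewrite -powRM ?(ltW (dstep_gt0 _))// -dstep_split; congr (_ `^ _).
  by rewrite dstepS mulrC divfK.
have -> : 2 `^ `|alpha| * kappa * 2 `^ (alpha + 1) *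
   (dstep j.+1 `^ (alpha + 1) * Mp p c (drad j.+1) `^ p) =
   2 `^ `|alpha| * kappa * dstep j `^ alpha * Mp p c (drad j.+1) `^ p * dstep j.
  transitivity (2 `^ `|alpha| * kappa * (2 `^ (alpha + 1) * dstep j.+1 `^ (alpha + 1)) *
     Mp p c (drad j.+1) `^ p); first by ring.
  by rewrite E; ring.
have -> : 2 `^ `|alpha| * dstep j `^ alpha *
   (Mp p c (drad j.+1) `^ p * (kappa * (drad j.+1 ^+ 2 - drad j ^+ 2))) =
   2 `^ `|alpha| * kappa * dstep j `^ alpha * Mp p c (drad j.+1) `^ p * (drad j.+1 ^+ 2 - drad j ^+ 2).
  by ring.
apply: ler_wpM2l; last by have /andP[] := drad_sqrB j.
have k1 := @kappa_ge1 R.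
by rewrite !mulr_ge0 ?powR_ge0//; lra.
Qed.

Lemma bergman_shells p alpha c h : tame c -> (forall z, disc z -> h z = psum c z) ->
  bergman_integral p alpha h = (\sum_(j <oo) shell_integral p alpha c j)%E.
Proof.
move=> tc hc.
have -> : bergman_integral p alpha h =
    (\int[area]_(w in disk 1) (disk_power p c w * weight alpha w)%:E)%E.
  rewrite /bergman_integral /area.
  have -> : [set w : R * R | disc (w.1 +i* w.2)] = disk 1.
    by apply/seteqP; split => w /=; rewrite discE.
  by apply: eq_integral => w /set_mem hw; rewrite disk_powerE// hc// discE.
rewrite disk_shells; apply: ge0_integral_bigcup.
- by move=> j; exact: measurable_annulus.
- exact: measurable_weighted.
- by move=> w _; rewrite lee_fin mulr_ge0 ?powR_ge0.
- exact: trivIset_shells.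
Qed.

(** Each shell is estimated from below by the mean on its inner circle. *)
Lemma dsum_le_bergman p alpha c h J : 1 <= p -> tame c -> (forall z, disc z -> h z = psum c z) ->
  ((dsum p alpha c J)%:E <= (4 * 2 `^ `|alpha|)%:E * bergman_integral p alpha h)%E.
Proof.
move=> p1 tc hc; rewrite (bergman_shells _ _ tc hc).
have q0 : 0 < 4 * 2 `^ `|alpha| :> R by rewrite mulr_gt0// powR_gt0.
apply: le_trans (_ : ((4 * 2 `^ `|alpha|)%:E * \sum_(0 <= j < J) shell_integral p alpha c j <= _)%E); last first.
  apply: lee_wpmul2l; first by rewrite lee_fin ltW.
  by apply: nneseries_lim_ge => *; exact: shell_integral_ge0.
rewrite /dsum -sumEFin big_mkord ge0_sume_distrr; last by move=> *; exact: shell_integral_ge0.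
by apply: lee_sum => j _; exact: shell_integral_lower.
Qed.

(** Each shell is estimated from above by the mean on its outer circle, which is the
    inner circle of the next one. *)
Lemma bergman_le_dsum p alpha c h (B : R) : 1 <= p -> tame c -> (forall z, disc z -> h z = psum c z) ->
  (forall J, dsum p alpha c J <= B) ->
  (bergman_integral p alpha h <= (2 `^ `|alpha| * kappa * 2 `^ (alpha + 1) * B)%:E)%E.
Proof.
move=> p1 tc hc HB; rewrite (bergman_shells _ _ tc hc).
apply: lime_le; first by apply: is_cvg_nneseries => *; exact: shell_integral_ge0.
apply: nearW => J; have k1 := @kappa_ge1 R.
have q0 : 0 <= 2 `^ `|alpha| * kappa * 2 `^ (alpha + 1).
  by rewrite !mulr_ge0 ?powR_ge0//; lra.
apply: le_trans (_ : ((2 `^ `|alpha| * kappa * 2 `^ (alpha + 1) * dsum p alpha c J.+1)%:E <= _)%E); last first.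
  by rewrite lee_fin; exact: ler_wpM2l.
rewrite /dsum big_ord_recl mulrDr.
apply: le_trans (_ : ((2 `^ `|alpha| * kappa * 2 `^ (alpha + 1) *
   \sum_(j < J) dstep j.+1 `^ (alpha + 1) * Mp p c (drad j.+1) `^ p)%:E <= _)%E); last first.
  by rewrite lee_fin lerDr; apply: mulr_ge0 => //; rewrite mulr_ge0 ?powR_ge0.
rewrite mulr_sumr -sumEFin big_mkord.
by apply: lee_sum => j _; exact: shell_integral_upper.
Qed.

End BergmanSum.

(** * Mean Lipschitz spaces on dyadic radii *)

Section MeanLipschitz.
Context {R : realType}.
Implicit Types (c : nat -> R[i]) (p r s x K : R) (f g : R[i] -> R[i]).

Lemma integral_mean_Mp p c f r : tame c -> (forall z, disc z -> f z = psum c z) ->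
  0 <= r < 1 -> integral_mean p r f = Mp p c r.
Proof.
move=> tc fc /andP[r0 r1]; have E t : normc (f ((r * cos t) +i* (r * sin t))) = normc (circ c r t).
  have -> : (r * cos t) +i* (r * sin t) = r%:C * cis t.
    by rewrite /cis; congr (_ +i* _); rewrite mul0r ?subr0 ?addr0.
  by rewrite circE fc// discE normc_rcis.
rewrite /integral_mean; under eq_Rintegral do rewrite E.
by rewrite /Mp power_meanE circle_avgE.
Qed.

Lemma dyadic_of_near p c f K s : tame c -> (forall z, disc z -> f z = psum c z) ->
  (\forall r \near 1^'-, `|integral_mean p r f| <= K * `|(1 - r) `^ (s - 1)|) ->
  exists N, forall k, (N <= k)%N -> Mp p c (drad k) <= K * dstep k `^ (s - 1).
Proof.
move=> tc fc [e /= e0 H].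
have [N HN] := @dstep_small R (e / 2) (divr_gt0 e0 (ltr0Sn R 1)).
exists N => k Nk; have dk := @dstep_gt0 R k.
have h := @drad_le R _ _ Nk.
have rk := @drad01 R k.
have := H (drad k); rewrite (integral_mean_Mp _ tc fc rk) !ger0_norm ?powR_ge0 ?Mp_ge0//.
rewrite (_ : 1 - drad k = dstep k); last by rewrite /drad; ring.
apply; last by case/andP: rk.
rewrite /= /ball /= (_ : 1 - drad k = dstep k); last by rewrite /drad; ring.
by rewrite gtr0_norm//; rewrite /drad in h; lra.
Qed.

Lemma near_of_dyadic p c f K s N : 1 <= p -> 0 <= K ->
  tame c -> (forall z, disc z -> f z = psum c z) ->
  (forall k, (N <= k)%N -> Mp p c (drad k) <= K * dstep k `^ (s - 1)) ->
  \forall r \near 1^'-, `|integral_mean p r f| <= K * 2 `^ `|s - 1| * `|(1 - r) `^ (s - 1)|.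
Proof.
move=> p1 K0 tc fc H; exists (dstep N); first exact: dstep_gt0.
move=> r /= hr r1; have r0 : drad N < r.
  move: hr; rewrite /ball /= gtr0_norm ?subr_gt0// /drad; lra.
have rr : 0 <= r < 1.
  by rewrite r1 andbT; apply: le_trans (ltW r0); have /andP[] := @drad01 R N.
rewrite (integral_mean_Mp _ tc fc rr) (ger0_norm (Mp_ge0 _ _ _)) (ger0_norm (powR_ge0 _ _)).
have [j /andP[j1 j2]] := dyadic_bracket rr.
have Nj : (N <= j.+1)%N.
  by rewrite leqNgt; apply/negP => /ltnW h; have := @drad_le R _ _ h; lra.
have /andP[r_ge0 _] := rr; have /andP[_ d1] := @drad01 R j.+1.
apply: le_trans (Mp_le tc p1 r_ge0 (ltW j2) d1) _.
apply: (le_trans (H _ Nj)); rewrite -mulrA; apply: ler_wpM2l => //.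
move: j1 j2; rewrite /drad dstepS => j1 j2; have d0 := @dstep_gt0 R j.
apply: powR_comparable; lra.
Qed.

(** Means grow with the radius while [1 - r] changes by a factor of two between
    successive dyadic radii. For the finitely many radii below the range of the
    asymptotic condition, [s < 1] makes the weight at least one. *)
Lemma mean_lipschitzP p s c g : 1 <= p -> s < 1 ->
  tame c -> (forall z, disc z -> g z = psum c z) ->
  mean_lipschitz p s g <->
  exists2 K, 0 <= K & forall k, Mp p (shift_deriv c) (drad k) <= K * dstep k `^ (s - 1).
Proof.
move=> p1 s1 tc gc; have td := tame_deriv tc.
have dg z : disc z -> derive1 g z = psum (shift_deriv c) z by exact: derive1_psum.
split=> [[_ /eqO_exP[K K0 HK]]|[K K0 HK]].
  have [N HN] := dyadic_of_near td dg HK.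
  have M0 := Mp_ge0 p (shift_deriv c) (drad N).
  exists (K + Mp p (shift_deriv c) (drad N)); first by rewrite addr_ge0 // ltW.
  move=> k; rewrite mulrDl; have [Nk|kN] := leqP N k.
    by rewrite ler_wpDr ?HN// mulr_ge0 ?powR_ge0.
  apply: ler_wpDl; first by rewrite mulr_ge0 ?powR_ge0 ?ltW.
  have /andP[r0 _] := @drad01 R k; have /andP[_ r1] := @drad01 R N.
  apply: le_trans (Mp_le td p1 r0 (drad_le (ltnW kN)) r1) _.
  by rewrite ler_peMr// dstep_pow_ge1// subr_le0 ltW.
split; first by apply/HolP; exists c.
apply/eqO_exP; exists (K * 2 `^ `|s - 1| + 1).
  by rewrite ltr_wpDl// mulr_ge0 ?powR_ge0.
have H := near_of_dyadic p1 K0 td dg (fun k (_ : (0 <= k)%N) => HK k).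
apply: filterS H => r h; apply: (le_trans h).
by rewrite ler_wpM2r// lerDl.
Qed.

Lemma little_mean_lipschitzP p s c g : 1 <= p -> 
  tame c -> (forall z, disc z -> g z = psum c z) ->
  little_mean_lipschitz p s g <->
  forall e, 0 < e -> exists N, forall k, (N <= k)%N ->
    Mp p (shift_deriv c) (drad k) <= e * dstep k `^ (s - 1).
Proof.
move=> p1 tc gc; have td := tame_deriv tc.
have dg z : disc z -> derive1 g z = psum (shift_deriv c) z by exact: derive1_psum.
split=> [[_ /eqoP H] e e0|H]; first exact: dyadic_of_near td dg (H e e0).
split; first by apply/HolP; exists c.
apply/eqoP => e e0; have q0 : 0 < 2 `^ `|s - 1| :> R by rewrite powR_gt0.
have [N HN] := H _ (divr_gt0 e0 q0).
have := near_of_dyadic p1 (ltW (divr_gt0 e0 q0)) td dg HN.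
by rewrite divfK// gt_eqF.
Qed.

End MeanLipschitz.

(** * Test functions *)

Section TestFunctions.
Context {R : realType}.
Implicit Types (c eta : nat -> R[i]) (p a b r s x y K e rho : R) (phi psi : nat -> R).

Lemma sum_dstepN_le y : 0 < y ->
  exists2 C, 0 <= C & forall k, \sum_(j < k) (dstep j : R) `^ (- y) <= C * dstep k `^ (- y).
Proof.
move=> y0; pose th : R := 2 `^ (- y).
have th0 : 0 < th by rewrite powR_gt0.
have th1 : th < 1 by apply: pow2_lt1; lra.
exists (1 - th)^-1; first by rewrite invr_ge0; lra.
elim=> [|k IH]; first by rewrite big_ord0 mulr_ge0 ?powR_ge0// invr_ge0; lra.
rewrite big_ord_recr /=; apply: (le_trans (lerD IH (lexx _))).
have E : (dstep k : R) `^ (- y) = th * dstep k.+1 `^ (- y).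
  rewrite /th -powRM ?(ltW (dstep_gt0 _))//; congr (_ `^ _).
  by rewrite dstepS mulrC divfK.
rewrite E -[X in _ + X]mul1r -mulrDl mulrA; apply: ler_wpM2r; first exact: powR_ge0.
have -> : ((1 - th)^-1 + 1) * th = (1 - th)^-1 - (1 - th) by field; lra.
lra.
Qed.

(** Coefficients of [- (1 - rho) z / (1 - rho z)], which is [(1 - z) / (1 - rho z) - 1]:
    division by [1 - z], the effect of partial sums, leaves a difference of two
    Cauchy kernels. *)
Definition probe rho : nat -> R[i] :=
  fun n => if n is m.+1 then - (1 - rho)%:C * rho%:C ^+ m else 0.

Lemma partial_sums_probe rho n : partial_sums (probe rho) n = rho%:C ^+ n - 1.
Proof.
rewrite /partial_sums; elim: n => [|n IH]; first by rewrite big_ord_recr big_ord0 /= add0r subrr.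
have E : (1 - rho)%:C = 1 - rho%:C :> R[i] by rewrite rmorphB.
by rewrite big_ord_recr /= IH E exprS; ring.
Qed.

Lemma tame_const_scale c rho : 0 <= rho < 1 -> tame c -> tame (fun n => c n * rho%:C ^+ n).
Proof.
move=> /andP[r0 r1] tc; apply: tame_scale => //.
by rewrite normc_real ger0_norm// ltW.
Qed.

Lemma shift_deriv_probe rho :
  shift_deriv (probe rho) = fun n => - (1 - rho)%:C * (partial_sums ones n * rho%:C ^+ n).
Proof.
apply/funext => n; rewrite /shift_deriv /probe /partial_sums /ones sumr_const card_ord.
by rewrite mulrCA.
Qed.

Lemma tame_probe rho : 0 <= rho < 1 -> tame (probe rho).
Proof.
move=> hr; apply: tame_cons; apply: tameZ.
have := tame_const_scale hr (@tame_ones R).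
by rewrite /ones; under eq_fun do rewrite mul1r.
Qed.

Lemma circ_probe rho r t : 0 <= rho < 1 -> 0 <= r < 1 ->
  normc (circ (shift_deriv (probe rho)) r t) = (1 - rho) * cauchy_norm (rho * r) t ^+ 2.
Proof.
move=> hrho hr; have tp := tame_partial_sums (@tame_ones R).
have /andP[h0 h1] := hrho; have /andP[r0 r1] := hr.
rewrite circE shift_deriv_probe psumZ; [|exact: tame_const_scale|by rewrite normc_rcis].
have E : rho%:C * (r%:C * cis t) = (rho * r)%:C * cis t by rewrite rmorphM mulrA.
have n1 : normc ((rho * r)%:C * cis t) < 1.
  by rewrite normc_rcis ?mulr_ge0// mulr_ilt1.
rewrite psum_scale E psum_partial_sums//; last exact: tame_ones.
rewrite psum_ones// normcM normcN normc_real ger0_norm ?subr_ge0 ?(ltW h1)//.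
by congr (_ * _); rewrite normcM normcV /cauchy_norm expr2.
Qed.

(** The derivative of the probe is [- (1 - rho) / (1 - rho z)^2]. The number [m] is
    to be [1 - rho] or [1 - r], whichever is the larger. *)
Lemma probe_mean p : 1 < p -> exists2 C, 0 <= C & forall rho r m, 0 <= rho < 1 -> 0 <= r < 1 ->
  0 < m -> m <= 1 - rho * r ->
  Mp p (shift_deriv (probe rho)) r `^ p <= C * ((1 - rho) `^ p * m `^ (1 - 2 * p)).
Proof.
move=> p1; have [|C C0 HC] := @cauchy_norm_mean R (2 * p); first lra.
exists C => // rho r m hrho hr m0 hm.
have /andP[h0 h1] := hrho; have /andP[r0 r1] := hr.
have hrr : 0 <= rho * r < 1 by rewrite mulr_ge0// mulr_ilt1.
have cc : continuous (cauchy_norm (rho * r)) by exact: continuous_cauchy_norm.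
rewrite /Mp power_meanK; last lra.
have -> : (fun t => normc (circ (shift_deriv (probe rho)) r t) `^ p) =
          (fun t => (1 - rho) `^ p * cauchy_norm (rho * r) t `^ (2 * p)).
  apply/funext => t; rewrite circ_probe// powRM ?exprn_ge0 ?subr_ge0 ?cauchy_norm_ge0 ?(ltW h1)//.
  by rewrite -powR_mulrn ?cauchy_norm_ge0// -powRrM.
rewrite circle_avgZ; last first.
  by apply: continuous_powR => //; [lra|move=> t; exact: cauchy_norm_ge0].
rewrite mulrCA; apply: ler_wpM2l; first exact: powR_ge0.
apply: le_trans (HC _ hrr) _; apply: ler_wpM2l => //.
rewrite -[1 - 2 * p]opprK !(powRN _ (- (1 - 2 * p))).
have m1 : 0 < 1 - rho * r by lra.
rewrite lef_pV2 ?posrE ?powR_gt0//; apply: ge0_ler_powR; rewrite ?nnegrE; lra.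
Qed.

Lemma dstepD i j : (dstep (i + j) : R) = dstep i * dstep j.
Proof. by rewrite /dstep exprD. Qed.

Lemma dsum_mono p a c J1 J2 : (J1 <= J2)%N -> dsum p a c J1 <= dsum p a c J2.
Proof.
move=> /subnKC <-; rewrite /dsum big_split_ord /= lerDl; apply: sumr_ge0 => j _.
by rewrite mulr_ge0 ?powR_ge0.
Qed.

(** On radii below [drad k] the estimate by [1 - r] is used, and [a < 2 * p - 2] makes
    the terms grow geometrically; beyond, the estimate by [1 - rho], and [-1 < a] makes
    them decrease. *)
Lemma probe_dsum p a : 1 < p -> -1 < a -> a < 2 * p - 2 ->
  exists2 C, 0 <= C & forall k J, dsum p a (shift_deriv (probe (drad k))) J <= C * dstep k `^ (a + 2 - p).
Proof.
move=> p1 a1 a2; have [C C0 HC] := probe_mean p1.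
have [|C1 C10 HC1] := @sum_dstepN_le (2 * p - 2 - a); first lra.
have [|C2 C20 HC2] := @sum_dstep_le R (a + 1); first lra.
exists (C * (C1 + C2)) => [|k J]; first by rewrite mulr_ge0// addr_ge0.
apply: le_trans (_ : dsum p a (shift_deriv (probe (drad k))) (k + J) <= _).
  by apply: dsum_mono; exact: leq_addl.
have dk := @dstep_gt0 R k.
have one_sub j : 1 - drad j = dstep j :> R by rewrite /drad; ring.
have rk := @drad01 R k; have /andP[rk0 rk1] := rk.
have maxm j : dstep j <= 1 - drad k * drad j :> R /\ dstep k <= 1 - drad k * drad j :> R.
  have /andP[rj0 rj1] := @drad01 R j; have := one_sub j; have := one_sub k.
  have : drad k * drad j <= drad j :> R by apply: ler_piMl => //; lra.
  have : drad k * drad j <= drad k :> R by apply: ler_piMr => //; lra.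
  by move=> *; split; lra.
have X0 : dstep k `^ (a + 2 - p) = dstep k `^ p * dstep k `^ (a + 2 - 2 * p).
  by rewrite -powR_addr_exp//; congr (_ `^ _); ring.
rewrite /dsum big_split_ord /= X0 -mulrA mulrDl mulrDr; apply: lerD.
  apply: le_trans (_ : C * (dstep k `^ p * \sum_(j < k) dstep j `^ (- (2 * p - 2 - a))) <= _); last first.
    apply: ler_wpM2l => //; rewrite mulrCA; apply: ler_wpM2l; first exact: powR_ge0.
    by apply: le_trans (HC1 k) _; rewrite (_ : - (2 * p - 2 - a) = a + 2 - 2 * p)//; ring.
  rewrite !mulr_sumr; apply: ler_sum => j _; have dj := @dstep_gt0 R j.
  have [m1 _] := maxm j.
  have := HC (drad k) (drad j) (dstep j) rk (drad01 j) dj m1; rewrite one_sub => h.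
  apply: le_trans (ler_wpM2l (powR_ge0 _ _) h) _.
  rewrite (_ : - (2 * p - 2 - a) = (a + 1) + (1 - 2 * p)); last by ring.
  rewrite (powR_addr_exp _ _ dj) le_eqVlt; apply/orP; left; apply/eqP; ring.
apply: le_trans (_ : C * (dstep k `^ p * (dstep k `^ (a + 2 - 2 * p) * \sum_(j < J) dstep j `^ (a + 1))) <= _); last first.
  apply: ler_wpM2l => //; rewrite [leRHS]mulrCA; apply: ler_wpM2l; first exact: powR_ge0.
  by rewrite mulrC; apply: ler_wpM2r; [exact: powR_ge0|exact: HC2].
rewrite !mulr_sumr; apply: ler_sum => j _; have dj := @dstep_gt0 R j.
have [_ m1] := maxm (k + j)%N.
have := HC (drad k) (drad (k + j)%N) (dstep k) rk (drad01 _) dk m1; rewrite one_sub => h.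
apply: le_trans (ler_wpM2l (powR_ge0 _ _) h) _.
rewrite dstepD powRM ?(ltW dk) ?(ltW dj)// (_ : a + 2 - 2 * p = (a + 1) + (1 - 2 * p)); last by ring.
rewrite (powR_addr_exp _ _ dk) le_eqVlt; apply/orP; left; apply/eqP; ring.
Qed.

(** The operator maps the probe to [g(rho z) - g(z)]. Its derivative compares [g'] on
    one dyadic circle with [g'] on a circle inside the preceding one. *)
Lemma symbol_increment p eta k : 1 <= p -> tame eta ->
  Mp p (shift_deriv eta) (drad k.+1) <= Mp p (shift_deriv eta) (drad k) +
    Mp p (shift_deriv (rhaly_coef eta (probe (drad k)))) (drad k.+1).
Proof.
move=> p1 te; have p0 : 0 < p by lra.
have td := tame_deriv te; have rk := @drad01 R k; have rk1 := @drad01 R k.+1.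
have /andP[k0 k1] := rk; have /andP[s0 s1] := rk1.
set h := shift_deriv (rhaly_coef _ _).
have th : tame h by apply: tame_deriv; apply: tame_rhaly => //; exact: tame_probe.
have ts := tame_const_scale rk td.
have rr : 0 <= (drad k * drad k.+1 : R) < 1 by rewrite mulr_ge0// mulr_ilt1.
have E t : circ (shift_deriv eta) (drad k.+1) t =
    (drad k)%:C * circ (shift_deriv eta) (drad k * drad k.+1) t - circ h (drad k.+1) t.
  have z1 : normc ((drad k.+1)%:C * cis t) < 1 by rewrite normc_rcis.
  have hE : h = fun n => (drad k)%:C * (shift_deriv eta n * (drad k)%:C ^+ n) - shift_deriv eta n.
    apply/funext => n; rewrite /h /shift_deriv /rhaly_coef partial_sums_probe exprS.
    by ring.
  rewrite !circE hE psumB//; last exact: tameZ.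
  rewrite psumZ// psum_scale mulrA -rmorphM; ring.
have cA r : 0 <= r < 1 -> continuous (fun t => normc (circ (shift_deriv eta) r t)).
  by move=> hr; apply: continuous_normc; exact: continuous_circ.
have cH : continuous (fun t => normc (circ h (drad k.+1) t)).
  by apply: continuous_normc; exact: continuous_circ.
have A0 r t : 0 <= normc (circ (shift_deriv eta) r t) by exact: normc_ge0.
have H0 t : 0 <= normc (circ h (drad k.+1) t) by exact: normc_ge0.
apply: le_trans (_ : power_mean p (fun t => normc (circ (shift_deriv eta) (drad k * drad k.+1) t) +
   normc (circ h (drad k.+1) t)) <= _).
  apply: power_mean_le => //; first exact: cA.
  - by apply: continuousDf => //; exact: cA.
  move=> t; rewrite E; apply: le_trans (le_normcD _ _) _; rewrite normcN lerD2r normcM normc_real.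
  by rewrite ger0_norm// ler_piMl// ltW.
apply: le_trans (minkowski_mean p1 (A0 _) H0 (cA _ rr) cH) _.
rewrite lerD2r; apply: Mp_le => //; first by case/andP: rr.
by rewrite ler_piMr// ltW.
Qed.

Lemma telescope phi psi N m : (forall k, phi k.+1 <= phi k + psi k) ->
  phi (N + m)%N <= phi N + \sum_(i < m) psi (N + i)%N.
Proof.
move=> H; elim: m => [|m IH]; first by rewrite big_ord0 addn0 addr0.
by rewrite addnS big_ord_recr addrA /=; apply: le_trans (H _) _; rewrite lerD2r.
Qed.

(** Since [s < 1] the bounds of the increments grow geometrically, so their sums are
    comparable with the last of them. *)
Lemma increments_big_O phi psi s K : s < 1 -> 0 <= K -> (forall k, 0 <= phi k) ->
  (forall k, phi k.+1 <= phi k + psi k) -> (forall k, psi k <= K * dstep k `^ (s - 1)) ->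
  exists2 C, 0 <= C & forall k, phi k <= C * dstep k `^ (s - 1).
Proof.
move=> s1 K0 phi0 H HK; have [|C C0 HC] := @sum_dstepN_le (1 - s); first lra.
rewrite opprB in HC; exists (phi 0%N + K * C); first by rewrite addr_ge0// mulr_ge0.
move=> k; have := telescope 0 k H; rewrite add0n => /le_trans; apply.
rewrite mulrDl; apply: lerD.
  by rewrite ler_peMr// dstep_pow_ge1// subr_le0 ltW.
rewrite -mulrA; apply: le_trans (ler_wpM2l K0 (HC k)).
by rewrite mulr_sumr; apply: ler_sum => i _; rewrite add0n.
Qed.

(** As in the previous lemma from an index [N] on; the value at [N] is negligible
    because the weights tend to infinity. *)
Lemma increments_little_o phi psi s : s < 1 ->
  (forall k, phi k.+1 <= phi k + psi k) ->
  (forall e, 0 < e -> exists N, forall k, (N <= k)%N -> psi k <= e * dstep k `^ (s - 1)) ->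
  forall e, 0 < e -> exists N, forall k, (N <= k)%N -> phi k <= e * dstep k `^ (s - 1).
Proof.
move=> s1 H Hpsi e e0; have [|C C0 HC] := @sum_dstepN_le (1 - s); first lra.
rewrite opprB in HC; have e1 : 0 < e / (2 * (C + 1)) by rewrite divr_gt0//; lra.
have [N HN] := Hpsi _ e1.
pose B := `|phi N| + 1; have B0 : 0 < B by rewrite ltr_wpDl.
have y0 : 0 < (e / (2 * B)) `^ (1 - s)^-1 by rewrite powR_gt0// divr_gt0// mulr_gt0.
have [M HM] := dstep_small y0.
exists (N + M)%N => k hk.
have [m Ek] : exists m, k = (N + m)%N by exists (k - N)%N; rewrite subnKC// (leq_trans _ hk)// leq_addr.
have dk := @dstep_gt0 R k.
have D : dstep k `^ (1 - s) <= e / (2 * B).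
  have -> : e / (2 * B) = ((e / (2 * B)) `^ (1 - s)^-1) `^ (1 - s).
    rewrite -powRrM mulVf ?powRr1//; last lra.
    by rewrite divr_ge0// ?ltW// mulr_gt0.
  apply: ge0_ler_powR; rewrite ?nnegrE ?(ltW dk) ?powR_ge0//; first lra.
  apply: le_trans HM; have := @drad_le R M k; rewrite /drad => h.
  by have := h (leq_trans (leq_addl _ _) hk); lra.
have P : phi N <= e / 2 * dstep k `^ (s - 1).
  rewrite -opprB powRN ler_pdivlMr ?powR_gt0//.
  apply: le_trans (_ : B * dstep k `^ (1 - s) <= _).
    by apply: ler_wpM2r; [exact: powR_ge0|rewrite /B; apply: le_trans (ler_norm _) _; rewrite lerDl].
  apply: le_trans (ler_wpM2l (ltW B0) D) _.
  by rewrite le_eqVlt; apply/orP; left; apply/eqP; field; lra.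
rewrite Ek; apply: le_trans (telescope N m H) _; rewrite -Ek.
have S : \sum_(i < m) psi (N + i)%N <= e / 2 * dstep k `^ (s - 1).
  apply: le_trans (_ : e / (2 * (C + 1)) * (C * dstep k `^ (s - 1)) <= _); last first.
    rewrite mulrA; apply: ler_wpM2r; first exact: powR_ge0.
    have -> : e / (2 * (C + 1)) * C = e / 2 * (C / (C + 1)) by field; lra.
    apply: ler_piMr; first by lra.
    by rewrite ler_pdivrMr; lra.
  apply: le_trans (ler_wpM2l (ltW e1) (HC k)).
  rewrite Ek big_split_ord /= mulrDr; apply: ler_wpDl.
    by apply: mulr_ge0; [exact: ltW|apply: sumr_ge0 => j _; exact: powR_ge0].
  by rewrite mulr_sumr; apply: ler_sum => i _; apply: HN; exact: leq_addr.
lra.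
Qed.

End TestFunctions.

(** * Dirichlet spaces and boundedness *)

(** The [p]-th power of the norm of the Dirichlet space, as a real number. *)
HB.lock Definition energy (R : realType) (p a : R) (f : R[i] -> R[i]) : R :=
  normc (f 0) `^ p + fine (bergman_integral p a (derive1 f)).

Lemma energyE (R : realType) (p a : R) (f : R[i] -> R[i]) :
  energy p a f = normc (f 0) `^ p + fine (bergman_integral p a (derive1 f)).
Proof. by rewrite energy.unlock. Qed.

Section DirichletSpace.
Context {R : realType}.
Implicit Types (c d eta : nat -> R[i]) (p a b r s x K B : R) (f g h : R[i] -> R[i]).

Definition represents c f := tame c /\ forall z, disc z -> f z = psum c z.

Lemma bergman_ge0 p a f : (0 <= bergman_integral p a f)%E.
Proof. by apply: integral_ge0 => w _; rewrite lee_fin mulr_ge0 ?powR_ge0. Qed.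

Lemma energy_ge0 p a f : 0 <= energy p a f.
Proof. by rewrite energyE addr_ge0 ?powR_ge0// fine_ge0// bergman_ge0. Qed.

Lemma represents_psum c : tame c -> represents c (psum c).
Proof. by []. Qed.

Lemma represents_Hol c f : represents c f -> Hol f.
Proof. by move=> [tc fc]; apply/HolP; exists c. Qed.

Lemma represents_taylor f : Hol f -> represents (taylor_coef f) f.
Proof. by move=> /Hol_taylor. Qed.

Lemma represents0 c f : represents c f -> f 0 = c 0%N.
Proof. by move=> [_ ->]; [rewrite psum0|exact: disc0]. Qed.

Lemma represents_derive1 c f : represents c f -> represents (shift_deriv c) (derive1 f).
Proof. by move=> [tc fc]; split; [exact: tame_deriv|move=> z; exact: derive1_psum]. Qed.

Lemma representsB c d f g : represents c f -> represents d g ->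
  represents (fun n => c n - d n) (f \- g).
Proof.
move=> [tc fc] [td gd]; split; first exact: tameB.
by move=> z hz; rewrite /= fc// gd// psumB//; apply/discE.
Qed.

Lemma representsDZ (k : R[i]) c d f g : represents c f -> represents d g ->
  represents ((fun n => k * c n) \+ d) (k \*: f \+ g).
Proof.
move=> [tc fc] [td gd]; have tk := tameZ k tc; split; first exact: tameD.
move=> z hz; have z1 : normc z < 1 by apply/discE.
by rewrite /= fc// gd// psumD// psumZ.
Qed.

Lemma fnorm_energy p a f : carrier (dirichlet p a) f ->
  fnorm (dirichlet p a) f = (energy p a f `^ p^-1)%:E.
Proof.
move=> [_ hf]; rewrite /fnorm /=.
have E : (bergman_integral p a (derive1 f)) = (fine (bergman_integral p a (derive1 f)))%:E.
  by rewrite fineK// ge0_fin_numE// bergman_ge0.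
by rewrite energyE E -EFinD poweR_EFin.
Qed.

Lemma dsum_le_energy p a : 1 <= p -> exists2 K, 0 <= K & forall c f J, represents c f ->
  carrier (dirichlet p a) f ->
  normc (c 0%N) `^ p + dsum p a (shift_deriv c) J <= K * energy p a f.
Proof.
move=> p1; have q0 : 0 <= 4 * 2 `^ `|a| :> R by rewrite mulr_ge0// powR_ge0.
exists (1 + 4 * 2 `^ `|a|) => [|c f J cf [_ hf]]; first by rewrite addr_ge0.
have [td dc] := represents_derive1 cf.
have := dsum_le_bergman a J p1 td dc.
have E : (bergman_integral p a (derive1 f)) = (fine (bergman_integral p a (derive1 f)))%:E.
  by rewrite fineK// ge0_fin_numE// bergman_ge0.
rewrite E -EFinM lee_fin => h; rewrite energyE (represents0 cf).
have f0 : 0 <= fine (bergman_integral p a (derive1 f)) by rewrite fine_ge0// bergman_ge0.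
have m0 : 0 <= 4 * 2 `^ `|a| * normc (c 0%N) `^ p :> R by rewrite mulr_ge0// powR_ge0.
rewrite mulrDl mul1r mulrDr; lra.
Qed.

Lemma energy_le_dsum p a : 1 <= p -> exists2 K, 0 <= K & forall c f B, represents c f ->
  (forall J, dsum p a (shift_deriv c) J <= B) ->
  carrier (dirichlet p a) f /\ energy p a f <= normc (c 0%N) `^ p + K * B.
Proof.
move=> p1; have k1 := @kappa_ge1 R.
exists (2 `^ `|a| * kappa * 2 `^ (a + 1)) => [|c f B cf HB].
  by rewrite !mulr_ge0 ?powR_ge0//; lra.
have [td dc] := represents_derive1 cf.
have h := bergman_le_dsum p1 td dc HB; split.
  split; first exact: represents_Hol cf.
  by apply: le_lt_trans h _; exact: ltry.
rewrite energyE (represents0 cf) lerD2l -lee_fin fineK//.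
rewrite ge0_fin_numE ?bergman_ge0//; apply: le_lt_trans h _; exact: ltry.
Qed.

Lemma rhalyE eta f z : rhaly eta f z = psum (rhaly_coef eta (taylor_coef f)) z.
Proof.
rewrite psumE /rhaly; congr (limn (series _)); apply/funext => n.
by rewrite /rhaly_coef /partial_sums big_mkord.
Qed.

Lemma represents_rhaly eta c f : tame eta -> represents c f ->
  represents (rhaly_coef eta c) (rhaly eta f).
Proof.
move=> te [tc fc]; split; first exact: tame_rhaly.
move=> z _; rewrite rhalyE; congr psum; rewrite (_ : taylor_coef f = c)//.
by apply/funext => n; exact: taylor_coefE.
Qed.

(** [rhaly_dsum], transferred to the norms. *)
Lemma rhaly_energy p a b eta K : 1 < p -> p - 2 < a -> tame eta -> 0 <= K ->
  (forall j, Mp p (shift_deriv eta) (drad j) <= K * dstep j `^ ((a - b + 1) / p - 1)) ->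
  exists2 M, 0 <= M & forall f, carrier (dirichlet p a) f ->
    carrier (dirichlet p b) (rhaly eta f) /\ energy p b (rhaly eta f) <= M * energy p a f.
Proof.
move=> p1 a1 te K0 HK; have p1' := ltW p1.
have [C C0 HC] := rhaly_dsum p1 a1 te K0 HK.
have [K1 K10 HK1] := dsum_le_energy a p1'.
have [K2 K20 HK2] := energy_le_dsum b p1'.
exists (normc (eta 0%N) `^ p * K1 + K2 * (C * K1)) => [|f hf].
  by rewrite addr_ge0 ?mulr_ge0 ?powR_ge0.
have cf : represents (taylor_coef f) f by apply: represents_taylor; case: hf.
set c := taylor_coef f in cf *.
have B J : dsum p b (shift_deriv (rhaly_coef eta c)) J <= C * K1 * energy p a f.
  apply: (le_trans (HC c J cf.1)); rewrite -mulrA; apply: ler_wpM2l => //; exact: HK1.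
have [h1 h2] := HK2 _ _ _ (represents_rhaly te cf) B; split=> //.
apply: (le_trans h2); rewrite mulrDl; apply: lerD; last by rewrite mulrA.
rewrite /rhaly_coef /partial_sums big_ord1 normcM.
rewrite powRM ?normc_ge0// -mulrA; apply: ler_wpM2l; first exact: powR_ge0.
by have := HK1 c f 0%N cf hf; rewrite /dsum big_ord0 addr0.
Qed.

Lemma rhaly_linear p a b eta : tame eta ->
  (forall f, carrier (dirichlet p a) f -> carrier (dirichlet p b) (rhaly eta f)) ->
  linear_into (dirichlet p a) (dirichlet p b) (rhaly eta).
Proof.
move=> te H; split; first exact: H.
move=> k f h [/represents_taylor cf _] [/represents_taylor ch _] z hz.
have [tf Ef] := represents_rhaly te cf; have [th Eh] := represents_rhaly te ch.
have [_ Efh] := represents_rhaly te (representsDZ k cf ch).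
have z1 : normc z < 1 by apply/discE.
rewrite (Ef z hz) (Eh z hz) (Efh z hz).
rewrite -(psumZ k tf z1) -(psumD (tameZ k tf) th z1).
congr psum; apply/funext => n; rewrite /rhaly_coef /partial_sums /=.
by rewrite big_split /= -mulr_sumr mulrDr mulrCA.
Qed.

(** The term at [drad k.+1] of a dyadic sum is bounded by the norm of a probe; here
    the mean in it is isolated. *)
Lemma probe_mean_solve p a b M k psi : 0 < p -> 0 <= M -> 0 <= psi ->
  dstep k.+1 `^ (b + 1) * psi `^ p <= M * dstep k `^ (a + 2 - p) ->
  psi <= (2 `^ (b + 1) * M) `^ p^-1 * dstep k `^ ((a - b + 1) / p - 1) :> R.
Proof.
move=> p0 M0 psi0 h; have dk := @dstep_gt0 R k; have d1 := @dstep_gt0 R k.+1.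
have q0 : 0 <= 2 `^ (b + 1) * M by rewrite mulr_ge0// powR_ge0.
apply: (powR_le_inv p0 psi0); first by rewrite mulr_ge0 ?powR_ge0.
rewrite powRM ?powR_ge0// -!powRrM mulVf ?gt_eqF// powRr1//.
have -> : ((a - b + 1) / p - 1) * p = (a + 2 - p) + - (b + 1) by field; rewrite gt_eqF.
rewrite (powR_addr_exp _ _ dk) powRN.
have E : dstep k `^ (b + 1) = 2 `^ (b + 1) * dstep k.+1 `^ (b + 1).
  rewrite -powRM ?(ltW d1)//; congr (_ `^ _).
  by rewrite dstepS mulrC divfK.
rewrite mulrA ler_pdivlMr ?powR_gt0// E mulrCA -mulrA; apply: ler_wpM2l; first exact: powR_ge0.
by rewrite mulrC.
Qed.

Lemma probe_energy p a : 1 < p -> -1 < a -> a < 2 * p - 2 ->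
  exists2 C, 0 <= C & forall k, carrier (dirichlet p a) (psum (probe (drad k))) /\
     energy p a (psum (probe (drad k))) <= C * dstep k `^ (a + 2 - p).
Proof.
move=> p1 a1 a2; have [C C0 HC] := probe_dsum p1 a1 a2.
have [K K0 HK] := energy_le_dsum a (ltW p1).
exists (K * C) => [|k]; first exact: mulr_ge0.
have [h1 h2] := HK _ _ _ (represents_psum (tame_probe (drad01 k))) (HC k); split=> //.
apply: (le_trans h2); rewrite /probe normc0 powR0; last lra.
by rewrite add0r mulrA.
Qed.

Lemma powR_root_le p x y K : 0 < p -> 0 <= x -> 0 <= y ->
  x `^ p^-1 <= K * y `^ p^-1 -> x <= `|K| `^ p * y.
Proof.
move=> p0 x0 y0 h.
rewrite -[leLHS](powR_rootK p0 x0) -(powR_rootK p0 y0) -powRM ?powR_ge0//.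
apply: ge0_ler_powR; rewrite ?nnegrE ?mulr_ge0 ?powR_ge0 ?(ltW p0)//.
by apply: (le_trans h); apply: ler_wpM2r; [exact: powR_ge0|exact: ler_norm].
Qed.

Lemma lee_fin_mul x y K (X Y : \bar R) : X = x%:E -> Y = y%:E -> (X <= K%:E * Y)%E = (x <= K * y).
Proof. by move=> -> ->; rewrite -EFinM lee_fin. Qed.

Lemma bounded_rhaly p a b eta : 1 < p -> tame eta ->
  bounded_operator (dirichlet p a) (dirichlet p b) (rhaly eta) <->
  exists2 M, 0 <= M & forall f, carrier (dirichlet p a) f ->
    carrier (dirichlet p b) (rhaly eta f) /\ energy p b (rhaly eta f) <= M * energy p a f.
Proof.
move=> p1 te; have p0 : 0 < p by lra.
have cmp f h C : carrier (dirichlet p a) f -> carrier (dirichlet p b) h ->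
    (fnorm (dirichlet p b) h <= C%:E * fnorm (dirichlet p a) f)%E =
    (energy p b h `^ p^-1 <= C * energy p a f `^ p^-1).
  move=> /fnorm_energy hf /fnorm_energy hh; exact: lee_fin_mul hh hf.
split=> [[[Hc _] [C HC]]|[M M0 H]].
  exists (`|C| `^ p); first exact: powR_ge0.
  move=> f hf; have hr := Hc f hf; split; first exact: hr.
  have := HC f hf; rewrite (cmp f _ C hf hr) => h.
  exact (powR_root_le p0 (energy_ge0 p b (rhaly eta f)) (energy_ge0 p a f) h).
split; first by apply: (rhaly_linear te) => f hf; have [h _] := H f hf; exact h.
exists (M `^ p^-1) => f hf; have [hr h] := H f hf.
rewrite (cmp f _ _ hf hr) -powRM; [|exact: M0|exact: energy_ge0].
apply: ge0_ler_powR h; rewrite ?nnegrE.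
- by rewrite invr_ge0 ltW.
- exact: energy_ge0.
- by apply: mulr_ge0; [exact: M0|exact: energy_ge0].
Qed.

(** Testing the operator on the probes bounds the increments of the symbol, and
    these determine its growth; the converse is [rhaly_energy]. *)
Lemma bounded_rhaly_symbol p a b eta : 1 < p -> -1 < a -> p - 2 < a -> a < 2 * p - 2 ->
  a < p - 1 + b -> tame eta ->
  bounded_operator (dirichlet p a) (dirichlet p b) (rhaly eta) <->
  exists2 K, 0 <= K &
    forall k, Mp p (shift_deriv eta) (drad k) <= K * dstep k `^ ((a - b + 1) / p - 1).
Proof.
move=> p1 aN1 a1 a2 ab te; have p0 : 0 < p by lra.
have s1 : (a - b + 1) / p < 1 by rewrite ltr_pdivrMr; lra.
apply: iff_trans (bounded_rhaly a b p1 te) _; split=> [[M M0 H]|[K K0 HK]]; last first.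
  exact: rhaly_energy p1 a1 te K0 HK.
have [C C0 HC] := probe_energy p1 aN1 a2.
have [K1 K10 HK1] := dsum_le_energy b (ltW p1).
pose psi k := Mp p (shift_deriv (rhaly_coef eta (probe (drad k)))) (drad k.+1).
pose L := K1 * (M * C); have L0 : 0 <= L by rewrite !mulr_ge0.
apply: (increments_big_O s1 (powR_ge0 (2 `^ (b + 1) * L) p^-1) (psi := psi)).
- by move=> k; exact: Mp_ge0.
- by move=> k; apply: symbol_increment => //; exact: ltW.
move=> k; apply: (probe_mean_solve p0 L0); first exact: Mp_ge0.
have rw := represents_psum (tame_probe (@drad01 R k)).
have [hw ew] := HC k; have [hr er] := H _ hw.
have := HK1 _ _ k.+2 (represents_rhaly te rw) hr.
rewrite /dsum big_ord_recr /= => h.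
have S0 : 0 <= \sum_(j < k.+1) dstep j `^ (b + 1) *
    Mp p (shift_deriv (rhaly_coef eta (probe (drad k)))) (drad j) `^ p.
  by apply: sumr_ge0 => j _; rewrite mulr_ge0 ?powR_ge0.
have n0 := powR_ge0 (normc (rhaly_coef eta (probe (drad k)) 0%N)) p.
apply: (le_trans (_ : _ <= K1 * energy p b (rhaly eta (psum (probe (drad k)))))).
  by rewrite /psi; lra.
rewrite /L -!mulrA; apply: ler_wpM2l => //; apply: (le_trans er); exact: ler_wpM2l.
Qed.

End DirichletSpace.

(** * Limits along subsequences *)

Section CoefficientLimits.
Context {R : realType}.
Implicit Types (c d eta : nat -> R[i]) (p a b r s x K B e : R) (v : nat -> nat -> R[i]).

(** Compactness of a segment. *)
Lemma ultra_limit (U : set_system nat) (u : nat -> R) B : UltraFilter U ->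
  (forall n, `|u n| <= B) -> exists l, forall e, 0 < e -> U [set n | `|u n - l| < e].
Proof.
move=> UU uB.
have UF : ProperFilter (fmap u U) by apply: fmap_proper_filter.
have hB : (fmap u U) `[- B, B]%classic.
  have : U (u @^-1` `[- B, B]%classic).
    by apply: (filterS _ (@filterT _ U _)) => n _; rewrite /= in_itv /= -ler_norml; exact: uB.
  by [].
have [l [_ cl]] := @segment_compact R (- B) B (fmap u U) UF hB.
exists l => e e0; have [//|h] := in_ultra_setVsetC [set n | `|u n - l| < e] UU.
have nb : nbhs l (ball l e) by exact: nbhsx_ballx.
have FB : fmap u U (~` ball l e).
  have : U (u @^-1` (~` ball l e)) by apply: (filterS _ h) => n /= hn; rewrite /ball /= distrC.
  by [].
by have [y [h1 h2]] := cl _ _ FB nb.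
Qed.

(** The coordinatewise limits are taken along one free ultrafilter; every finite set
    of approximation conditions then holds at arbitrarily late indices, from which
    the subsequence is chosen. *)
Lemma subsequence_cvg v : (forall k, exists B, forall n, normc (v n k) <= B) ->
  exists (phi : nat -> nat) d, {homo phi : m n / (m < n)%N} /\
    forall k e, 0 < e -> exists N, forall n, (N <= n)%N -> normc (v (phi n) k - d k) <= e.
Proof.
move=> vB; have [U [UU Uoo]] := @ultraFilterLemma _ (\oo : set_system nat) _.
have [d Hd] : exists d, forall k e, 0 < e -> U [set n | normc (v n k - d k) < e].
  suff /choice[d Hd] : forall k, exists z, forall e, 0 < e -> U [set n | normc (v n k - z) < e].
    by exists d.
  move=> k; have [B HB] := vB k.
  have [|x Hx] := @ultra_limit U (fun n => Re (v n k)) B UU.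
    by move=> n; exact: le_trans (le_Re_normc _) (HB n).
  have [|y Hy] := @ultra_limit U (fun n => Im (v n k)) B UU.
    by move=> n; exact: le_trans (le_Im_normc _) (HB n).
  exists (x +i* y) => e e0; have e2 : 0 < e / 2 by rewrite divr_gt0.
  apply: filterS (filterI (Hx _ e2) (Hy _ e2)) => n [/= h1 h2].
  apply: le_lt_trans (le_normc_ReIm _) _.
  by move: h1 h2; case: (v n k) => z1 z2 /= h1 h2; rewrite [ltRHS]splitr; exact: ltrD.
have Hall j e : 0 < e -> U [set n | forall k, (k < j)%N -> normc (v n k - d k) < e].
  move=> e0; elim: j => [|j IH]; first by apply: filterS (@filterT _ U _) => n _ k.
  apply: filterS (filterI IH (Hd j e e0)) => n [/= h1 h2] k.
  by rewrite ltnS leq_eqVlt => /predU1P[->|/h1].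
have /choice[f Hf] : forall x : nat * nat, exists m, (x.1 < m)%N /\
    forall k, (k < x.2)%N -> normc (v m k - d k) < dstep x.2.
  move=> [N n] /=; have h1 : U [set m | (N < m)%N] by apply: Uoo; exists N.+1.
  by have [m [m1 m2]] := filter_ex (filterI h1 (Hall n _ (dstep_gt0 n))); exists m.
pose phi := fix phi n := if n is m.+1 then f (phi m, m.+1) else f (0, 0)%N.
exists phi, d; split.
  by apply: homo_ltn => [i j k|n]; [exact: ltn_trans|have [] := Hf (phi n, n.+1)].
move=> k e e0; have [M HM] := dstep_small e0.
exists (maxn k.+1 M) => n; rewrite geq_max => /andP[kn Mn].
have : normc (v (phi n) k - d k) < dstep n.
  case: n kn Mn => [//|n] kn Mn; exact: (Hf (phi n, n.+1)).2.
move=> /ltW /le_trans; apply; apply: le_trans HM.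
by have := @drad_le R _ _ Mn; rewrite /drad; lra.
Qed.

Lemma MpB p c d r : 1 <= p -> tame c -> tame d -> 0 <= r < 1 ->
  Mp p (fun n => c n - d n) r <= Mp p c r + Mp p d r.
Proof.
move=> p1 tc td hr; have p0 : 0 < p by lra.
have tcd := tameB tc td.
have cn c' : tame c' -> continuous (fun t => normc (circ c' r t)).
  by move=> tx; apply: continuous_normc; exact: continuous_circ.
have n0 c' t : 0 <= normc (circ c' r t) by exact: normc_ge0.
apply: le_trans (minkowski_mean p1 (n0 c) (n0 d) (cn c tc) (cn d td)).
apply: (power_mean_le p0 (cn _ tcd) (continuousDf (cn c tc) (cn d td)) (n0 _)) => t.
have z1 : normc (r%:C * cis t) < 1 by rewrite normc_rcis; case/andP: hr.
rewrite !circE psumB; [|exact: tc|exact: td|exact: z1].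
by apply: le_trans (le_normcD _ _) _; rewrite normcN.
Qed.

Lemma MpZ p (k : R[i]) c r : 0 < p -> tame c -> 0 <= r < 1 ->
  Mp p (fun n => k * c n) r = normc k * Mp p c r.
Proof.
move=> p0 tc hr; rewrite /Mp -(power_meanZ p0 (normc_ge0 k) (fun t => normc_ge0 (circ c r t))).
  congr (power_mean p _); apply/funext => t.
  have z1 : normc (r%:C * cis t) < 1 by rewrite normc_rcis; case/andP: hr.
  by rewrite !circE (psumZ k tc z1) normcM.
by apply: continuous_normc; exact: continuous_circ.
Qed.

Lemma dsumB p a c d J : 1 <= p -> tame c -> tame d ->
  dsum p a (fun n => c n - d n) J <= 2 `^ (p - 1) * (dsum p a c J + dsum p a d J).
Proof.
move=> p1 tc td; rewrite /dsum -big_split mulr_sumr; apply: ler_sum => j _.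
rewrite /= -mulrDr mulrCA; apply: ler_wpM2l; first exact: powR_ge0.
apply: le_trans (powR_add2 p1 (Mp_ge0 _ _ _) (Mp_ge0 _ _ _)).
apply: ge0_ler_powR; rewrite ?nnegrE ?addr_ge0 ?Mp_ge0//; first by lra.
by apply: MpB => //; exact: drad01.
Qed.

Lemma dsumZ p a (k : R[i]) c J : 0 < p -> tame c ->
  dsum p a (fun n => k * c n) J = normc k `^ p * dsum p a c J.
Proof.
move=> p0 tc; rewrite /dsum mulr_sumr; apply: eq_bigr => j _.
by rewrite MpZ ?drad01// powRM ?normc_ge0 ?Mp_ge0// mulrCA.
Qed.

Lemma shift_derivB c d : shift_deriv (fun n => c n - d n) = fun n => shift_deriv c n - shift_deriv d n.
Proof. by apply/funext => n; rewrite /shift_deriv mulrBr. Qed.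

Lemma shift_derivZ (k : R[i]) c : shift_deriv (fun n => k * c n) = fun n => k * shift_deriv c n.
Proof. by apply/funext => n; rewrite /shift_deriv mulrCA. Qed.

Lemma rhaly_coefB eta c d :
  rhaly_coef eta (fun n => c n - d n) = fun n => rhaly_coef eta c n - rhaly_coef eta d n.
Proof. by apply/funext => n; rewrite /rhaly_coef /partial_sums sumrB mulrBr. Qed.

(** A bound for the norm controls the coefficients on every circle, so that
    norm-bounded families are dominated. *)
Lemma coef_bound p a r : 1 <= p -> 0 <= r < 1 -> exists2 C, 0 <= C & forall c B, tame c ->
  (forall J, normc (c 0%N) `^ p + dsum p a (shift_deriv c) J <= B) ->
  forall k, normc (c k) * r ^+ k <= C * B `^ p^-1.
Proof.
move=> p1 hr; have p0 : 0 < p by lra.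
have [j /andP[_ rj]] := dyadic_bracket hr; have /andP[r0 r1] := hr.
pose D : R := (dstep j.+1 `^ (a + 1))^-1 `^ p^-1.
exists (1 + D) => [|c B tc HB k]; first by rewrite addr_ge0// powR_ge0.
have n0 := powR_ge0 (normc (c 0%N)) p; have td := tame_deriv tc.
have B0 : 0 <= B by apply: le_trans (HB 0%N); rewrite addr_ge0// dsum_ge0.
have c0 : normc (c 0%N) <= B `^ p^-1.
  apply: (powR_le_inv p0 (normc_ge0 _) (powR_ge0 _ _)); rewrite powR_rootK//.
  by apply: le_trans (HB 0%N); rewrite lerDl dsum_ge0.
have M : Mp p (shift_deriv c) (drad j.+1) <= D * B `^ p^-1.
  have dj : 0 < dstep j.+1 `^ (a + 1) :> R by rewrite powR_gt0// dstep_gt0.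
  rewrite /D -powRM ?invr_ge0 ?(ltW dj)//.
  have h0 : 0 <= (dstep j.+1 `^ (a + 1))^-1 * B by rewrite mulr_ge0// invr_ge0 ltW.
  apply: (powR_le_inv p0 (Mp_ge0 _ _ _) (powR_ge0 _ _)); rewrite powR_rootK//.
  rewrite ler_pdivlMl//; apply: le_trans (HB j.+2).
  rewrite /dsum big_ord_recr /= addrA lerDr; apply: addr_ge0 => //.
  by apply: sumr_ge0 => i _; rewrite mulr_ge0 ?powR_ge0.
rewrite mulrDl mul1r; case: k => [|k].
  by rewrite expr0 mulr1; apply: le_trans c0 _; rewrite lerDl mulr_ge0 ?powR_ge0.
apply: le_trans (_ : Mp p (shift_deriv c) (drad j.+1) <= _); last first.
  by apply: (le_trans M); rewrite lerDr powR_ge0.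
have /andP[_ d1] := @drad01 R j.+1.
apply: le_trans (Mp_le td p1 r0 (ltW rj) d1).
apply: le_trans (coef_le_Mp k p1 td hr).
rewrite /shift_deriv normcM normc_nat exprS mulrCA.
apply: le_trans (_ : 1 * (normc (c k.+1) * r ^+ k) <= _).
  by apply: ler_wpM2r; [rewrite mulr_ge0 ?exprn_ge0// normc_ge0|exact: ltW].
by rewrite -mulrA; apply: ler_wpM2r; [rewrite mulr_ge0 ?exprn_ge0// normc_ge0|rewrite ler1n].
Qed.

Lemma dsum_small p a env v J e : 1 <= p -> dominated env v -> coefwise0 v -> 0 < e ->
  exists N, forall n, (N <= n)%N -> dsum p a (v n) J <= e.
Proof.
move=> p1 dv v0 e0; have p0 : 0 < p by lra.
apply: (@sum_small R (fun n j => dstep j `^ (a + 1) * Mp p (v n) (drad j) `^ p) J _ e e0) => j e' e'0.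
have dj : 0 < dstep j `^ (a + 1) :> R by rewrite powR_gt0// dstep_gt0.
have e1 : 0 < (e' / dstep j `^ (a + 1)) `^ p^-1 by rewrite powR_gt0// divr_gt0.
have [N HN] := Mp_small p1 dv v0 (drad01 j) e1.
exists N => n /HN h; rewrite mulrC -ler_pdivlMr//.
rewrite -[leRHS](powR_rootK p0); last by rewrite ltW// divr_gt0.
by apply: ge0_ler_powR h; rewrite ?nnegrE ?Mp_ge0 ?powR_ge0// ltW.
Qed.

Lemma dominated_rhaly env eta v : tame eta -> dominated env v ->
  dominated (fun k => normc (eta k) * \sum_(i < k.+1) env i) (fun n => rhaly_coef eta (v n)).
Proof.
move=> te /dominated_partial_sums[tE HE]; split; last first.
  by move=> n k; rewrite /rhaly_coef normcM; apply: ler_wpM2l; [exact: normc_ge0|exact: HE].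
have tn : tame (fun k => (normc (eta k))%:C).
  move=> r hr; have [B HB] := te r hr; exists B => n.
  by rewrite normc_real ger0_norm ?normc_ge0.
have := tameM tn tE; congr tame; apply/funext => k.
by rewrite rmorphM.
Qed.

Lemma coefwise0_rhaly eta v : coefwise0 v -> coefwise0 (fun n => rhaly_coef eta (v n)).
Proof.
move=> /coefwise0_partial_sums H k e e0.
have n0 : 0 <= normc (eta k) by exact: normc_ge0.
have n1 : 0 < normc (eta k) + 1 by rewrite ltr_wpDl.
have [N HN] := H k _ (divr_gt0 e0 n1); exists N => n /HN h.
rewrite /rhaly_coef normcM.
apply: le_trans (_ : (normc (eta k) + 1) * (e / (normc (eta k) + 1)) <= _); last first.
  by rewrite mulrC divfK// gt_eqF.
apply: ler_pM => //; [exact: normc_ge0|by rewrite lerDl].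
Qed.

(** On the finitely many low radii the images converge to zero with their
    coefficients; on the high radii they are small with the symbol, uniformly in the
    family. *)
Lemma rhaly_dsum_small p a b eta env v B : 1 < p -> p - 2 < a -> tame eta ->
  (forall e, 0 < e -> exists N, forall k, (N <= k)%N ->
     Mp p (shift_deriv eta) (drad k) <= e * dstep k `^ ((a - b + 1) / p - 1)) ->
  dominated env v -> coefwise0 v ->
  (forall n J, normc (v n 0%N) `^ p + dsum p a (shift_deriv (v n)) J <= B) ->
  forall e, 0 < e -> exists N, forall n, (N <= n)%N -> forall J,
    dsum p b (shift_deriv (rhaly_coef eta (v n))) J <= e.
Proof.
move=> p1 a1 te Heta dv v0 HB e e0; have p1' := ltW p1; have p0 : 0 < p by lra.
have [C C0 HC] := partial_sums_estimate p1 a1.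
have B0 : 0 <= B by apply: le_trans (HB 0%N 0%N); rewrite addr_ge0 ?powR_ge0// dsum_ge0.
pose A : R := 2 `^ (p + b + 1) * (C * B) + 1.
have A0 : 0 < A by rewrite ltr_wpDl// mulr_ge0 ?powR_ge0// mulr_ge0.
have q0 : 0 < e / (2 * A) by rewrite divr_gt0// mulr_gt0.
pose k := (e / (2 * A)) `^ p^-1; have k0 : 0 < k by rewrite powR_gt0.
have [N0 HN0] := Heta k k0.
have e2 : 0 < e / 2 by rewrite divr_gt0.
have [N HN] := dsum_small b N0 p1' (dominated_deriv (dominated_rhaly te dv))
  (coefwise0_deriv (@coefwise0_rhaly eta _ v0)) e2.
exists N => n /HN h J.
apply: le_trans (_ : dsum p b (shift_deriv (rhaly_coef eta (v n))) (N0 + J) <= _).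
  by apply: dsum_mono; exact: leq_addl.
rewrite /dsum big_split_ord /= [leRHS]splitr; apply: (lerD h).
have tv := dominated_tame n dv.
apply: le_trans (_ : 2 `^ (p + b + 1) * (k `^ p * \sum_(i < J)
   (dstep (N0 + i).+1 `^ (a + 2 - p) * Mp 1 (partial_sums (v n)) (drad (N0 + i).+1) `^ p)) <= _).
  rewrite !mulr_sumr; apply: ler_sum => i _; apply: rhaly_term => //; first exact: ltW.
  by apply: HN0; rewrite leqW// leq_addr.
apply: le_trans (_ : 2 `^ (p + b + 1) * (k `^ p * (C * B)) <= _); last first.
  rewrite mulrCA /k powR_rootK ?(ltW q0)//.
  apply: le_trans (_ : e / (2 * A) * A <= _).
    by apply: ler_wpM2l; [exact: ltW|rewrite /A lerDl].
  by rewrite le_eqVlt; apply/orP; left; apply/eqP; field; rewrite gt_eqF.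
apply: ler_wpM2l; first exact: powR_ge0.
apply: ler_wpM2l; first exact: powR_ge0.
have := HC (v n) (N0 + J).+1 tv.
rewrite -(addSn N0 J) big_split_ord /= => h1.
have h2 : C * (normc (v n 0%N) `^ p + dsum p a (shift_deriv (v n)) (N0.+1 + J).+2) <= C * B.
  exact: ler_wpM2l.
apply: le_trans (le_trans h1 h2); rewrite lerDr.
by apply: sumr_ge0 => i _; rewrite mulr_ge0 ?powR_ge0.
Qed.

End CoefficientLimits.

(** * Sufficiency for compactness *)

Section Compactness.
Context {R : realType}.
Implicit Types (c d eta : nat -> R[i]) (p a b r s x K B e : R) (f g h : R[i] -> R[i]).

Lemma root_cvg0P p (x : nat -> R) (X : nat -> \bar R) : 0 < p -> (forall n, 0 <= x n) ->
  (forall n, X n = (x n `^ p^-1)%:E) ->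
  X @ \oo --> 0%E <-> forall e, 0 < e -> exists N, forall n, (N <= n)%N -> x n <= e.
Proof.
move=> p0 x0 /funext ->; have pV : 0 < p^-1 by rewrite invr_gt0.
split=> [/fine_cvgP[_ /cvgrPdist_le H] e e0|H].
  have q0 : 0 < e `^ p^-1 by rewrite powR_gt0.
  have [N _ HN] := H _ q0; exists N => n /HN /=; rewrite sub0r normrN ger0_norm ?powR_ge0// => h.
  rewrite -(powR_rootK p0 (x0 n)) -[leRHS](powR_rootK p0 (ltW e0)).
  by apply: ge0_ler_powR h; rewrite ?nnegrE ?powR_ge0// ltW.
apply/fine_cvgP; split; first exact: nearW.
apply/cvgrPdist_le => e e0; have [N HN] := H _ (powR_gt0 p e0).
exists N => // n /HN h; rewrite /= sub0r normrN ger0_norm ?powR_ge0//.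
apply: (powR_le_inv p0 (powR_ge0 _ _) (ltW e0)).
by rewrite powR_rootK.
Qed.

Lemma fnorm_cvg0P p a (F : nat -> R[i] -> R[i]) : 0 < p ->
  (forall n, carrier (dirichlet p a) (F n)) ->
  (fun n => fnorm (dirichlet p a) (F n)) @ \oo --> 0%E <->
  forall e, 0 < e -> exists N, forall n, (N <= n)%N -> energy p a (F n) <= e.
Proof.
move=> p0 HF; apply: (root_cvg0P p0 (fun n => energy_ge0 p a (F n))) => n.
exact: fnorm_energy (HF n).
Qed.

Lemma carrierB p a f g : 1 <= p -> carrier (dirichlet p a) f -> carrier (dirichlet p a) g ->
  carrier (dirichlet p a) (f \- g).
Proof.
move=> p1 hf hg; have [K K0 HK] := dsum_le_energy a p1; have [K' K'0 HK'] := energy_le_dsum a p1.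
have cf : represents (taylor_coef f) f by case: hf => /represents_taylor.
have cg : represents (taylor_coef g) g by case: hg => /represents_taylor.
suff H J : dsum p a (shift_deriv (fun n => taylor_coef f n - taylor_coef g n)) J <=
    2 `^ (p - 1) * (K * energy p a f + K * energy p a g).
  by have [] := HK' _ _ _ (representsB cf cg) H.
rewrite shift_derivB; apply: le_trans (dsumB _ _ p1 (tame_deriv cf.1) (tame_deriv cg.1)) _.
apply: ler_wpM2l; first exact: powR_ge0.
apply: lerD.
  by apply: le_trans (HK _ _ J cf hf); rewrite lerDr; exact: powR_ge0.
by apply: le_trans (HK _ _ J cg hg); rewrite lerDr; exact: powR_ge0.
Qed.

(** A bounded sequence has a coefficientwise limit along a subsequence. The limit
    stays in the space, because finite dyadic sums pass to the limit, and the
    differences satisfy [rhaly_dsum_small]. *)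
Lemma compact_of_little p a b eta : 1 < p -> p - 2 < a -> tame eta ->
  (exists2 M, 0 <= M & forall f, carrier (dirichlet p a) f ->
    carrier (dirichlet p b) (rhaly eta f) /\ energy p b (rhaly eta f) <= M * energy p a f) ->
  (forall e, 0 < e -> exists N, forall k, (N <= k)%N ->
     Mp p (shift_deriv eta) (drad k) <= e * dstep k `^ ((a - b + 1) / p - 1)) ->
  compact_operator (dirichlet p a) (dirichlet p b) (rhaly eta).
Proof.
move=> p1 a1 te [M M0 HM] Heta; have p1' := ltW p1; have p0 : 0 < p by lra.
split; first by apply: (rhaly_linear te) => f hf; have [h _] := HM f hf; exact h.
move=> u hu [B0 HB0].
have [K K0 HK] := dsum_le_energy a p1'; have [K' K'0 HK'] := energy_le_dsum a p1'.
have [L L0 HL] := energy_le_dsum b p1'.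
pose c n := taylor_coef (u n).
have cu n : represents (c n) (u n) by have [/represents_taylor] := hu n.
have eu n : energy p a (u n) <= `|B0| `^ p.
  have := HB0 n; rewrite (fnorm_energy (hu n)) lee_fin => h.
  rewrite -[leRHS]mulr1; apply: (powR_root_le p0 (energy_ge0 p a (u n)) ler01).
  by rewrite powR1E mulr1.
pose B := K * `|B0| `^ p.
have HB n J : normc (c n 0%N) `^ p + dsum p a (shift_deriv (c n)) J <= B.
  apply: (le_trans (HK _ _ J (cu n) (hu n))); exact: ler_wpM2l.
have [env [tenv denv]] : exists env, dominated env c.
  apply: uniformly_tame_dominated => r hr; have [C C0 HC] := coef_bound a p1' hr.
  by exists (C * B `^ p^-1) => n k; apply: HC (HB n) k; exact: (cu n).1.
have [|phi [d [phi_mono Hd]]] := @subsequence_cvg _ c.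
  by move=> k; exists (env k) => n; exact: denv.
have env0 k : 0 <= env k by apply: le_trans (denv 0%N k); exact: normc_ge0.
have dd k : normc (d k) <= env k.
  apply/ler_addgt0Pr => e e0; have [N HN] := Hd k e e0.
  have -> : d k = c (phi N) k - (c (phi N) k - d k) by ring.
  apply: le_trans (le_normcD _ _) _; rewrite normcN; apply: lerD; first exact: denv.
  exact: HN.
have td : tame d.
  move=> r hr; have [E HE] := tenv r hr; exists E => k; apply: le_trans (HE k).
  rewrite normc_real ger0_norm//; apply: ler_wpM2r; last exact: dd.
  by rewrite exprn_ge0//; case/andP: hr.
pose v n k := c (phi n) k - d k.
have dv : dominated (fun k => 2 * env k) v.
  split; last first.
    move=> n k; apply: le_trans (le_normcD _ _) _; rewrite normcN mulr_natl mulr2n.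
    by apply: lerD; [exact: denv|exact: dd].
  have := tameZ 2%:C tenv; congr tame; apply/funext => k.
  by rewrite rmorphM.
have v0 : coefwise0 v by move=> k e e0; exact: Hd.
have tv n : tame (v n) := dominated_tame n dv.
have dB J : dsum p a (shift_deriv d) J <= 2 `^ (p - 1) * (B + 1).
  have [n /(_ n (leqnn n)) Hn] :=
    dsum_small a J p1' (dominated_deriv dv) (coefwise0_deriv v0) ltr01.
  have -> : d = fun k => c (phi n) k - v n k by apply/funext => k; rewrite /v opprB addrC subrK.
  rewrite shift_derivB.
  apply: le_trans (dsumB _ _ p1' (tame_deriv (cu (phi n)).1) (tame_deriv (tv n))) _.
  apply: ler_wpM2l; first exact: powR_ge0.
  apply: lerD Hn; apply: le_trans (HB (phi n) J).
  by rewrite lerDr powR_ge0.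
have rd := represents_psum td.
have [hd _] := HK' _ _ _ rd dB.
pose B' := (2 * env 0%N) `^ p + 2 `^ (p - 1) * (B + 2 `^ (p - 1) * (B + 1)).
have vB n J : normc (v n 0%N) `^ p + dsum p a (shift_deriv (v n)) J <= B'.
  apply: lerD.
    apply: ge0_ler_powR (dv.2 n 0%N); rewrite ?nnegrE ?mulr_ge0 ?normc_ge0//; exact: ltW.
  rewrite /v shift_derivB.
  apply: le_trans (dsumB _ _ p1' (tame_deriv (cu (phi n)).1) (tame_deriv td)) _.
  apply: ler_wpM2l; first exact: powR_ge0.
  apply: lerD (dB J); apply: le_trans (HB (phi n) J).
  by rewrite lerDr powR_ge0.
have [hh _] := HM _ hd.
exists phi, (rhaly eta (psum d)); split; [exact: phi_mono|exact: hh|].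
have hR n : carrier (dirichlet p b) (rhaly eta (u (phi n)) \- rhaly eta (psum d)).
  have [h _] := HM _ (hu (phi n)); exact (carrierB p1' h hh).
apply (proj2 (fnorm_cvg0P p0 hR)) => e e0.
have rR n : represents (rhaly_coef eta (v n)) (rhaly eta (u (phi n)) \- rhaly eta (psum d)).
  rewrite /v rhaly_coefB.
  exact (representsB (represents_rhaly te (cu (phi n))) (represents_rhaly te rd)).
have e2 : 0 < e / 2 by rewrite divr_gt0.
have L1 : 0 < L + 1 by lra.
have [N1 HN1] := rhaly_dsum_small p1 a1 te Heta dv v0 vB (divr_gt0 e2 L1).
have [N2 HN2] := coefwise0_rhaly eta v0 0%N (powR_gt0 p^-1 e2).
exists (maxn N1 N2) => n; rewrite geq_max => /andP[/HN1 h1 /HN2 h2].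
have [_ h] := HL _ _ _ (rR n) h1; apply: (le_trans h); rewrite [leRHS]splitr; apply: lerD.
  rewrite -[leRHS](powR_rootK p0 (ltW e2)).
  by apply: ge0_ler_powR h2; rewrite ?nnegrE ?powR_ge0 ?normc_ge0// ltW.
rewrite mulrCA ler_piMr ?(ltW e2)// ler_pdivrMr// mul1r; lra.
Qed.

End Compactness.

(** * Necessity for compactness *)

Section CompactNecessity.
Context {R : realType}.
Implicit Types (c d eta : nat -> R[i]) (p a b r s x K B e : R) (f g h : R[i] -> R[i]).

Lemma normc_1BX_le rho n : 0 <= rho <= 1 -> normc (rho%:C ^+ n - 1 : R[i]) <= n%:R * (1 - rho).
Proof.
move=> /andP[r0 r1].
have -> : (rho%:C ^+ n - 1 : R[i]) = (rho ^+ n - 1)%:C by rewrite rmorphB rmorphXn.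
have rn : rho ^+ n <= 1 by rewrite exprn_ile1.
rewrite normc_real distrC ger0_norm ?subr_ge0//.
elim: n {rn} => [|n IH]; first by rewrite expr0 subrr mul0r.
have rn : rho ^+ n <= 1 by rewrite exprn_ile1.
have rn0 : 0 <= rho ^+ n by rewrite exprn_ge0.
have -> : 1 - rho ^+ n.+1 = (1 - rho ^+ n) + rho ^+ n * (1 - rho) by rewrite exprSr; ring.
rewrite -natr1 mulrDl mul1r; apply: (lerD IH); apply: ler_piMl => //; lra.
Qed.

Lemma powR_dstep_small x e : 0 < x -> 0 < e -> exists N, forall k, (N <= k)%N -> dstep k `^ x <= e :> R.
Proof.
move=> x0 e0; have q0 : 0 < e `^ x^-1 by rewrite powR_gt0.
have [N HN] := dstep_small q0; exists N => k Nk.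
rewrite -[leRHS](powR_rootK x0 (ltW e0)).
apply: ge0_ler_powR; rewrite ?nnegrE ?powR_ge0 ?(ltW x0) ?(ltW (dstep_gt0 _))//.
apply: le_trans HN; have := @drad_le R _ _ Nk; rewrite /drad; lra.
Qed.

(** The probes, divided by the order of their norm. *)
Definition unit_probe p a k : nat -> R[i] :=
  fun n => (dstep k `^ (- ((a + 2 - p) / p)))%:C * probe (drad k) n.

Lemma tame_unit_probe p a k : tame (unit_probe p a k).
Proof. by apply: tameZ; apply: tame_probe; exact: drad01. Qed.

Lemma unit_probe_powR p a k : 0 < p ->
  (dstep k `^ (- ((a + 2 - p) / p))) `^ p * dstep k `^ (a + 2 - p) = 1 :> R.
Proof.
move=> p0; rewrite -powRrM -powR_addr_exp ?dstep_gt0//.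
by rewrite mulNr divfK ?gt_eqF// addNr powRr0.
Qed.

Lemma unit_probe_energy p a : 1 < p -> -1 < a -> a < 2 * p - 2 ->
  exists2 C, 0 <= C & forall k, carrier (dirichlet p a) (psum (unit_probe p a k)) /\
     energy p a (psum (unit_probe p a k)) <= C.
Proof.
move=> p1 a1 a2; have p0 : 0 < p by lra.
have [C C0 HC] := probe_dsum p1 a1 a2.
have [K K0 HK] := energy_le_dsum a (ltW p1).
exists (K * C) => [|k]; first exact: mulr_ge0.
have l0 := powR_ge0 (dstep k) (- ((a + 2 - p) / p)) : 0 <= _ :> R.
have D J : dsum p a (shift_deriv (unit_probe p a k)) J <= C.
  have tp := tame_deriv (tame_probe (@drad01 R k)).
  rewrite /unit_probe shift_derivZ (dsumZ _ _ _ p0 tp) normc_real (ger0_norm l0).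
  apply: le_trans (ler_wpM2l (powR_ge0 _ _) (HC k J)) _.
  by rewrite mulrCA (unit_probe_powR _ _ p0) mulr1.
have [h1 h2] := HK _ _ _ (represents_psum (@tame_unit_probe p a k)) D; split; first exact: h1.
apply: (le_trans h2); rewrite /unit_probe /probe mulr0 normc0 powR0; last by rewrite gt_eqF.
by rewrite add0r.
Qed.

(** The normalizing factor [dstep k `^ (- ((a + 2 - p) / p))] tends to infinity, but
    the [m]-th partial sum of the probe is at most [m * dstep k], and
    [a < 2 * p - 2] lets the product tend to zero. *)
Lemma rhaly_unit_probe_small p a eta m e : 0 < p -> a < 2 * p - 2 -> 0 < e ->
  exists N, forall k, (N <= k)%N -> normc (rhaly_coef eta (unit_probe p a k) m) <= e.
Proof.
move=> p0 a2 e0.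
have x0 : 0 < 1 - (a + 2 - p) / p by rewrite subr_gt0 ltr_pdivrMr//; lra.
have n0 : 0 <= normc (eta m) * m%:R by rewrite mulr_ge0// normc_ge0.
have n1 : 0 < normc (eta m) * m%:R + 1 by lra.
have [N HN] := powR_dstep_small x0 (divr_gt0 e0 n1); exists N => k /HN h.
have -> : rhaly_coef eta (unit_probe p a k) m =
    eta m * ((dstep k `^ (- ((a + 2 - p) / p)))%:C * ((drad k)%:C ^+ m - 1)).
  rewrite -partial_sums_probe /rhaly_coef; congr (_ * _).
  by rewrite /partial_sums -mulr_sumr.
have /andP[r0 r1] := @drad01 R k.
rewrite !normcM normc_real (ger0_norm (powR_ge0 _ _)).
apply: le_trans (_ : normc (eta m) * (dstep k `^ (- ((a + 2 - p) / p)) * (m%:R * dstep k)) <= _).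
  apply: ler_wpM2l; first exact: normc_ge0.
  apply: ler_wpM2l; first exact: powR_ge0.
  rewrite (_ : dstep k = 1 - drad k); last by rewrite /drad; ring.
  by apply: normc_1BX_le; rewrite r0 ltW.
have E : dstep k `^ (- ((a + 2 - p) / p)) * dstep k = dstep k `^ (1 - (a + 2 - p) / p) :> R.
  rewrite -[X in _ * X](powRr1 (ltW (dstep_gt0 k))) -(powR_addr_exp _ _ (dstep_gt0 k)).
  by rewrite [_ + 1]addrC.
have -> : normc (eta m) * (dstep k `^ (- ((a + 2 - p) / p)) * (m%:R * dstep k)) =
   normc (eta m) * m%:R * dstep k `^ (1 - (a + 2 - p) / p) by rewrite -E; ring.
apply: le_trans (ler_wpM2l n0 h) _.
rewrite mulrCA ler_piMr ?(ltW e0)// ler_pdivrMr// mul1r; lra.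
Qed.

(** Otherwise there are normalized probes with parameters tending to one whose
    images stay away from zero in norm. Along a subsequence the images converge in
    norm, hence coefficientwise, and the limit can only be zero: a contradiction. *)
Lemma little_of_compact p a b eta : 1 < p -> -1 < a -> p - 2 < a -> a < 2 * p - 2 ->
  a < p - 1 + b -> tame eta ->
  compact_operator (dirichlet p a) (dirichlet p b) (rhaly eta) ->
  forall e, 0 < e -> exists N, forall k, (N <= k)%N ->
     Mp p (shift_deriv eta) (drad k) <= e * dstep k `^ ((a - b + 1) / p - 1).
Proof.
move=> p1 aN1 a1 a2 ab te [[Hc _] Hcomp]; have p0 : 0 < p by lra.
have p1' := ltW p1.
have s1 : (a - b + 1) / p < 1 by rewrite ltr_pdivrMr; lra.
pose psi k := Mp p (shift_deriv (rhaly_coef eta (probe (drad k)))) (drad k.+1).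
apply: (increments_little_o s1 (psi := psi)).
  by move=> k; exact: symbol_increment p1' te.
move=> e e0; apply: contrapT => hn.
have /choice[kap Hkap] : forall N, exists k, (N <= k)%N /\ e * dstep k `^ ((a - b + 1) / p - 1) < psi k.
  move=> N; apply: contrapT => h; apply: hn; exists N => k Nk.
  by rewrite leNgt; apply/negP => h'; apply: h; exists k.
have [C C0 HC] := unit_probe_energy p1 aN1 a2.
pose u n := psum (unit_probe p a (kap n)).
have hu n : carrier (dirichlet p a) (u n) by have [h _] := HC (kap n); exact h.
have bu : exists M : R, forall n, (fnorm (dirichlet p a) (u n) <= M%:E)%E.
  exists (C `^ p^-1) => n; rewrite (fnorm_energy (hu n)) lee_fin.
  have [_ h] := HC (kap n); apply: ge0_ler_powR h; rewrite ?nnegrE ?energy_ge0//.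
  by rewrite invr_ge0 ltW.
have [phi [h [phi_mono hh Hlim]]] := Hcomp u hu bu.
have phi_ge n : (n <= phi n)%N.
  by elim: n => // n IH; apply: leq_ltn_trans IH _; exact: phi_mono.
pose w n := rhaly_coef eta (unit_probe p a (kap (phi n))).
have ru n : represents (unit_probe p a (kap (phi n))) (u (phi n)).
  exact: represents_psum (@tame_unit_probe p a (kap (phi n))).
have rw n : represents (w n) (rhaly eta (u (phi n))) := represents_rhaly te (ru n).
have hw n : carrier (dirichlet p b) (rhaly eta (u (phi n))) := Hc _ (hu (phi n)).
have hd n : carrier (dirichlet p b) (rhaly eta (u (phi n)) \- h) := carrierB p1' (hw n) hh.
have Hsmall := proj1 (fnorm_cvg0P p0 hd) Hlim.
have rh : represents (taylor_coef h) h by case: hh => /represents_taylor.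
set d := taylor_coef h in rh.
have rd n : represents (fun m => w n m - d m) (rhaly eta (u (phi n)) \- h) := representsB (rw n) rh.
have [K K0 HK] := dsum_le_energy b p1'.
have wsmall m e' : 0 < e' -> exists N, forall n, (N <= n)%N -> normc (w n m) <= e'.
  move=> e'0; have [N HN] := rhaly_unit_probe_small eta m p0 a2 e'0.
  exists N => n Nn; apply: HN; have [hk _] := Hkap (phi n).
  exact: leq_trans (leq_trans Nn (phi_ge n)) hk.
(* The norm limit is the coefficientwise limit, by [coef_bound]. *)
have d0 m : d m = 0.
  have [|C2 C20 HC2] := @coef_bound R p b 2^-1 p1' _.
    by rewrite invr_ge0 ler0n invf_lt1// ltr1n.
  have h2 : 0 < 2^-1 ^+ m :> R by rewrite exprn_gt0// invr_gt0.
  apply: eq0_normc; apply/eqP; rewrite eq_le normc_ge0 andbT.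
  apply/ler_addgt0Pr => e' e'0; rewrite add0r.
  have e2 : 0 < e' / 2 by rewrite divr_gt0.
  pose q := e' / 2 * 2^-1 ^+ m / (C2 + 1).
  have q0 : 0 < q by rewrite divr_gt0 ?mulr_gt0//; lra.
  have qp : 0 < q `^ p / (K + 1) by rewrite divr_gt0 ?powR_gt0//; lra.
  have [N1 HN1] := wsmall m _ e2; have [N2 HN2] := Hsmall _ qp.
  pose n := maxn N1 N2.
  have hw1 := HN1 n (leq_maxl _ _); have he := HN2 n (leq_maxr _ _).
  have hB J : normc (w n 0%N - d 0%N) `^ p + dsum p b (shift_deriv (fun m => w n m - d m)) J <= q `^ p.
    apply: le_trans (HK _ _ J (rd n) (hd n)) _; apply: le_trans (ler_wpM2l K0 he) _.
    rewrite mulrCA ler_piMr ?powR_ge0// ler_pdivrMr ?mul1r; lra.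
  have := HC2 _ _ (rd n).1 hB m.
  rewrite -powRrM mulfV ?gt_eqF// powRr1 ?(ltW q0)// => hq.
  have hq' : normc (w n m - d m) <= e' / 2.
    rewrite -(ler_pM2r h2); apply: (le_trans hq); rewrite /q.
    rewrite mulrCA ler_piMr ?(ltW (mulr_gt0 e2 h2))// ler_pdivrMr ?mul1r; lra.
  have -> : d m = w n m - (w n m - d m) by ring.
  apply: le_trans (le_normcD _ _) _; rewrite normcN; lra.
(* The constant is such that [probe_mean_solve] contradicts the choice of [kap]. *)
pose M0 := e `^ p / (2 `^ (b + 1)) / 2.
have M00 : 0 < M0 by rewrite !divr_gt0 ?powR_gt0.
have K1 : 0 < K + 1 by lra.
have [N HN] := Hsmall _ (divr_gt0 M00 K1).
have he := HN N (leqnn N).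
set k := kap (phi N).
have hpsi : dstep k.+1 `^ (b + 1) * psi k `^ p <= M0 * dstep k `^ (a + 2 - p).
  have := HK _ _ k.+2 (rd N) (hd N).
  have -> : (fun m => w N m - d m) = w N by apply/funext => m; rewrite d0 subr0.
  rewrite /dsum big_ord_recr /= => hle.
  have tw := tame_deriv (tame_rhaly te (tame_probe (@drad01 R k))).
  have l0 := powR_ge0 (dstep k) (- ((a + 2 - p) / p)) : 0 <= _ :> R.
  have E : Mp p (shift_deriv (w N)) (drad k.+1) = dstep k `^ (- ((a + 2 - p) / p)) * psi k.
    have -> : w N = fun n => (dstep k `^ (- ((a + 2 - p) / p)))%:C * rhaly_coef eta (probe (drad k)) n.
      apply/funext => n; rewrite /w /rhaly_coef /partial_sums /unit_probe -/k -mulr_sumr.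
      by rewrite mulrCA.
    by rewrite shift_derivZ (MpZ _ p0 tw (drad01 k.+1)) normc_real (ger0_norm l0).
  rewrite E (powRM _ l0 (Mp_ge0 _ _ _)) in hle.
  have hle' : dstep k.+1 `^ (b + 1) * ((dstep k `^ (- ((a + 2 - p) / p))) `^ p * psi k `^ p) <= M0.
    apply: le_trans (_ : K * energy p b (rhaly eta (u (phi N)) \- h) <= _).
      apply: le_trans hle; apply: ler_wpDl; first exact: powR_ge0.
      by apply: ler_wpDl; [apply: sumr_ge0 => i _; rewrite mulr_ge0 ?powR_ge0|].
    apply: le_trans (ler_wpM2l K0 he) _.
    rewrite mulrCA ler_piMr ?(ltW M00)// ler_pdivrMr// mul1r; lra.
  have dk0 := powR_ge0 (dstep k) (a + 2 - p) : 0 <= _ :> R.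
  have := ler_wpM2r dk0 hle'.
  have -> // : dstep k.+1 `^ (b + 1) * ((dstep k `^ (- ((a + 2 - p) / p))) `^ p * psi k `^ p) * dstep k `^ (a + 2 - p) =
     dstep k.+1 `^ (b + 1) * psi k `^ p * ((dstep k `^ (- ((a + 2 - p) / p))) `^ p * dstep k `^ (a + 2 - p)).
    by ring.
  by rewrite unit_probe_powR// mulr1.
have := probe_mean_solve p0 (ltW M00) (Mp_ge0 _ _ _) hpsi.
have [_ /lt_le_trans h1] := Hkap (phi N) => /h1; apply/negP; rewrite -leNgt -/k.
apply: ler_wpM2r; first exact: powR_ge0.
apply: (powR_le_inv p0 (powR_ge0 _ _) (ltW e0)).
rewrite powR_rootK//; last by rewrite mulr_ge0 ?powR_ge0// ltW.
have ep : 0 <= e `^ p by exact: powR_ge0.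
rewrite /M0 mulrA mulrCA mulfV ?gt_eqF ?powR_gt0//; lra.
Qed.

End CompactNecessity.

(** * Rhaly operators between Dirichlet spaces *)

Theorem theorem4 (R : realType) (eta : nat -> R[i]) (g : R[i] -> R[i])
    (g_eta : expansion_on_disc eta g)
    (p a b : R) (p_gt1 : 1 < p) (a_gtN1 : -1 < a) (b_gtN1 : -1 < b)
    (a_gt : p - 2 < a) (a_lt : a < Num.min (p - 1 + b) (2 * p - 2))
    (ab_gt0 : 0 < a - b + 1) :
  let s := (a - b + 1) / p in
  (bounded_operator (dirichlet p a) (dirichlet p b) (rhaly eta)
     <-> mean_lipschitz p s g) /\
  (compact_operator (dirichlet p a) (dirichlet p b) (rhaly eta)
     <-> little_mean_lipschitz p s g).
Proof.
move=> s; move: a_lt; rewrite lt_min => /andP[ab a_lt2].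
have p0 : 0 < p by lra.
have p1 := ltW p_gt1.
have s1 : s < 1 by rewrite /s ltr_pdivrMr//; lra.
have [te g_psum] := expansion_tame g_eta.
have big := mean_lipschitzP p1 s1 te g_psum.
have bounded := bounded_rhaly_symbol p_gt1 a_gtN1 a_gt a_lt2 ab te.
split; first exact: iff_trans bounded (iff_sym big).
apply: iff_trans (iff_sym (little_mean_lipschitzP s p1 te g_psum)).
split=> [|little]; first exact: little_of_compact.
apply: (compact_of_little p_gt1 a_gt te) => //.
apply/(bounded_rhaly a b p_gt1 te)/bounded/big.
have [_ little_g] := proj2 (little_mean_lipschitzP s p1 te g_psum) little.
split; first by apply/HolP; exists eta.
by apply/eqO_exP; exists 1 => //; move/eqoP : little_g; exact.
Qed.
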